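(* A pluricomplex structure $K:\mathbb{P}^1\to\mathcal{J}(V)$ on a finite-dimensional real vector space $V$ is hypercomplex if and only if its characteristic curve is the diagonal $\{(\zeta,\zeta)\}\subset\mathbb{P}^1\times\mathbb{P}^1$.
   Context: For $\dim V=2n$, $\mathcal{J}(V)$ is the space of complex structures on $V$, regarded as an open subset of $\mathrm{Gr}_n(V^{\mathbb{C}})$ via $J\mapsto V^{1,0}(J)=\{X-iJX\}$, with tautological bundle $\mathcal{V}^{1,0}$. A pluricomplex structure on $V$ is a holomorphic map $K:\mathbb{P}^1\to\mathcal{J}(V)$ with $K^*\mathcal{V}^{1,0}\simeq\mathcal{O}(-1)\otimes\mathbb{C}^n$ and $V^{\mathbb{C}}/K^*\mathcal{V}^{1,0}\simeq\mathcal{O}(1)\otimes\mathbb{C}^n$. Write $J_\zeta=K(\zeta)$, and let $V^{1,0}_\zeta$, $V^{0,1}_\zeta$ be the spaces of $(1,0)$- and $(0,1)$-vectors for $J_\zeta$. The pluricomplex structure is hypercomplex if the $J_\zeta$, $\zeta\in\mathbb{P}^1\simeq S^2$, are the unit imaginary quaternions of a quaternionic module structure on $V$, i.e. there are $I_1,I_2,I_3$ satisfying the quaternion relations such that $K$ is the composition of an antipodal-map-preserving identification of $\mathbb{P}^1$ (antipodal map $\zeta\mapsto-1/\bar\zeta$) with the unit sphere in $\mathbb{R}^3$ and the map $(a,b,c)\mapsto aI_1+bI_2+cI_3$. The characteristic sheaf $\mathcal{F}$ of $K$ is the cokernel of the natural injection $\mathcal{W}\to\mathcal{O}\otimes V^{\mathbb{C}}$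 on $\mathbb{P}^1\times\mathbb{P}^1$, where $\mathcal{W}$ is the bundle with fibre $V^{1,0}_\zeta\oplus V^{0,1}_{-1/\bar\eta}$ at $(\zeta,\eta)$. The characteristic curve is the support of $\mathcal{F}$, as a complex subspace $(S,\mathcal{O}_S)$ defined by the annihilator ideal of $\mathcal{F}$; the statement ''is the diagonal'' is understood as an equality of complex subspaces (the diagonal with its reduced structure). *)

(* Defs.v *)
From HB Require Import structures.
From mathcomp Require Import all_boot all_order all_algebra.
From mathcomp Require Import complex.
From mathcomp Require Import all_classical all_reals all_analysis.

Set Implicit Arguments.
Unset Strict Implicit.
Unset Printing Implicit Defensive.

Import Order.TTheory GRing.Theory Num.Theory.
Import numFieldNormedType.Exports.
Local Open Scope classical_set_scope.
Local Open Scope ring_scope.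

(* The complex numbers, packed as a numClosedFieldType so that the normed
   (hence topological) structure of numFieldNormedType is found on them.
   [differentiable] between normed modules over [C R] is complex
   differentiability. *)
Definition C (R : realType) : numClosedFieldType := R[i].

(* The complex projective line C \cup {oo}; [None] is the point at infinity. *)
Definition P1 (R : realType) : Type := option (C R).

(* A holomorphic coordinate centred at [z], defined on the whole of C.
   [loc (Some 0)] is the affine chart [Some], and [loc None], w |-> 1 / w, is
   the standard chart at infinity; these two charts cover P1. *)
Definition loc (R : realType) (z : P1 R) (t : C R) : P1 R :=
  if z is Some a then Some (a + t)
  else if t == 0 then None else Some t^-1.

(* z |-> - 1 / z^* *)
Definition antipode (R : realType) (z : P1 R) : P1 R :=
  if z is Some a then (if a == 0 then None else Some (- (a^*)^-1)) else Some 0.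

Section ComplexStructures.
Variables (R : realType) (V : vectType R).

(* The complexification of V, in coordinates with respect to a real basis of V
   (which is a complex basis of V \otimes C). *)
Definition complexification := 'rV[C R]_(\dim {:V}).

Definition complexify (X : V) : complexification :=
  map_mx (real_complex R) (passmx.rVof (vbasis {:V}) X).

Definition complex_structure (J : 'End(V)) : Prop := (J \o J = - \1)%VF.

Definition V10 (J : 'End(V)) : set complexification :=
  [set v | exists X : V, v = complexify X - 'i *: complexify (J X)].

Definition V01 (J : 'End(V)) : set complexification :=
  [set v | exists X : V, v = complexify X + 'i *: complexify (J X)].

End ComplexStructures.

Section BundlesOnP1.
Variables (R : realType) (m n : nat).

(* The rows of A form a basis of the subspace E of C^m. *)
Definition is_frame (E : set 'rV[C R]_m) (A : 'M[C R]_(n, m)) : Prop :=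
  row_free A /\ (forall v, E v <-> (v <= A)%MS).

(* A map from P1 to Gr_n(C^m) is holomorphic when it lifts locally to a
   holomorphic map into the space of n-frames. *)
Definition holomorphic_to_Gr (E : P1 R -> set 'rV[C R]_m) : Prop :=
  forall z : P1 R, exists A : C R -> 'M[C R]_(n, m),
    \forall t \near (0 : C R),
      differentiable A t /\ is_frame (E (loc z t)) (A t).

(* The line bundle O(k) is given by generators e0 over C and e1 over
   P1 \ {0}, with e0 = z^(-k) e1 on the overlap: for k = -1 these are the
   sections (1, z) and (1/z, 1) of the tautological bundle. An isomorphism
   from O(k) \otimes C^n to the subbundle E of the trivial bundle C^m is thus
   a pair of holomorphic frames of E, the images of e0 \otimes C^n and
   e1 \otimes C^n, glued accordingly. *)
Definition subbundle_iso_O (k : int) (E : P1 R -> set 'rV[C R]_m) : Prop :=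
  exists A0 A1 : C R -> 'M[C R]_(n, m),
    [/\ forall z, differentiable A0 z /\ is_frame (E (Some z)) (A0 z),
        forall w, differentiable A1 w /\ is_frame (E (loc None w)) (A1 w)
      & forall z, z != 0 -> A0 z = z ^ (- k) *: A1 z^-1].

(* An isomorphism from the quotient C^m / E to O(k) \otimes C^n is a
   surjective bundle morphism from C^m to O(k) \otimes C^n with kernel E; the
   matrices B0 and B1 (acting on row vectors) represent it in the two
   trivialisations, so that (v B0) e0 = (v B1) e1 on the overlap. *)
Definition is_quotient_map (E : set 'rV[C R]_m) (B : 'M[C R]_(m, n)) : Prop :=
  row_full B /\ (forall v, E v <-> v *m B = 0).

Definition quotient_iso_O (k : int) (E : P1 R -> set 'rV[C R]_m) : Prop :=
  exists B0 B1 : C R -> 'M[C R]_(m, n),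
    [/\ forall z, differentiable B0 z /\ is_quotient_map (E (Some z)) (B0 z),
        forall w, differentiable B1 w /\ is_quotient_map (E (loc None w)) (B1 w)
      & forall z, z != 0 -> B1 z^-1 = z ^ (- k) *: B0 z].

End BundlesOnP1.

Section Pluricomplex.
Variables (R : realType) (V : vectType R).
Implicit Type K : P1 R -> 'End(V).

Definition pluricomplex (n : nat) K : Prop :=
  [/\ forall z, complex_structure (K z),
      holomorphic_to_Gr n (fun z => V10 (K z)),
      subbundle_iso_O n (- 1) (fun z => V10 (K z))
    & quotient_iso_O n 1 (fun z => V10 (K z))].

Definition quaternion_relations (I1 I2 I3 : 'End(V)) : Prop :=
  [/\ (I1 \o I1 = - \1)%VF, (I2 \o I2 = - \1)%VF, (I3 \o I3 = - \1)%VF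
    & (I1 \o I2 \o I3 = - \1)%VF].

Definition unit_sphere : set 'rV[R]_3 := [set x | \sum_i x 0 i ^+ 2 = 1].

(* P1 being compact and the sphere Hausdorff, a continuous bijection is a
   homeomorphism. *)
Definition antipodal_identification (phi : P1 R -> 'rV[R]_3) : Prop :=
  [/\ forall z, continuous (fun t : C R => phi (loc z t)),
      injective phi,
      range phi = unit_sphere
    & forall z, phi (antipode z) = - phi z].

Definition hypercomplex K : Prop :=
  exists I1 I2 I3 : 'End(V), exists phi : P1 R -> 'rV[R]_3,
    [/\ quaternion_relations I1 I2 I3,
        antipodal_identification phi
      & forall z, K z = phi z 0 0 *: I1 + phi z 0 1 *: I2 + phi z 0 2 *: I3].

(* Germs at a point (z, w) of P1 x P1 are represented by functions on
   P1 x P1, of which only the values near (z, w) matter. *)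
Definition near_at (z w : P1 R) (P : P1 R -> P1 R -> Prop) : Prop :=
  \forall t \near (0 : C R * C R), P (loc z t.1) (loc w t.2).

Definition holomorphic_at (W : normedModType (C R)) (z w : P1 R)
    (f : P1 R -> P1 R -> W) : Prop :=
  \forall t \near (0 : C R * C R),
    differentiable (fun u : C R * C R => f (loc z u.1) (loc w u.2)) t.

(* The germ s lies in the image of the stalk at (z, w) of the bundle with
   fibre V10 (K x) \oplus V01 (K (antipode y)) at (x, y). *)
Definition in_image_W K (z w : P1 R)
    (s : P1 R -> P1 R -> complexification V) : Prop :=
  exists a b : P1 R -> P1 R -> complexification V,
    [/\ holomorphic_at z w a, holomorphic_at z w b,
        near_at z w (fun x y => V10 (K x) (a x y)),
        near_at z w (fun x y => V01 (K (antipode y)) (b x y))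
      & near_at z w (fun x y => s x y = a x y + b x y)].

(* The stalk at (z, w) of the characteristic sheaf is the quotient of the
   germs of V^C-valued holomorphic functions by [in_image_W K z w]. *)
Definition in_support K (z w : P1 R) : Prop :=
  exists s : P1 R -> P1 R -> complexification V,
    holomorphic_at z w s /\ ~ in_image_W K z w s.

Definition in_annihilator K (z w : P1 R) (f : P1 R -> P1 R -> C R) : Prop :=
  forall s : P1 R -> P1 R -> complexification V,
    holomorphic_at z w s -> in_image_W K z w (fun x y => f x y *: s x y).

Definition in_diagonal_ideal (z w : P1 R) (f : P1 R -> P1 R -> C R) : Prop :=
  near_at z w (fun x y => x = y -> f x y = 0).

(* Equality of complex subspaces: same points, and same ideal in each stalk
   of the structure sheaf of P1 x P1. *)
Definition characteristic_curve_is_diagonal K : Prop :=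
  (forall z w, in_support K z w <-> z = w) /\
  (forall z w (f : P1 R -> P1 R -> C R), holomorphic_at z w f ->
     (in_annihilator K z w f <-> in_diagonal_ideal z w f)).

End Pluricomplex.

(* Main.v *)
Require Import Defs.
From HB Require Import structures.
From mathcomp Require Import all_boot all_order all_algebra.
From mathcomp Require Import complex ring lra.
From mathcomp Require Import all_classical all_reals all_analysis.

(** Write E_z for V10 (K z) and F_z for V01 (K (antipode z)), so that the
    characteristic sheaf is the cokernel of E_x + F_y at (x, y).

    Everything about E is affine.  The trivialisations of E and of its quotient
    are pairs of entire matrices glued by z, and Liouville's theorem
    ([affine_gluing]) leaves E_z the row space of P + z Q and the kernel of
    S + z T, with constant P, Q, S, T.

    If K is hypercomplex, then K (antipode z) = - K z, so F_z = E_z, and for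
    distinct x and y the square of K x - K y is a negative scalar, so E_x and
    E_y meet in 0.  Hence the rows of P and Q form a basis, and Cramer's rule
    applied to P + x Q and P + y Q writes (x - y) v, for every v, as a
    polynomial element of E_x plus one of E_y ([image_W]).  A germ f therefore
    kills the sheaf as soon as f = (x - y) g with g holomorphic.  Testing an
    annihilating f on a vector that lies in no E_x with x near the given point
    shows that f vanishes on the diagonal, and conversely a holomorphic f that
    vanishes on the diagonal is divisible by x - y ([hadamard]).

    This division is false for merely differentiable functions of a real
    variable, so it has to go through Cauchy's theory: Goursat's theorem
    ([goursat]), Cauchy's formula ([contour_dquot]), Taylor expansions with
    uniform bounds ([taylor3]), Osgood's lemma ([osgood]).  The integrals are
    limits of midpoint sums along the edges of triangles and of a square.

    Conversely, let the curve be the diagonal.  Equality of supports says that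
    E_x and F_y are complementary when x and y differ.  Fix c, a frame A of F_c
    and the quotient map B t with kernel E_(c + t): the square pencil A *m B t
    is invertible for t <> 0, and also at infinity, so its determinant is
    k t^n.  Since the curve is reduced, x - y kills the sheaf, which gives
    t B t = b t *m B t with b holomorphic and the rows of b t in F_c.  With L a
    left inverse of B 0 this reads t L B t = G t *m (A *m B t); comparing
    determinants, G 0 is invertible, hence A *m B 0 = 0 and F_c = E_c
    ([coframe_in_frame]).  So K (antipode z) = - K z, that is, K z is i on the
    rows of P + z Q and - i on those of z^* P - Q.  Solving for K z on P and Q
    exhibits it as the combination of K 0, K 1 and K (- i) whose coefficients
    are the stereographic coordinates of z ([antipodal_hypercomplex]). *)

Set Implicit Arguments.
Unset Strict Implicit.
Unset Printing Implicit Defensive.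

Import Order.TTheory GRing.Theory Num.Theory.
Import numFieldNormedType.Exports.
Local Open Scope ring_scope.

(** * The modulus and limits of sequences *)

Section Modulus.
Variable R : realType.
Local Notation K := R[i].
Implicit Types (x y z : K) (r : R).

(** The modulus as an element of R rather than of the complex field, so that
    inequalities live in a total order. *)
Definition nm z : R := ComplexField.Normc.normc z.

Lemma normE z : `|z| = real_complex R (nm z). Proof. by []. Qed.

Lemma nm_eq_le x y : x = y -> nm x <= nm y. Proof. by move->. Qed.

Lemma nm0 : nm 0 = 0. Proof. exact: ComplexField.Normc.normc0. Qed.

Lemma nm1 : nm 1 = 1. Proof. exact: ComplexField.Normc.normc1. Qed.

Lemma nmM x y : nm (x * y) = nm x * nm y.
Proof. exact: ComplexField.Normc.normcM. Qed.

Lemma nmV x : nm x^-1 = (nm x)^-1.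
Proof. exact: ComplexField.Normc.normcV. Qed.

Lemma nmX x n : nm (x ^+ n) = nm x ^+ n.
Proof. by elim: n => [|n IH]; rewrite ?expr0 ?nm1 // !exprS nmM IH. Qed.

Lemma nmN x : nm (- x) = nm x.
Proof. by apply: (@complexI R); rewrite -!normE normrN. Qed.

Lemma nmB x y : nm (x - y) = nm (y - x).
Proof. by rewrite -nmN opprB. Qed.

Lemma nmD x y : nm (x + y) <= nm x + nm y.
Proof. by rewrite -lecR rmorphD /= -!normE ler_normD. Qed.

Lemma nm_ge0 x : 0 <= nm x.
Proof. by rewrite -lecR -normE normr_ge0. Qed.

Lemma nm_eq0 x : (nm x == 0) = (x == 0).
Proof.
apply/eqP/eqP => [|->]; last exact: nm0.
exact: ComplexField.Normc.eq0_normc.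
Qed.

Lemma nm_gt0 x : (0 < nm x) = (x != 0).
Proof. by rewrite lt_def nm_ge0 nm_eq0 andbT. Qed.

Lemma nm_real r : nm (real_complex R r) = `|r|.
Proof. by rewrite /nm /= expr0n /= addr0 sqrtr_sqr. Qed.

Lemma nm_nat n : nm (n%:R) = n%:R.
Proof. by rewrite -(rmorph_nat (real_complex R)) nm_real ger0_norm. Qed.

Lemma nm_sqr z : nm z ^+ 2 = complex.Re z ^+ 2 + complex.Im z ^+ 2.
Proof. by case: z => a b; rewrite /nm /= sqr_sqrtr // addr_ge0 ?sqr_ge0. Qed.

Lemma Re_le_nm z : `|complex.Re z| <= nm z.
Proof.
rewrite -(@ler_pXn2r _ 2) ?nnegrE ?nm_ge0 ?normr_ge0 //.
by rewrite nm_sqr real_normK ?num_real // lerDl sqr_ge0.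
Qed.

Lemma Im_le_nm z : `|complex.Im z| <= nm z.
Proof.
rewrite -(@ler_pXn2r _ 2) ?nnegrE ?nm_ge0 ?normr_ge0 //.
by rewrite nm_sqr real_normK ?num_real // lerDr sqr_ge0.
Qed.

Lemma nm_le_ReIm z : nm z <= `|complex.Re z| + `|complex.Im z|.
Proof.
rewrite -(@ler_pXn2r _ 2) ?nnegrE ?nm_ge0 ?addr_ge0 //.
rewrite nm_sqr sqrrD !real_normK ?num_real //.
by rewrite addrAC lerDl mulrn_wge0 ?mulr_ge0.
Qed.

Lemma ReD x y : complex.Re (x + y) = complex.Re x + complex.Re y.
Proof. by case: x y => ? ? [? ?]. Qed.

Lemma ImD x y : complex.Im (x + y) = complex.Im x + complex.Im y.
Proof. by case: x y => ? ? [? ?]. Qed.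

Lemma ReN x : complex.Re (- x) = - complex.Re x. Proof. by case: x. Qed.

Lemma ImN x : complex.Im (- x) = - complex.Im x. Proof. by case: x. Qed.

Lemma half2 z : (z / 2 + z / 2 = z).
Proof. by field. Qed.

Lemma Re_half z : complex.Re (z / 2) = complex.Re z / 2.
Proof. by have := half2 z => /(congr1 (@complex.Re R)); rewrite ReD; lra. Qed.

Lemma Im_half z : complex.Im (z / 2) = complex.Im z / 2.
Proof. by have := half2 z => /(congr1 (@complex.Im R)); rewrite ImD; lra. Qed.

Lemma nm_half z : nm (z / 2) = nm z / 2.
Proof. by rewrite nmM nmV nm_nat. Qed.

Definition tends (u : nat -> K) (l : K) : Prop :=
  forall e : R, 0 < e -> exists N, forall m, (N <= m)%N -> nm (u m - l) <= e.

(** The limit is the supremum of the eventual lower bounds of the sequence. *)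
Lemma real_cauchy_tends (u : nat -> R) :
  (forall e, 0 < e -> exists N, forall m p, (N <= m)%N -> (N <= p)%N ->
     `|u m - u p| <= e) ->
  exists l, forall e, 0 < e -> exists N, forall m, (N <= m)%N -> `|u m - l| <= e.
Proof.
move=> cu; pose A := [set x : R | exists N, forall n, (N <= n)%N -> x <= u n]%classic.
have low e N : (forall m p, (N <= m)%N -> (N <= p)%N -> `|u m - u p| <= e) ->
  A (u N - e).
  move=> h; exists N => n Nn; have := h N n (leqnn _) Nn.
  by rewrite ler_norml => /andP[_]; lra.
have upp e N : (forall m p, (N <= m)%N -> (N <= p)%N -> `|u m - u p| <= e) ->
  ubound A (u N + e).
  move=> h x [N' hx]; pose n := maxn N N'.
  have := hx n (leq_maxr _ _); have := h n N (leq_maxl _ _) (leqnn _).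
  by rewrite ler_norml => /andP[_]; lra.
have [N1 h1] := cu 1 ltr01.
exists (sup A) => e e0; have [N h] := cu (e / 2) (divr_gt0 e0 (ltr0n _ 2)).
exists N => m Nm.
have : u N - e / 2 <= sup A.
  by apply: ub_le_sup (low _ _ h); exists (u N1 + 1); exact: upp h1.
have : sup A <= u N + e / 2.
  by apply: ge_sup; [exists (u N - e / 2); exact: low | exact: upp].
have := h m N Nm (leqnn _); rewrite !ler_norml => /andP[].
by move=> *; apply/andP; split; lra.
Qed.

Lemma cauchy_tends (u : nat -> K) :
  (forall e, 0 < e -> exists N, forall m p, (N <= m)%N -> (N <= p)%N ->
     nm (u m - u p) <= e) -> exists l, tends u l.
Proof.
move=> cu.
have [a ha] : exists l, forall e, 0 < e -> exists N, forall m, (N <= m)%N ->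
    `|complex.Re (u m) - l| <= e.
  apply: real_cauchy_tends => e e0; have [N h] := cu e e0.
  exists N => m p Nm Np; rewrite -ReN -ReD.
  exact: le_trans (Re_le_nm _) (h m p Nm Np).
have [b hb] : exists l, forall e, 0 < e -> exists N, forall m, (N <= m)%N ->
    `|complex.Im (u m) - l| <= e.
  apply: real_cauchy_tends => e e0; have [N h] := cu e e0.
  exists N => m p Nm Np; rewrite -ImN -ImD.
  exact: le_trans (Im_le_nm _) (h m p Nm Np).
exists (Complex a b) => e e0.
have e2 : 0 < e / 2 by lra.
have [N1 h1] := ha _ e2; have [N2 h2] := hb _ e2.
exists (maxn N1 N2) => m; rewrite geq_max => /andP[/h1 + /h2].
move=> hx hy; apply: le_trans (nm_le_ReIm _) _.
by rewrite ReD ImD ReN ImN /=; lra.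
Qed.

Lemma tends_uniq u l l' : tends u l -> tends u l' -> l = l'.
Proof.
move=> h h'; apply/eqP; rewrite -subr_eq0 -nm_eq0 eq_le nm_ge0 andbT.
apply/ler_addgt0Pl => e e0; rewrite addr0.
have [N hN] := h (e / 2) (divr_gt0 e0 (ltr0n _ 2)).
have [N' hN'] := h' (e / 2) (divr_gt0 e0 (ltr0n _ 2)).
have := hN (maxn N N') (leq_maxl _ _); have := hN' (maxn N N') (leq_maxr _ _).
set m := maxn _ _ => i1 i2.
have -> : l - l' = (u m - l') - (u m - l) by ring.
by apply: le_trans (nmD _ _) _; rewrite nmN; lra.
Qed.

Lemma tendsD u v l l' : tends u l -> tends v l' -> tends (fun m => u m + v m) (l + l').
Proof.
move=> h h' e e0.
have [N hN] := h (e / 2) (divr_gt0 e0 (ltr0n _ 2)).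
have [N' hN'] := h' (e / 2) (divr_gt0 e0 (ltr0n _ 2)).
exists (maxn N N') => m; rewrite geq_max => /andP[/hN i1 /hN' i2].
have -> : u m + v m - (l + l') = (u m - l) + (v m - l') by ring.
by apply: le_trans (nmD _ _) _; lra.
Qed.

Lemma tendsZ a u l : tends u l -> tends (fun m => a * u m) (a * l).
Proof.
move=> h e e0; have a0 : 0 < nm a + 1 by have := nm_ge0 a; lra.
have [N hN] := h (e / (nm a + 1)) (divr_gt0 e0 a0).
exists N => m /hN i; rewrite -mulrBr nmM.
apply: le_trans (_ : (nm a + 1) * (e / (nm a + 1)) <= _); last by rewrite mulrCA divff ?mulr1 // gt_eqF.
by apply: ler_pM => //; rewrite ?nm_ge0 // lerDl.
Qed.

Lemma tends_nm u l B : tends u l -> (forall m, nm (u m) <= B) -> nm l <= B.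
Proof.
move=> h hB; apply/ler_addgt0Pl => e e0; have [N hN] := h e e0.
have -> : l = u N - (u N - l) by ring.
apply: le_trans (nmD _ _) _; rewrite nmN.
by have := hN N (leqnn _); have := hB N; lra.
Qed.

Lemma tends_ext u v l : u =1 v -> tends u l -> tends v l.
Proof. by move=> uv h e /h[N hN]; exists N => m /hN; rewrite uv. Qed.

End Modulus.

(** * Midpoint sums and Goursat's theorem *)

Section Triangles.
Variable R : realType.
Local Notation K := R[i].
Implicit Types (p q r x z : K) (D : K -> Prop) (f g : K -> K).

Definition midpoint p q : K := (p + q) / 2.

Definition perimeter p q r : R := nm (q - p) + nm (r - q) + nm (p - r).

Definition midconvex D := forall p q, D p -> D q -> D (midpoint p q).

Definition lim_closed D :=
  forall x, (forall e : R, 0 < e -> exists2 y, D y & nm (y - x) <= e) -> D x.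

Lemma midpointC p q : midpoint p q = midpoint q p.
Proof. by rewrite /midpoint addrC. Qed.

Lemma perimeter_ge0 p q r : 0 <= perimeter p q r.
Proof. by rewrite !addr_ge0 ?nm_ge0. Qed.

Lemma perimeter_sub p q r :
  let a := midpoint p q in let b := midpoint q r in let c := midpoint p r in
  [/\ perimeter p a c = perimeter p q r / 2,
      perimeter a q b = perimeter p q r / 2,
      perimeter c b r = perimeter p q r / 2
    & perimeter b c a = perimeter p q r / 2].
Proof.
move=> a b c; rewrite /perimeter /a /b /c /midpoint; split.
- have -> : (p + q) / 2 - p = (q - p) / 2 by field.
  have -> : (p + r) / 2 - (p + q) / 2 = (r - q) / 2 by field.
  have -> : p - (p + r) / 2 = (p - r) / 2 by field.
  by rewrite !nm_half; lra.
- have -> : q - (p + q) / 2 = (q - p) / 2 by field.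
  have -> : (q + r) / 2 - q = (r - q) / 2 by field.
  have -> : (p + q) / 2 - (q + r) / 2 = (p - r) / 2 by field.
  by rewrite !nm_half; lra.
- have -> : (q + r) / 2 - (p + r) / 2 = (q - p) / 2 by field.
  have -> : r - (q + r) / 2 = (r - q) / 2 by field.
  have -> : (p + r) / 2 - r = (p - r) / 2 by field.
  by rewrite !nm_half; lra.
- have -> : (p + r) / 2 - (q + r) / 2 = - ((q - p) / 2) by field.
  have -> : (p + q) / 2 - (p + r) / 2 = - ((r - q) / 2) by field.
  have -> : (q + r) / 2 - (p + q) / 2 = - ((p - r) / 2) by field.
  by rewrite !nmN !nm_half; lra.
Qed.

(** Cousin's principle: if the property failed for a triangle, it would fail
    for one of the four triangles cut out by its midpoints, and so on; the
    failing triangles shrink to a point of D, around which the property holds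
    by assumption. Both Goursat's theorem and the convergence of midpoint sums
    are instances. *)
Theorem triangle_ind D (P : K -> K -> K -> Prop) :
  midconvex D -> lim_closed D ->
  (forall p q r, D p -> D q -> D r ->
     P p (midpoint p q) (midpoint p r) -> P (midpoint p q) q (midpoint q r) ->
     P (midpoint p r) (midpoint q r) r -> P (midpoint q r) (midpoint p r) (midpoint p q) -> P p q r) ->
  (forall x, D x -> exists2 d : R, 0 < d & forall p q r, D p -> D q -> D r ->
     perimeter p q r < d -> nm (x - p) <= perimeter p q r -> P p q r) ->
  forall p q r, D p -> D q -> D r -> P p q r.
Proof.
move=> Dmid Dlim glue small p q r Dp Dq Dr; apply: contrapT => nP.
pose bad (t : K * K * K) := [/\ D t.1.1, D t.1.2, D t.2 & ~ P t.1.1 t.1.2 t.2].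
pose per (t : K * K * K) := perimeter t.1.1 t.1.2 t.2.
have step t : exists t', bad t ->
    [/\ bad t', per t' = per t / 2 & nm (t'.1.1 - t.1.1) <= per t / 2].
  have [[D1 D2 D3 nPt]|nb] := pselect (bad t); last by exists t => /nb.
  case: t D1 D2 D3 nPt => [[p1 q1] r1] /= D1 D2 D3 nPt.
  have [e1 e2 e3 e4] := perimeter_sub p1 q1 r1.
  have [g1 g2 g3] := And3 (nm_ge0 (q1 - p1)) (nm_ge0 (r1 - q1)) (nm_ge0 (p1 - r1)).
  have [h1|h1] := pselect (P p1 (midpoint p1 q1) (midpoint p1 r1)); last first.
    exists (p1, midpoint p1 q1, midpoint p1 r1); split; rewrite /per //=; first split => //=.
    + exact: Dmid.
    + exact: Dmid.
    + by rewrite subrr nm0 divr_ge0 ?perimeter_ge0.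
  have [h2|h2] := pselect (P (midpoint p1 q1) q1 (midpoint q1 r1)); last first.
    exists (midpoint p1 q1, q1, midpoint q1 r1); split; rewrite /per //=; first split => //=.
    + exact: Dmid.
    + exact: Dmid.
    + have -> : midpoint p1 q1 - p1 = (q1 - p1) / 2 by rewrite /midpoint; field.
      by rewrite nm_half /perimeter; lra.
  have [h3|h3] := pselect (P (midpoint p1 r1) (midpoint q1 r1) r1); last first.
    exists (midpoint p1 r1, midpoint q1 r1, r1); split; rewrite /per //=; first split => //=.
    + exact: Dmid.
    + exact: Dmid.
    + have -> : midpoint p1 r1 - p1 = - ((p1 - r1) / 2) by rewrite /midpoint; field.
      by rewrite nmN nm_half /perimeter; lra.
  have [h4|h4] := pselect (P (midpoint q1 r1) (midpoint p1 r1) (midpoint p1 q1)).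
    by case: nPt; exact: glue.
  exists (midpoint q1 r1, midpoint p1 r1, midpoint p1 q1); split; rewrite /per //=; first split => //=.
  + exact: Dmid.
  + exact: Dmid.
  + exact: Dmid.
  + have -> : midpoint q1 r1 - p1 = (q1 - p1) / 2 - (p1 - r1) / 2 by rewrite /midpoint; field.
    apply: le_trans (nmD _ _) _.
    by rewrite nmN !nm_half /perimeter; lra.
have [next nextP] := choice step.
pose t := fix t k := if k is k'.+1 then next (t k') else (p, q, r).
have tbad k : bad (t k).
  elim: k => [|k IH] /=; first by split.
  by have [] := nextP _ IH.
have tper k : per (t k) = perimeter p q r / 2 ^+ k.
  elim: k => [|k IH] /=; first by rewrite expr0 divr1.
  have [_ -> _] := nextP _ (tbad k); rewrite IH exprSr invfM.
  by rewrite mulrA.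
have tdist k j : nm ((t (k + j)%N).1.1 - (t k).1.1) <= per (t k) - per (t (k + j)%N).
  elim: j => [|j IH]; first by rewrite addn0 !subrr nm0.
  rewrite addnS /=; have [_ e1 e2] := nextP _ (tbad (k + j)%N).
  set s := next _ in e1 e2 *.
  have -> : s.1.1 - (t k).1.1 = (s.1.1 - (t (k + j)%N).1.1)
     + ((t (k + j)%N).1.1 - (t k).1.1) by ring.
  by apply: le_trans (nmD _ _) _; rewrite e1; lra.
have per0 k : 0 <= per (t k) by exact: perimeter_ge0.
have tsmall e : 0 < e -> exists k, per (t k) < e.
  move=> e0; pose k := Num.bound (perimeter p q r / e).
  exists k; rewrite tper ltr_pdivrMr ?exprn_gt0 // mulrC.
  rewrite -ltr_pdivrMr //.
  apply: le_lt_trans (ler_norm _) _.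
  rewrite ger0_norm ?divr_ge0 ?perimeter_ge0 ?ltW //.
  apply: lt_trans (archi_boundP (divr_ge0 (perimeter_ge0 _ _ _) (ltW e0))) _.
  by rewrite -natrX ltr_nat; apply: ltn_expl.
have [x xlim] : exists x, tends (fun k => (t k).1.1) x.
  apply: cauchy_tends => e e0; have [k kP] := tsmall (e / 2) (divr_gt0 e0 (ltr0n _ 2)).
  exists k => m j km kj.
  have -> : (t m).1.1 - (t j).1.1 = ((t m).1.1 - (t k).1.1) - ((t j).1.1 - (t k).1.1) by ring.
  apply: le_trans (nmD _ _) _; rewrite nmN.
  have := tdist k (m - k)%N; have := tdist k (j - k)%N; rewrite !subnKC //.
  by have := per0 m; have := per0 j; lra.
have xdist k : nm (x - (t k).1.1) <= per (t k).
  have sh : tends (fun j => (t (k + j)%N).1.1 - (t k).1.1) (x - (t k).1.1).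
    move=> e /xlim[N hN]; exists N => m Nm.
    have -> : (t (k + m)%N).1.1 - (t k).1.1 - (x - (t k).1.1) = (t (k + m)%N).1.1 - x by ring.
    by apply: hN; rewrite (leq_trans Nm) // leq_addl.
  apply: tends_nm sh _ => j.
  by apply: le_trans (tdist k j) _; have := per0 (k + j)%N; lra.
have Dx : D x.
  apply: Dlim => e e0; have [k kP] := tsmall e e0.
  exists (t k).1.1; first by have [] := tbad k.
  by rewrite nmB; apply: le_trans (xdist k) (ltW kP).
have [d d0 hd] := small x Dx; have [k kP] := tsmall d d0.
by have [D1 D2 D3] := tbad k; case; exact: hd.
Qed.

(** The midpoint rule on 2 ^ m equal pieces of the segment. It is exact on
    affine functions and defined by bisection, as suits [triangle_ind]. *)
Fixpoint midsum m f p q : K :=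
  if m is m'.+1 then (midsum m' f p (midpoint p q) + midsum m' f (midpoint p q) q) / 2
  else f (midpoint p q).

Lemma midsum_rev m f p q : midsum m f p q = midsum m f q p.
Proof.
elim: m p q => [|m IH] p q /=; first by rewrite midpointC.
by rewrite [midpoint q p]midpointC (IH p) (IH _ q) addrC.
Qed.

Lemma midsum_lin m a f g p q :
  midsum m (fun z => a * f z + g z) p q = a * midsum m f p q + midsum m g p q.
Proof. by elim: m p q => [//|m IH] p q /=; rewrite !IH; field. Qed.

Lemma midsum_affine m a b p q : midsum m (fun z => a + b * z) p q = a + b * midpoint p q.
Proof. by elim: m p q => [//|m IH] p q /=; rewrite !IH /midpoint; field. Qed.

Lemma midsum_ext D m f g p q : midconvex D -> D p -> D q ->
  (forall z, D z -> f z = g z) -> midsum m f p q = midsum m g p q.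
Proof.
move=> Dm Dp Dq fg; elim: m p q Dp Dq => [|m IH] p q Dp Dq /=.
  exact/fg/Dm.
by rewrite !IH //; exact: Dm.
Qed.

Lemma midsum_bound D m f p q B : midconvex D -> D p -> D q ->
  (forall z, D z -> nm (f z) <= B) -> nm (midsum m f p q) <= B.
Proof.
move=> Dm Dp Dq fB; elim: m p q Dp Dq => [|m IH] p q Dp Dq /=.
  exact/fB/Dm.
rewrite nm_half; have Dpq := Dm _ _ Dp Dq.
have i1 := IH _ _ Dp Dpq; have i2 := IH _ _ Dpq Dq.
by have := nmD (midsum m f p (midpoint p q)) (midsum m f (midpoint p q) q); lra.
Qed.

Lemma midsum_Im_ge D m f p q B : midconvex D -> D p -> D q ->
  (forall z, D z -> B <= complex.Im (f z)) -> B <= complex.Im (midsum m f p q).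
Proof.
move=> Dm Dp Dq fB; elim: m p q Dp Dq => [|m IH] p q Dp Dq /=.
  exact/fB/Dm.
rewrite Im_half ImD; have Dpq := Dm _ _ Dp Dq.
by have i1 := IH _ _ Dp Dpq; have i2 := IH _ _ Dpq Dq; lra.
Qed.

Definition edge_sum m f p q : K := (q - p) * midsum m f p q.

Definition triangle_sum m f p q r : K := edge_sum m f p q + edge_sum m f q r + edge_sum m f r p.

Lemma edge_sum_rev m f p q : edge_sum m f p q = - edge_sum m f q p.
Proof. by rewrite /edge_sum midsum_rev -opprB mulNr. Qed.

Lemma edge_sum_split m f p q :
  edge_sum m.+1 f p q = edge_sum m f p (midpoint p q) + edge_sum m f (midpoint p q) q.
Proof. by rewrite /edge_sum /midpoint /=; field. Qed.

Lemma edge_sum_lin m a f g p q :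
  edge_sum m (fun z => a * f z + g z) p q = a * edge_sum m f p q + edge_sum m g p q.
Proof. by rewrite /edge_sum midsum_lin; ring. Qed.

Lemma edge_sum_bound D m f p q B : midconvex D -> D p -> D q ->
  (forall z, D z -> nm (f z) <= B) -> nm (edge_sum m f p q) <= nm (q - p) * B.
Proof.
move=> Dm Dp Dq fB; rewrite nmM; apply: ler_wpM2l; first exact: nm_ge0.
exact: (midsum_bound m Dm Dp Dq).
Qed.

Lemma triangle_sum_split m f p q r : let a := midpoint p q in let b := midpoint q r in let c := midpoint p r in
  triangle_sum m.+1 f p q r = triangle_sum m f p a c + triangle_sum m f a q b + triangle_sum m f c b r + triangle_sum m f b c a.
Proof.
move=> a b c; rewrite /triangle_sum !edge_sum_split -/a -/b [midpoint r p]midpointC -/c.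
rewrite (edge_sum_rev m f b c) (edge_sum_rev m f c a) (edge_sum_rev m f a b).
by ring.
Qed.

Definition has_cderiv f z l := forall e : R, 0 < e -> exists2 d : R, 0 < d &
  forall w, nm (w - z) < d -> nm (f w - f z - l * (w - z)) <= e * nm (w - z).

Definition cderivable f z := exists l, has_cderiv f z l.

Lemma ball_midconvex x (s : R) : midconvex (fun z => nm (z - x) <= s).
Proof.
move=> p q hp hq; have -> : midpoint p q - x = (p - x) / 2 + (q - x) / 2 by rewrite /midpoint; field.
by apply: le_trans (nmD _ _) _; rewrite !nm_half; lra.
Qed.

(** On a small triangle f is affine up to an error that is negligible with
    respect to the perimeter, and the sums of an affine function along a closed
    triangle cancel, so the sum of f is at most e times the squared perimeter.
    The squared perimeters of the four triangles cut out by the midpoints of a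
    triangle add up to its own, so [triangle_ind] extends this bound to all
    triangles. *)
Theorem goursat D f p q r : midconvex D -> lim_closed D ->
  (forall z, D z -> cderivable f z) -> D p -> D q -> D r ->
  tends (fun m => triangle_sum m f p q r) 0.
Proof.
move=> Dm Dl Df Dp Dq Dr.
suff main e : 0 < e -> exists N, forall m, (N <= m)%N ->
    nm (triangle_sum m f p q r) <= e * perimeter p q r ^+ 2.
  move=> e e0; pose s := perimeter p q r ^+ 2 + 1.
  have s0 : 0 < s by rewrite ltr_wpDl ?sqr_ge0.
  have [N hN] := main (e / s) (divr_gt0 e0 s0).
  exists N => m /hN; rewrite subr0 => h; apply: le_trans h _.
  rewrite mulrAC ler_pdivrMr //; apply: ler_wpM2l; first exact: ltW.
  by rewrite /s lerDl.
move=> e0; move: p q r Dp Dq Dr; apply: (triangle_ind Dm Dl).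
- move=> p q r _ _ _ [N1 h1] [N2 h2] [N3 h3] [N4 h4].
  have [e1 e2 e3 e4] := perimeter_sub p q r.
  rewrite {}e1 in h1; rewrite {}e2 in h2; rewrite {}e3 in h3; rewrite {}e4 in h4.
  pose N := maxn (maxn N1 N2) (maxn N3 N4).
  exists N.+1 => -[//|m]; rewrite ltnS !geq_max.
  move=> /andP[/andP[/h1 i1 /h2 i2] /andP[/h3 i3 /h4 i4]].
  rewrite triangle_sum_split.
  apply: le_trans (nmD _ _) _; apply: le_trans (lerD (nmD _ _) (lexx _)) _.
  apply: le_trans (lerD (lerD (nmD _ _) (lexx _)) (lexx _)) _.
  move: i1 i2 i3 i4; rewrite !expr_div_n.
  have -> : e * (perimeter p q r ^+ 2 / 2 ^+ 2) = (e * perimeter p q r ^+ 2) / 4 by field.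
  by move=> *; lra.
move=> x /Df[l hl]; have [d d0 hd] := hl (e / 2) (divr_gt0 e0 (ltr0n _ 2)).
exists (d / 2) => [|p q r _ _ _ sm close]; first by lra.
exists 0%N => m _; set s := perimeter p q r in sm close *.
have [g1 g2 g3] := And3 (nm_ge0 (q - p)) (nm_ge0 (r - q)) (nm_ge0 (p - r)).
pose B z := nm (z - x) <= 2 * s.
have Bm : midconvex B := @ball_midconvex _ _.
have s0 : 0 <= s by exact: perimeter_ge0.
have Bp : B p by rewrite /B nmB; lra.
have Bq : B q.
  rewrite /B; have -> : q - x = (q - p) - (x - p) by ring.
  by apply: le_trans (nmD _ _) _; rewrite nmN; move: close; rewrite /s /perimeter; lra.
have Br : B r.
  rewrite /B; have -> : r - x = - (p - r) - (x - p) by ring.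
  by apply: le_trans (nmD _ _) _; rewrite !nmN; move: close; rewrite /s /perimeter; lra.
pose g z := f z - f x - l * (z - x).
have gB z : B z -> nm (g z) <= e * s.
  move=> Bz; apply: le_trans (hd z _) _; first by rewrite (le_lt_trans Bz) //; lra.
  by have := ler_wpM2l (ltW (divr_gt0 e0 (ltr0n _ 2))) Bz; lra.
have fE p1 q1 : edge_sum m f p1 q1 =
    edge_sum m g p1 q1 + (q1 - p1) * (f x - l * x + l * midpoint p1 q1).
  rewrite -(midsum_affine m) -[edge_sum m g _ _]mul1r -/(edge_sum m _ p1 q1) -edge_sum_lin.
  by congr edge_sum; apply/funext => z; rewrite /g; ring.
have -> : triangle_sum m f p q r = triangle_sum m g p q r by rewrite /triangle_sum !fE /midpoint; field.
apply: le_trans (nmD _ _) _; apply: le_trans (lerD (nmD _ _) (lexx _)) _.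
have := edge_sum_bound m Bm Bp Bq gB; have := edge_sum_bound m Bm Bq Br gB.
have := edge_sum_bound m Bm Br Bp gB.
have -> : e * s ^+ 2 = nm (q - p) * (e * s) + nm (r - q) * (e * s) + nm (p - r) * (e * s).
  by rewrite /s /perimeter; ring.
by move=> i1 i2 i3; apply: lerD; first apply: lerD.
Qed.

Lemma cderivable_cont f z e : cderivable f z -> 0 < e ->
  exists2 d : R, 0 < d & forall w, nm (w - z) < d -> nm (f w - f z) <= e.
Proof.
move=> [l hl] e0; have [d d0 hd] := hl 1 ltr01.
have l0 : 0 < nm l + 1 by have := nm_ge0 l; lra.
exists (Num.min d (e / (nm l + 1))); first by rewrite lt_min d0 divr_gt0.
move=> w; rewrite lt_min => /andP[/hd h1]; rewrite ltr_pdivlMr // => h2.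
have -> : f w - f z = (f w - f z - l * (w - z)) + l * (w - z) by ring.
by apply: le_trans (nmD _ _) _; rewrite nmM; lra.
Qed.

(** The Cauchy criterion passes from the two halves of a segment to the
    segment, and holds on short segments by continuity. *)
Theorem edge_sum_tends D f p q : midconvex D -> lim_closed D ->
  (forall z, D z -> cderivable f z) -> D p -> D q ->
  exists l, tends (fun m => edge_sum m f p q) l.
Proof.
move=> Dm Dl Df Dp Dq; suff [l hl] : exists l, tends (fun m => midsum m f p q) l.
  by exists ((q - p) * l); exact: tendsZ.
apply: cauchy_tends => e e0.
suff : forall r, D r -> exists N, forall m k, (N <= m)%N -> (N <= k)%N ->
  nm (midsum m f p q - midsum k f p q) <= e by apply; exact: Dp.
move=> r Dr; move: p q r Dp Dq Dr; apply: (triangle_ind Dm Dl).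
- move=> p q r _ _ _ [N1 h1] [N2 h2] _ _.
  exists (maxn N1 N2).+1 => -[//|m] [//|k]; rewrite !ltnS !geq_max /=.
  move=> /andP[m1 m2] /andP[k1 k2].
  have i1 := h1 m k m1 k1; have i2 := h2 m k m2 k2.
  set a := midsum m f p _ in i1 *; set b := midsum m f _ q in i2 *.
  set c := midsum k f p _ in i1 *; set d := midsum k f _ q in i2 *.
  have -> : (a + b) / 2 - (c + d) / 2 = ((a - c) + (b - d)) / 2 by field.
  by rewrite nm_half; have := nmD (a - c) (b - d); lra.
move=> x /Df fx; have [d d0 hd] := cderivable_cont fx (divr_gt0 e0 (ltr0n _ 2)).
exists (d / 2) => [|p q r _ _ _ sm close]; first by lra.
exists 0%N => m k _ _; set s := perimeter p q r in sm close *.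
have [g1 g2 g3] := And3 (nm_ge0 (q - p)) (nm_ge0 (r - q)) (nm_ge0 (p - r)).
pose B z := nm (z - x) <= 2 * s.
have Bm : midconvex B := @ball_midconvex _ _.
have s0 : 0 <= s by exact: perimeter_ge0.
have Bp : B p by rewrite /B nmB; lra.
have Bq : B q.
  rewrite /B; have -> : q - x = (q - p) - (x - p) by ring.
  by apply: le_trans (nmD _ _) _; rewrite nmN; move: close; rewrite /s /perimeter; lra.
have bnd j : nm (midsum j f p q - f x) <= e / 2.
  have -> : midsum j f p q - f x = midsum j (fun z => f z - f x) p q.
    have /= := midsum_lin j 1 f (fun=> - f x) p q; rewrite mul1r.
    have -> : midsum j (fun=> - f x) p q = - f x.
      transitivity (midsum j (fun z => - f x + 0 * z) p q).
        by congr midsum; apply/funext => ?; rewrite mul0r addr0.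
      by rewrite midsum_affine mul0r addr0.
    by move=> <-; congr midsum; apply/funext => ?; rewrite mul1r.
  apply: (midsum_bound j Bm Bp Bq) => z Bz; apply: hd.
  by rewrite (le_lt_trans Bz) //; lra.
have -> : midsum m f p q - midsum k f p q = (midsum m f p q - f x) - (midsum k f p q - f x) by ring.
by apply: le_trans (nmD _ _) _; rewrite nmN; have := bnd m; have := bnd k; lra.
Qed.

End Triangles.

(** * Differentiability in terms of the modulus *)

Section Interface.
Variable R : realType.
Local Notation K := (C R).

Lemma pos_real (e : K) : 0 < e -> exists2 d : R, 0 < d & e = real_complex R d.
Proof.
by case: e => a b; rewrite ltcE /= => /andP[/eqP -> a0]; exists a.
Qed.

Lemma real_pos (d : R) : 0 < d -> (0 : K) < real_complex R d.
Proof. by move=> d0; rewrite ltcE /= eqxx. Qed.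

Lemma near1P (x : K) (P : K -> Prop) : (\forall t \near x, P t) <->
  exists2 d : R, 0 < d & forall t, nm (t - x) < d -> P t.
Proof.
split.
  move=> /nbhs_ballP[e /pos_real[d d0 ->] h]; exists d => // t td.
  by apply: h; rewrite -ball_normE /= distrC normE ltcR.
move=> [d d0 h]; apply/nbhs_ballP; exists (real_complex R d); first exact: real_pos.
move=> t; rewrite -ball_normE /= distrC normE ltcR; exact: h.
Qed.

Lemma near2P (x : K * K) (P : K * K -> Prop) : (\forall t \near x, P t) <->
  exists2 d : R, 0 < d &
    forall t, nm (t.1 - x.1) < d -> nm (t.2 - x.2) < d -> P t.
Proof.
split.
  move=> /nbhs_ballP[e /pos_real[d d0 ->] h]; exists d => // t t1 t2.
  by apply: h; split; rewrite -ball_normE /= distrC normE ltcR.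
move=> [d d0 h]; apply/nbhs_ballP; exists (real_complex R d); first exact: real_pos.
by move=> t []; rewrite -!ball_normE /= !(distrC _ t.1) !(distrC _ t.2) !normE !ltcR; exact: h.
Qed.

(** The differential is the zero map. Other functions are reduced to this case
    by subtracting their affine part. *)
Lemma little_differentiable (V : normedModType K) (h : V -> K) (x : V) :
  (forall e : K, 0 < e -> \forall u \near (0 : V), `|h (u + x) - h x| <= e * `|u|) ->
  differentiable h x.
Proof.
move=> hP.
have hl : h \o shift x = cst (h x) + (\0 : {linear V -> K}) +o_ (0 : V) id.
  apply/eqaddoP => e e0; near=> u.
  rewrite /= /cst /GRing.null_fun /= !fctE /= addr0.
  by near: u; exact: hP.
have c0 : continuous (\0 : {linear V -> K}) by apply: cst_continuous.
have dE := diff_unique c0 hl.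
by apply/diff_locallyP; rewrite dE; split.
Unshelve. all: by end_near. Qed.

Definition has_cderiv2 (f : K -> K -> K) (x y l1 l2 : K) := forall e : R, 0 < e ->
  exists2 d : R, 0 < d & forall u v, nm u < d -> nm v < d ->
    nm (f (x + u) (y + v) - f x y - l1 * u - l2 * v) <= e * (nm u + nm v).

Lemma prod_normC (t : K * K) :
  `|t| = real_complex R (Num.max (nm t.1) (nm t.2)).
Proof.
by rewrite prod_normE !normE /Order.max ltcR; case: ifP.
Qed.

Lemma cderivable_differentiable (f : K -> K) (x : K) :
  cderivable f x -> differentiable f x.
Proof.
move=> [l hl]; pose h := fun z : K => f z - l * (z - x).
have -> : f = h + (fun z => l * (z - x)) by apply/funext => z; rewrite /h !fctE; ring.
apply: differentiableD; last first.
  by apply: differentiableM.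
apply: little_differentiable => e /pos_real[d d0 ->].
have [s s0 hs] := hl d d0; apply/near1P; exists s => // u.
rewrite subr0 => us; rewrite !normE -rmorphM lecR.
have := hs (u + x); rewrite addrK => /(_ us); apply: le_trans.
by apply: nm_eq_le; rewrite /h; ring.
Qed.

Lemma differentiable_cderivable (f : K -> K) (x : K) :
  differentiable f x -> cderivable f x.
Proof.
move=> df; exists ('d f x 1) => e e0.
have [_ /eqaddoP hl] := (diff_locallyP _ _).1 df.
have /near1P[d d0 hd] := hl _ (real_pos e0).
exists d => // w wd; have := hd (w - x); rewrite subr0 => /(_ wd).
rewrite !normE -rmorphM lecR /= !fctE /= subrK.
have -> : 'd f x (w - x) = 'd f x 1 * (w - x).
  by rewrite -{1}[w - x]mulr1 linearZ /= mulrC.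
apply: le_trans; apply: nm_eq_le; rewrite /cst; ring.
Qed.

Lemma differentiable_fst (V W : normedModType K) (t : V * W) : differentiable fst t.
Proof.
have lf : linear (fst : V * W -> V) by [].
pose F : {linear (V * W)%type -> V} := HB.pack (fst : V * W -> V) (GRing.isLinear.Build K (V * W)%type V _ fst lf).
have cF : continuous F by case=> a b; exact: cvg_fst.
exact: (linear_differentiable t cF).
Qed.

Lemma differentiable_snd (V W : normedModType K) (t : V * W) : differentiable snd t.
Proof.
have lf : linear (snd : V * W -> W) by [].
pose F : {linear (V * W)%type -> W} := HB.pack (snd : V * W -> W) (GRing.isLinear.Build K (V * W)%type W _ snd lf).
have cF : continuous F by case=> a b; exact: cvg_snd.
exact: (linear_differentiable t cF).
Qed.

Lemma has_cderiv2_differentiable (f : K -> K -> K) (x y l1 l2 : K) :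
  has_cderiv2 f x y l1 l2 -> differentiable (fun t : K * K => f t.1 t.2) (x, y).
Proof.
move=> hl; pose h := fun t : K * K => f t.1 t.2 - l1 * (t.1 - x) - l2 * (t.2 - y).
have -> : (fun t : K * K => f t.1 t.2) =
    h + (fun t => l1 * (t.1 - x)) + (fun t => l2 * (t.2 - y)).
  by apply/funext => z; rewrite /h !fctE; ring.
have [d1 d2] := (@differentiable_fst K K (x, y), @differentiable_snd K K (x, y)).
apply: differentiableD; last first.
  apply: differentiableM; first exact: differentiable_cst.
  by apply: differentiableB => //; exact: differentiable_cst.
apply: differentiableD; last first.
  apply: differentiableM; first exact: differentiable_cst.
  by apply: differentiableB => //; exact: differentiable_cst.
apply: little_differentiable => e /pos_real[d d0 ->].
have [s s0 hs] := hl (d / 2) (divr_gt0 d0 (ltr0n _ 2)).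
apply/near2P; exists s => // u /=.
rewrite !subr0 => u1 u2; rewrite prod_normC normE -rmorphM lecR.
apply: le_trans (_ : d / 2 * (nm u.1 + nm u.2) <= _).
  apply: le_trans (hs _ _ u1 u2); apply: nm_eq_le.
  by rewrite /h /= ![u.1 + x]addrC ![u.2 + y]addrC; ring.
have i1 : nm u.1 <= Num.max (nm u.1) (nm u.2) by rewrite le_max lexx.
have i2 : nm u.2 <= Num.max (nm u.1) (nm u.2) by rewrite le_max lexx orbT.
by have := ler_wpM2l (ltW d0) i1; have := ler_wpM2l (ltW d0) i2; lra.
Qed.

Lemma differentiable_has_cderiv2 (f : K -> K -> K) (x y : K) :
  differentiable (fun t : K * K => f t.1 t.2) (x, y) ->
  exists l1 l2, has_cderiv2 f x y l1 l2.
Proof.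
set F := fun t => _; move=> df.
exists ('d F (x, y) (1, 0)), ('d F (x, y) (0, 1)) => e e0.
have [_ /eqaddoP hl] := (diff_locallyP _ _).1 df.
have /near2P[d d0 hd] := hl _ (real_pos e0).
exists d => // u v ud vd; have := hd (u, v); rewrite /= !subr0 => /(_ ud vd).
rewrite !normE prod_normC -rmorphM lecR /= !fctE /=.
have -> : 'd F (x, y) (u, v) = 'd F (x, y) (1, 0) * u + 'd F (x, y) (0, 1) * v.
  have -> : (u, v) = u *: (1, 0) + v *: (0, 1) :> K * K.
    rewrite [RHS]surjective_pairing /= !scaler0 addr0 add0r.
    by congr pair; rewrite [RHS]mulr1.
  by rewrite linearD !linearZ; congr (_ + _); exact: mulrC.
move=> h; apply: le_trans (le_trans h _).
  by apply: nm_eq_le; rewrite /cst /F /= ![u + x]addrC ![v + y]addrC; ring.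
apply: ler_wpM2l; first exact: ltW.
by rewrite ge_max lerDl lerDr !nm_ge0.
Qed.

End Interface.

(** * Cauchy's formula on a square and Taylor expansions *)

Section CauchyFormula.
Variable R : realType.
Local Notation K := (C R).
Implicit Types (a z h u : K) (f : K -> K) (s : R).

(** The imaginary unit as a literal pair, so that its real and imaginary parts
    compute. *)
Definition im : K := Complex 0 1.

Lemma im2 : im * im = -1.
Proof. by rewrite -expr2; exact: sqr_i. Qed.

Lemma nm_im : nm im = 1.
Proof. by rewrite /nm /= expr0n expr1n add0r sqrtr1. Qed.

Lemma im_neq0 : im != 0.
Proof. by rewrite -nm_eq0 nm_im oner_neq0. Qed.

Lemma corner_neq0 k : im ^+ k != 0.
Proof. by rewrite expf_neq0 // im_neq0. Qed.

Lemma nm_corner k : nm (im ^+ k) = 1.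
Proof. by rewrite nmX nm_im expr1n. Qed.

(** The real part of side k * z equals 1 along the edge from im ^+ k to im ^+
    k.+1: the half-planes where it is at least c separate this edge from points
    inside the square. *)
Definition side k : K := (1 - im) / im ^+ k.

Lemma nm_1Bim_sqr : nm (1 - im) ^+ 2 = 2.
Proof. by rewrite nm_sqr /=; lra. Qed.

Lemma nm_1Bim : nm (1 - im) <= 3 / 2.
Proof.
have h : nm (1 - im) ^+ 2 <= (3 / 2) ^+ 2 by rewrite nm_1Bim_sqr; lra.
by rewrite -(@ler_pXn2r _ 2) // nnegrE ?nm_ge0 //; lra.
Qed.

Lemma nm_side k : nm (side k) <= 3 / 2.
Proof. by rewrite nmM nmV nm_corner invr1 mulr1 nm_1Bim. Qed.

Lemma side_corner k : side k * im ^+ k = 1 - im.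
Proof. by rewrite divfK // corner_neq0. Qed.

Lemma side_cornerS k : side k * im ^+ k.+1 = 1 + im.
Proof.
by rewrite exprSr mulrA side_corner mulrBl mul1r im2 opprK addrC.
Qed.

Lemma Re_side_corner k : complex.Re (side k * im ^+ k) = 1.
Proof. by rewrite side_corner /= ; lra. Qed.

Lemma Re_side_cornerS k : complex.Re (side k * im ^+ k.+1) = 1.
Proof. by rewrite side_cornerS /=; lra. Qed.

Lemma Re_side_le k a : nm a <= 1 / 2 -> complex.Re (side k * a) <= 3 / 4.
Proof.
move=> ha; apply: le_trans (ler_norm _) _; apply: le_trans (Re_le_nm _) _.
rewrite nmM; have := nm_side k => hs.
by have := ler_pM (nm_ge0 _) (nm_ge0 _) hs ha; lra.
Qed.

Definition cap (al : K) (c : R) z := nm z <= 1 /\ c <= complex.Re (al * z).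

Lemma cap_midconvex al c : midconvex (cap al c).
Proof.
move=> p q [p1 p2] [q1 q2]; split.
  rewrite /midpoint nm_half; have := nmD p q; lra.
have -> : al * midpoint p q = (al * p + al * q) / 2 by rewrite /midpoint; field.
by rewrite Re_half ReD; lra.
Qed.

Lemma cap_closed al c : lim_closed (cap al c).
Proof.
move=> x hx; split; apply/ler_addgt0Pl => e e0.
  have [y [y1 _] yx] := hx e e0.
  have -> : x = y - (y - x) by ring.
  by apply: le_trans (nmD _ _) _; rewrite nmN; lra.
have a0 : 0 < nm al + 1 by have := nm_ge0 al; lra.
have [y [_ y2] yx] := hx (e / (nm al + 1)) (divr_gt0 e0 a0).
have -> : al * x = al * y - al * (y - x) by ring.
rewrite ReD ReN.
have : complex.Re (al * (y - x)) <= e.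
  apply: le_trans (ler_norm _) _; apply: le_trans (Re_le_nm _) _; rewrite nmM.
  rewrite ler_pdivlMr // in yx.
  by have := nm_ge0 (y - x); lra.
by lra.
Qed.

Lemma cap_corner k c : c <= 1 -> cap (side k) c (im ^+ k) /\ cap (side k) c (im ^+ k.+1).
Proof.
by move=> c1; split; split; rewrite ?nm_corner ?Re_side_corner ?Re_side_cornerS.
Qed.

Lemma cap_annulus k z : cap (side k) 1 z -> 1 / 2 <= nm z <= 1.
Proof.
move=> [z1 z2]; rewrite z1 andbT.
have : 1 <= nm (side k) * nm z.
  rewrite -nmM; apply: le_trans z2 _; exact: le_trans (ler_norm _) (Re_le_nm _).
have := nm_side k; have := nm_ge0 (side k); have := nm_ge0 z.
by move=> *; nra.
Qed.

(** A square rather than a circle, so that its sides are segments. *)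
Definition contour m f := \sum_(k < 4) edge_sum m f (im ^+ k) (im ^+ k.+1).

Lemma contour_lin m b f g :
  contour m (fun z => b * f z + g z) = b * contour m f + contour m g.
Proof. by rewrite /contour mulr_sumr -big_split; apply: eq_bigr => k _; exact: edge_sum_lin. Qed.

Lemma contour_ext m f g : (forall z, 1 / 2 <= nm z <= 1 -> f z = g z) ->
  contour m f = contour m g.
Proof.
move=> fg; apply: eq_bigr => k _; have [h1 h2] := cap_corner k (lexx 1).
congr (_ * _); apply: (midsum_ext m (@cap_midconvex (side k) 1) h1 h2).
by move=> z /cap_annulus; exact: fg.
Qed.

Lemma nm_cornerB k : nm (im ^+ k.+1 - im ^+ k) <= 3 / 2.
Proof.
rewrite exprSr -{2}[im ^+ k]mulr1 -mulrBr nmM nm_corner mul1r nmB.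
exact: nm_1Bim.
Qed.

Lemma contour_bound m f B : (forall z, 1 / 2 <= nm z <= 1 -> nm (f z) <= B) ->
  nm (contour m f) <= 6 * B.
Proof.
move=> fB; rewrite /contour.
have eB k : nm (edge_sum m f (im ^+ k) (im ^+ k.+1)) <= 3 / 2 * B.
  have [h1 h2] := cap_corner k (lexx 1).
  have zB z : cap (side k) 1 z -> nm (f z) <= B by move=> /cap_annulus; exact: fB.
  apply: le_trans (edge_sum_bound m (@cap_midconvex (side k) 1) h1 h2 zB) _.
  apply: ler_wpM2r; last exact: nm_cornerB.
  exact: le_trans (nm_ge0 _) (zB _ h1).
rewrite !big_ord_recr big_ord0 /= add0r.
have := eB 0%N; have := eB 1%N; have := eB 2%N; have := eB 3%N.
move=> i1 i2 i3 i4.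
apply: le_trans (nmD _ _) _; apply: le_trans (lerD (nmD _ _) (lexx _)) _.
apply: le_trans (lerD (lerD (nmD _ _) (lexx _)) (lexx _)) _.
by lra.
Qed.

Lemma tends_sum n (v : 'I_n -> nat -> K) :
  (forall k, exists l, tends (v k) l) -> exists l, tends (fun m => \sum_(k < n) v k m) l.
Proof.
elim: n v => [|n IH] v hv.
  by exists 0 => e e0; exists 0%N => m _; rewrite big_ord0 subrr nm0 ltW.
have [l1 h1] := IH (fun k => v (widen_ord (leqnSn n) k)) (fun k => hv _).
have [l2 h2] := hv ord_max.
exists (l1 + l2); apply: tends_ext (tendsD h1 h2) => m /=.
by rewrite big_ord_recr.
Qed.

Lemma contour_tends f : (forall z, 1 / 2 <= nm z <= 1 -> cderivable f z) ->
  exists l, tends (fun m => contour m f) l.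
Proof.
move=> df; apply: tends_sum => k; have [h1 h2] := cap_corner k (lexx 1).
apply: (edge_sum_tends (@cap_midconvex (side k) 1) (@cap_closed (side k) 1)) => //.
by move=> z /cap_annulus; exact: df.
Qed.

(** A substitute for the value 2 i pi of the integral of 1 / (z - a): writing y
    for side k * (z - a), the k-th edge vector divided by z - a equals 2 i / y,
    and its imaginary part is bounded below because the real part of y is. *)
Lemma contour_inv_ge m a : nm a <= 1 / 2 ->
  4 / 9 <= nm (contour m (fun z => (z - a)^-1)).
Proof.
move=> ha; apply: le_trans (le_trans (ler_norm _) (Im_le_nm _)).
have eB k : 1 / 9 <= complex.Im (edge_sum m (fun z => (z - a)^-1) (im ^+ k) (im ^+ k.+1)).
  have [h1 h2] := cap_corner k (lexx 1).
  have -> : edge_sum m (fun z => (z - a)^-1) (im ^+ k) (im ^+ k.+1) =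
     midsum m (fun z => (im ^+ k.+1 - im ^+ k) * (z - a)^-1) (im ^+ k) (im ^+ k.+1).
    have := midsum_lin m (im ^+ k.+1 - im ^+ k) (fun z => (z - a)^-1) (fun=> 0) (im ^+ k) (im ^+ k.+1).
    have -> : midsum m (fun=> 0) (im ^+ k) (im ^+ k.+1) = 0.
      transitivity (midsum m (fun z => 0 + 0 * z) (im ^+ k) (im ^+ k.+1)).
        by congr midsum; apply/funext => ?; rewrite mul0r addr0.
      by rewrite midsum_affine mul0r addr0.
    rewrite addr0 /edge_sum => <-; congr midsum; apply/funext => ?; by rewrite addr0.
  apply: (midsum_Im_ge m (@cap_midconvex (side k) 1) h1 h2) => z [z1 z2].
  set y := side k * (z - a).
  have yRe : 1 / 4 <= complex.Re y.
    by rewrite /y mulrBr ReD ReN; have := Re_side_le k ha; lra.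
  have y0 : y != 0 by apply/eqP => y0; move: yRe; rewrite y0 /=; lra.
  have za : nm (z - a) <= 3 / 2 by have := nmD z (- a); rewrite nmN; lra.
  have ny : nm y ^+ 2 <= 9 / 2.
    rewrite nmM nmM nmV nm_corner invr1 mulr1 exprMn nm_1Bim_sqr.
    by have := nm_ge0 (z - a); nra.
  have -> : (im ^+ k.+1 - im ^+ k) / (z - a) = 2 * (im * y^-1).
    have c0 := corner_neq0 k.
    have s0 : 1 - im != 0 by rewrite -nm_eq0 -sqrf_eq0 nm_1Bim_sqr pnatr_eq0.
    have za0 : z - a != 0 by apply: contraNneq y0 => e; rewrite /y e mulr0.
    have i2 : im * im = -1 := im2.
    rewrite exprSr /y /side; apply: (mulIf (mulf_neq0 s0 za0)).
    transitivity ((im ^+ k * (im - 1)) * (1 - im)); first by field.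
    transitivity (2 * (im * im ^+ k)); last by field; rewrite za0 s0 c0.
    transitivity (im ^+ k * (2 * im - 1 - im * im)); first by ring.
    by rewrite i2; ring.
  have -> : complex.Im (2 * (im * y^-1)) = 2 * (complex.Re y / nm y ^+ 2).
    rewrite nm_sqr; case: (y) => c d /=.
    by rewrite !(mul0r, mul1r, mulr0, subr0, add0r, addr0); lra.
  have y2 : 0 < nm y ^+ 2 by rewrite exprn_gt0 // nm_gt0.
  rewrite mulrA ler_pdivlMr //; lra.
rewrite /contour !big_ord_recr big_ord0 /= add0r !ImD.
by have := eB 0%N; have := eB 1%N; have := eB 2%N; have := eB 3%N; lra.
Qed.

End CauchyFormula.

Section Taylor.
Variable R : realType.
Local Notation K := (C R).
Local Notation im := (im R).
Implicit Types (a z h u : K) (f g : K -> K) (s : R).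

Lemma cderivableM f g z : cderivable f z -> cderivable g z ->
  cderivable (fun w => f w * g w) z.
Proof.
move=> /cderivable_differentiable df /cderivable_differentiable dg.
exact/differentiable_cderivable/differentiableM.
Qed.

Lemma cderivableB_cst f z b : cderivable f z -> cderivable (fun w => f w - b) z.
Proof.
move=> [l hl]; exists l => e /hl[d d0 hd]; exists d => // w /hd.
by apply: le_trans; apply: nm_eq_le; ring.
Qed.

Lemma cderivable_cst b z : cderivable (fun=> b : K) z.
Proof.
exists 0 => e e0; exists 1 => // w _; rewrite subrr mul0r subrr nm0.
by rewrite mulr_ge0 ?nm_ge0 // ltW.
Qed.

Lemma cderivable_id z : cderivable id z.
Proof.
exists 1 => e e0; exists 1 => // w _; rewrite mul1r subrr nm0.
by rewrite mulr_ge0 ?nm_ge0 // ltW.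
Qed.

Lemma cderivableV f z : f z != 0 -> cderivable f z -> cderivable (fun w => (f w)^-1) z.
Proof.
move=> f0 /cderivable_differentiable df.
exact/differentiable_cderivable/differentiableV.
Qed.

(** The value at a is 0, by the convention on division, which keeps the
    function bounded around a point a where f is derivable. *)
Definition dquot f a z := (f z - f a) / (z - a).

Lemma dquot_cderivable f a z : z != a -> cderivable f z -> cderivable (dquot f a) z.
Proof.
move=> za fz; apply: cderivableM; first exact: cderivableB_cst.
apply: cderivableV; first by rewrite subr_eq0.
exact: cderivableB_cst (cderivable_id z).
Qed.

Lemma dquot_bounded f a : cderivable f a -> exists2 d : R, 0 < d &
  exists2 B : R, 0 < B & forall z, nm (z - a) < d -> nm (dquot f a z) <= B.
Proof.
move=> [l hl]; have [d d0 hd] := hl 1 ltr01; exists d => //.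
exists (nm l + 1); first by have := nm_ge0 l; lra.
move=> z zd; have [->|za] := eqVneq z a.
  by rewrite /dquot !subrr mul0r nm0; have := nm_ge0 l; lra.
have za0 : z - a != 0 by rewrite subr_eq0.
have -> : dquot f a z = l + (f z - f a - l * (z - a)) / (z - a).
  by rewrite /dquot; field.
apply: le_trans (nmD _ _) _; apply: lerD => //.
rewrite nmM nmV ler_pdivrMr ?nm_gt0 //.
exact: hd.
Qed.

Definition shrink a s k := a + s%:C%C * (im ^+ k - a).

(** Each edge of the square spans, with its image under the homothety of centre
    a and ratio s, a trapezoid made of two triangles; each trapezoid lies in a
    half-plane that avoids a, where Goursat's theorem applies. The remaining
    sides of the trapezoids cancel in pairs around the square. *)
Lemma contour_shrink f a s : nm a <= 1 / 2 -> 0 < s < 1 ->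
  (forall z, nm z <= 1 -> z != a -> cderivable f z) ->
  tends (fun m => contour m f - \sum_(k < 4) edge_sum m f (shrink a s k) (shrink a s k.+1)) 0.
Proof.
move=> ha /andP[s0 s1] df.
have tri0 (k : nat) : tends (fun m => edge_sum m f (im ^+ k) (im ^+ k.+1)
    - edge_sum m f (shrink a s k) (shrink a s k.+1)
    + (edge_sum m f (im ^+ k.+1) (shrink a s k.+1) - edge_sum m f (im ^+ k) (shrink a s k))) 0.
  pose t := complex.Re (side R k * a).
  have t1 : t <= 3 / 4 by exact: Re_side_le.
  pose c := t + s * (1 - t).
  have c1 : c <= 1 by rewrite /c; nra.
  have [h1 h2] := cap_corner k c1.
  have capsh j : complex.Re (side R k * im ^+ j) = 1 -> cap (side R k) c (shrink a s j).
    move=> hj; split.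
      have -> : shrink a s j = (1 - s)%:C%C * a + s%:C%C * im ^+ j.
        by rewrite /shrink rmorphB rmorph1; ring.
      apply: le_trans (nmD _ _) _; rewrite !nmM nm_corner !nm_real.
      by rewrite !ger0_norm; nra.
    have -> : side R k * shrink a s j =
        side R k * a + s%:C%C * (side R k * im ^+ j - side R k * a).
      by rewrite /shrink; ring.
    have ReZ (x : K) : complex.Re (s%:C%C * x) = s * complex.Re x.
      by case: x => ? ? /=; rewrite mul0r subr0.
    by rewrite ReD ReZ ReD ReN hj /c /t.
  have h3 := capsh k (Re_side_corner R k).
  have h4 := capsh k.+1 (Re_side_cornerS R k).
  have dcap z : cap (side R k) c z -> cderivable f z.
    move=> [z1 z2]; apply: df => //; apply/eqP => za.
    by move: z2; rewrite za -/t /c; nra.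
  have g1 := goursat (@cap_midconvex _ (side R k) c) (@cap_closed _ (side R k) c) dcap h1 h2 h4.
  have g2 := goursat (@cap_midconvex _ (side R k) c) (@cap_closed _ (side R k) c) dcap h1 h4 h3.
  have := tendsD g1 g2; rewrite addr0; apply: tends_ext => m.
  rewrite /triangle_sum (edge_sum_rev m f (shrink a s k.+1) (im ^+ k)).
  rewrite (edge_sum_rev m f (shrink a s k.+1) (shrink a s k)).
  rewrite (edge_sum_rev m f (shrink a s k) (im ^+ k)).
  by ring.
have := tendsD (tendsD (tri0 0%N) (tri0 1%N)) (tendsD (tri0 2%N) (tri0 3%N)).
rewrite !addr0; apply: tends_ext => m.
rewrite /contour !big_ord_recr !big_ord0 /= !add0r.
have i4 : im ^+ 4 = im ^+ 0.
  have -> : im ^+ 4 = (im * im) * (im * im) by ring.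
  by rewrite im2; ring.
have -> : shrink a s 4 = shrink a s 0 by rewrite /shrink i4.
by rewrite i4; ring.
Qed.

(** The function is bounded around a, so its sums along a small square are
    small, and [contour_shrink] transports this to the unit square. As [dquot]
    is the difference of f z / (z - a) and f a / (z - a), this is Cauchy's
    formula. *)
Theorem contour_dquot f a : nm a <= 1 / 2 -> (forall z, nm z <= 1 -> cderivable f z) ->
  tends (fun m => contour m (dquot f a)) 0.
Proof.
move=> ha df.
have a1 : nm a <= 1 by lra.
have [d d0 [B B0 dB]] := dquot_bounded (df a a1).
move=> e e0.
(* Ratio of the small square: inside the disc where B bounds the function, and
   with perimeter at most e / B, up to constants. *)
pose s := Num.min (1 / 2) (Num.min (d / 2) (e / (12 * B))).
have s0 : 0 < s by rewrite !lt_min; apply/and3P; split; rewrite ?divr_gt0 ?mulr_gt0.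
have s2 : s <= 1 / 2 by rewrite ge_min lexx.
have sd : s <= d / 2 by rewrite !ge_min lexx orbT.
have se : s * (12 * B) <= e.
  by rewrite -ler_pdivlMr ?mulr_gt0 // !ge_min lexx !orbT.
have s01 : 0 < s < 1 by apply/andP; split=> //; lra.
have [|N hN] := contour_shrink ha s01 (f := dquot f a) _ (divr_gt0 e0 (ltr0n _ 2)).
  by move=> z z1 za; apply: dquot_cderivable => //; exact: df.
exists N => m /hN; rewrite !subr0.
set S := \sum_(k < 4) _ => h.
have shB k : nm (shrink a s k - a) <= s * (3 / 2).
  have -> : shrink a s k - a = s%:C%C * (im ^+ k - a) by rewrite /shrink; ring.
  rewrite nmM nm_real (ger0_norm (ltW s0)); apply: ler_wpM2l; first exact: ltW.
  by apply: le_trans (nmD _ _) _; rewrite nmN nm_corner; lra.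
have eB k : nm (edge_sum m (dquot f a) (shrink a s k) (shrink a s k.+1)) <= s * (3 / 2) * B.
  have bB z : nm (z - a) <= s * (3 / 2) -> nm (dquot f a z) <= B.
    by move=> hz; apply: dB; apply: le_lt_trans hz _; lra.
  apply: le_trans (edge_sum_bound m (@ball_midconvex _ a _) (shB _) (shB _) bB) _.
  apply: ler_wpM2r; first exact: ltW.
  have -> : shrink a s k.+1 - shrink a s k = s%:C%C * (im ^+ k.+1 - im ^+ k).
    by rewrite /shrink; ring.
  rewrite nmM nm_real (ger0_norm (ltW s0)); apply: ler_wpM2l; first exact: ltW.
  exact: nm_cornerB.
have SB : nm S <= s * 6 * B.
  rewrite /S !big_ord_recr big_ord0 /= add0r.
  apply: le_trans (nmD _ _) _; apply: le_trans (lerD (nmD _ _) (lexx _)) _.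
  apply: le_trans (lerD (lerD (nmD _ _) (lexx _)) (lexx _)) _.
  by have := eB 0%N; have := eB 1%N; have := eB 2%N; have := eB 3%N; lra.
have -> : contour m (dquot f a) = (contour m (dquot f a) - S) + S by ring.
by apply: le_trans (nmD _ _) _; lra.
Qed.

Lemma nmM_le (x y : K) (b c : R) : nm x <= b -> nm y <= c -> nm (x * y) <= b * c.
Proof. by move=> *; rewrite nmM; apply: ler_pM; rewrite ?nm_ge0. Qed.

Lemma nmD_le (x y : K) (b c : R) : nm x <= b -> nm y <= c -> nm (x + y) <= b + c.
Proof. by move=> *; apply: le_trans (nmD _ _) _; exact: lerD. Qed.

Lemma nmB_le (x y : K) (b c : R) : nm x <= b -> nm y <= c -> nm (x - y) <= b + c.
Proof. by move=> *; apply: nmD_le; rewrite ?nmN. Qed.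

(** Summation of the expansion 1 / (z - h) = 1 / z + h / z^2 + h^2 / z^3 + h^3
    / (z^3 (z - h)) along the contour. *)
Lemma contour_moments f h (M : R) : nm h <= 1 / 4 ->
  (forall z, 1 / 2 <= nm z <= 1 -> cderivable f z) ->
  (forall z, 1 / 2 <= nm z <= 1 -> nm (f z) <= M) ->
  exists r, nm r <= 192 * M /\ forall n0 n1 n2,
    tends (fun m => contour m (fun z => f z * z^-1 ^+ 1)) n0 ->
    tends (fun m => contour m (fun z => f z * z^-1 ^+ 2)) n1 ->
    tends (fun m => contour m (fun z => f z * z^-1 ^+ 3)) n2 ->
    tends (fun m => contour m (fun z => f z * (z - h)^-1))
      (n0 + h * n1 + h ^+ 2 * n2 + h ^+ 3 * r).
Proof.
move=> hh df fM.
pose g z := f z * (z^-1 ^+ 3 * (z - h)^-1).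
have ann z : 1 / 2 <= nm z <= 1 -> z != 0 /\ z - h != 0.
  move=> /andP[z1 _]; split; apply/eqP => z0.
    by move: z1; rewrite z0 nm0; lra.
  have : nm z <= nm (z - h) + nm h by rewrite -{1}[z](subrK h) nmD.
  by rewrite z0 nm0; lra.
have zhi z : 1 / 2 <= nm z <= 1 -> nm (z - h)^-1 <= 4.
  move=> hz; have [_ z0] := ann z hz; case/andP: hz => z1 _.
  have : nm z <= nm (z - h) + nm h by rewrite -{1}[z](subrK h) nmD.
  rewrite nmV => ?; have z4 : 1 / 4 <= nm (z - h) by lra.
  by rewrite -[leLHS]mul1r ler_pdivrMr ?nm_gt0 //; lra.
have zi z : 1 / 2 <= nm z <= 1 -> nm z^-1 <= 2.
  move=> hz; have [z0 _] := ann z hz; case/andP: hz => z1 _.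
  by rewrite nmV -[leLHS]mul1r ler_pdivrMr ?nm_gt0 //; lra.
have [|r hr] := @contour_tends _ g.
  move=> z hz; have [z0 zh] := ann z hz; apply: cderivableM; first exact: df.
  apply: cderivableM; last first.
    by apply: cderivableV => //; exact: cderivableB_cst (cderivable_id z).
  have d1 : cderivable (fun w : K => w^-1) z by apply: cderivableV => //; exact: cderivable_id.
  apply: cderivableM => //; exact: cderivableM.
exists r; split.
  apply: tends_nm hr _ => m.
  have -> : 192 * M = 6 * (M * (2 ^+ 3 * 4)) by lra.
  apply: contour_bound => z hz; apply: nmM_le; first exact: fM.
  apply: nmM_le; last exact: zhi.
  by rewrite nmX; apply: lerXn2r; rewrite ?nnegrE ?nm_ge0 ?zi.
move=> n0 n1 n2 t0 t1 t2.
apply: tends_ext (tendsD (tendsD (tendsD t0 (tendsZ h t1)) (tendsZ (h ^+ 2) t2)) (tendsZ (h ^+ 3) hr)).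
move=> m /=.
rewrite -[contour m (fun z => f z * z^-1 ^+ 1)]mul1r.
set F1 := fun z => _; set F2 := fun z => _; set F3 := fun z => _.
transitivity (contour m (fun z => h ^+ 3 * g z + (h ^+ 2 * F3 z + (h * F2 z + F1 z)))).
  by rewrite !contour_lin; ring.
apply: contour_ext => z hz; have [z0 zh] := ann z hz.
by rewrite /g /F1 /F2 /F3; field; rewrite z0 zh.
Qed.

Lemma moment_tends f (M : R) j : 
  (forall z, 1 / 2 <= nm z <= 1 -> cderivable f z) ->
  (forall z, 1 / 2 <= nm z <= 1 -> nm (f z) <= M) ->
  exists2 l, tends (fun m => contour m (fun z => f z * z^-1 ^+ j)) l &
    nm l <= 6 * (M * 2 ^+ j).
Proof.
move=> df fM.
have ann z : 1 / 2 <= nm z <= 1 -> z != 0.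
  by move=> /andP[z1 _]; apply/eqP => z0; move: z1; rewrite z0 nm0; lra.
have zi z : 1 / 2 <= nm z <= 1 -> nm z^-1 <= 2.
  move=> hz; have z0 := ann z hz; case/andP: hz => z1 _.
  by rewrite nmV -[leLHS]mul1r ler_pdivrMr ?nm_gt0 //; lra.
have [|l hl] := @contour_tends _ (fun z => f z * z^-1 ^+ j).
  move=> z hz; apply: cderivableM; first exact: df.
  have d1 : cderivable (fun w : K => w^-1) z.
    by apply: cderivableV; [exact: ann | exact: cderivable_id].
  elim: j => [|j IH]; first exact: cderivable_cst.
  have -> : (fun w : K => w^-1 ^+ j.+1) = (fun w => w^-1 * w^-1 ^+ j).
    by apply/funext => w; rewrite exprS.
  exact: cderivableM.
exists l => //; apply: tends_nm hl _ => m.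
apply: contour_bound => z hz; apply: nmM_le; first exact: fM.
by rewrite nmX; apply: lerXn2r; rewrite ?nnegrE ?nm_ge0 ?zi.
Qed.

(** By Cauchy's formula f h * W = N, where N and W are the limits of the
    contour sums of f z / (z - h) and of 1 / (z - h). Both have third-order
    expansions in h by [contour_moments], and W is bounded below by
    [contour_inv_ge], so the quotient has such an expansion. The bound M is
    only required near the contour: in Liouville's theorem this bound comes
    from the growth of f at infinity. *)
Theorem taylor3 : exists2 k : R, 0 < k & forall f (M : R),
  (forall z, nm z <= 1 -> cderivable f z) ->
  (forall z, 1 / 2 <= nm z <= 1 -> nm (f z) <= M) ->
  exists c1 c2, [/\ nm c1 <= k * M, nm c2 <= k * M & forall h, nm h <= 1 / 4 ->
    nm (f h - f 0 - c1 * h - c2 * h ^+ 2) <= k * M * nm h ^+ 3].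
Proof.
(* Any bound for the numerical constants accumulated below would do. *)
pose k : R := 10 * (1000 * 1000).
exists k; first by rewrite /k; lra.
move=> f M df fM.
have dfa z : 1 / 2 <= nm z <= 1 -> cderivable f z by move=> /andP[_]; exact: df.
have one_d z : 1 / 2 <= nm z <= 1 -> cderivable (fun=> 1 : K) z.
  by move=> _; exact: cderivable_cst.
have one_M (z : K) : 1 / 2 <= nm z <= 1 -> nm (1 : K) <= 1 by rewrite nm1.
have M0 : 0 <= M.
  by apply: le_trans (nm_ge0 _) (fM 1 _); rewrite nm1; apply/andP; split; lra.
have [n0 tn0 bn0] := moment_tends 1 dfa fM.
have [n1 tn1 bn1] := moment_tends 2 dfa fM.
have [n2 tn2 bn2] := moment_tends 3 dfa fM.
have [w0 tw0 bw0] := moment_tends 1 one_d one_M.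
have [w1 tw1 bw1] := moment_tends 2 one_d one_M.
have [w2 tw2 bw2] := moment_tends 3 one_d one_M.
have W_ge h l : nm h <= 1 / 2 ->
    tends (fun m => contour m (fun z => 1 * (z - h)^-1)) l -> nm l^-1 <= 9 / 4.
  move=> hh tl.
  have : 4 / 9 <= nm l.
    apply/ler_addgt0Pl => e e0; have [N hN] := tl e e0.
    apply: le_trans (contour_inv_ge N hh) _.
    have -> : contour N (fun z => (z - h)^-1) = (contour N (fun z => 1 * (z - h)^-1) - l) + l.
      by rewrite subrK; apply: contour_ext => z _; rewrite mul1r.
    by apply: le_trans (nmD _ _) _; have := hN N (leqnn _); lra.
  move=> h49; have l0 : 0 < nm l by lra.
  by rewrite nmV -[leLHS]mul1r ler_pdivrMr //; lra.
have iw0 : nm w0^-1 <= 9 / 4.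
  apply: (W_ge 0); first by rewrite nm0; lra.
  by apply: tends_ext tw0 => m; apply: contour_ext => z _; rewrite subr0 expr1.
have w00 : w0 != 0.
  apply/eqP => e; have [N hN] := tw0 (1 / 9) ltac:(lra).
  have hN1 := hN N (leqnn _); rewrite e subr0 in hN1.
  have := @contour_inv_ge R N 0; rewrite nm0 => /(_ ltac:(lra)).
  have -> : contour N (fun z : K => (z - 0)^-1) = contour N (fun z => 1 * z^-1 ^+ 1).
    by apply: contour_ext => z _; rewrite subr0 expr1 mul1r.
  by lra.
(* The coefficients of the quotient of the two expansions, up to order two. *)
pose c0 := n0 * w0^-1; pose c1 := (n1 - c0 * w1) * w0^-1.
pose c2 := (n2 - c0 * w2 - c1 * w1) * w0^-1.
have bc0 : nm c0 <= 27 * M.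
  by apply: le_trans (nmM_le bn0 iw0) _; lra.
have bc1 : nm c1 <= 1512 * M.
  apply: le_trans (nmM_le (nmB_le bn1 (nmM_le bc0 bw1)) iw0) _; lra.
have bc2 : nm c2 <= 84672%:R * M.
  apply: le_trans (nmM_le (nmB_le (nmB_le bn2 (nmM_le bc0 bw2)) (nmM_le bc1 bw1)) iw0) _.
  lra.
have main h : nm h <= 1 / 4 ->
    nm (f h - c0 - c1 * h - c2 * h ^+ 2) <= k * M * nm h ^+ 3.
  move=> hh; have h2 : nm h <= 1 / 2 by lra.
  have h1 : nm h <= 1 by lra.
  have [r [br hr]] := contour_moments hh dfa fM.
  have [r' [br' hr']] := contour_moments hh one_d one_M.
  have tf := hr _ _ _ tn0 tn1 tn2; have t1 := hr' _ _ _ tw0 tw1 tw2.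
  set N := n0 + _ + _ + _ in tf; set W := w0 + _ + _ + _ in t1.
  have iW := W_ge h W h2 t1.
  have W0 : W != 0.
    apply/eqP => e; have [m0 hm] := t1 (1 / 9) ltac:(lra).
    have hm1 := hm m0 (leqnn _); rewrite e subr0 in hm1.
    have := contour_inv_ge m0 h2.
    have -> : contour m0 (fun z : K => (z - h)^-1) = contour m0 (fun z => 1 * (z - h)^-1).
      by apply: contour_ext => z _; rewrite mul1r.
    by lra.
  have fW : f h * W = N.
    apply/eqP; rewrite -subr_eq0 -[_ - _]opprB oppr_eq0; apply/eqP.
    rewrite -mulNr.
    apply: (tends_uniq (tendsD tf (tendsZ (- f h) t1))).
    apply: tends_ext (contour_dquot h2 df) => m.
    rewrite addrC -contour_lin; apply: contour_ext => z _.
    by rewrite /dquot; ring.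
  have -> : f h - c0 - c1 * h - c2 * h ^+ 2 =
    (r - (c0 + c1 * h + c2 * h ^+ 2) * r' - (c1 * w2 + c2 * w1) - h * (c2 * w2))
      * W^-1 * h ^+ 3.
    apply: (mulIf W0); rewrite !mulrBl fW /N /W.
    have e0 : n0 = c0 * w0 by rewrite /c0 divfK.
    have e1 : n1 = c1 * w0 + c0 * w1 by rewrite /c1 divfK // subrK.
    have e2 : n2 = c2 * w0 + c1 * w1 + c0 * w2 by rewrite /c2 divfK // !subrK.
    rewrite {1}e0 {1}e1 {1}e2 -/W.
    transitivity (((r - (c0 + c1 * h + c2 * h ^+ 2) * r' - (c1 * w2 + c2 * w1) - h * (c2 * w2)) * h ^+ 3) * (W * W^-1)); last by ring.
    by rewrite divff // /W; ring.
  rewrite nmM nmX; apply: ler_wpM2r; first by rewrite exprn_ge0 ?nm_ge0.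
  have hh2 : nm (h ^+ 2) <= 1 / 16.
    by rewrite expr2; apply: le_trans (nmM_le hh hh) _; lra.
  have bp := nmD_le (nmD_le bc0 (nmM_le bc1 hh)) (nmM_le bc2 hh2).
  have b1 := nmD_le (nmM_le bc1 bw2) (nmM_le bc2 bw1).
  have b2 := nmM_le hh (nmM_le bc2 bw2).
  apply: le_trans (nmM_le (nmB_le (nmB_le (nmB_le br (nmM_le bp br')) b1) b2) iW) _.
  by rewrite /k; lra.
have f0 : f 0 = c0.
  apply/eqP; rewrite -subr_eq0 -nm_eq0; apply/eqP/le_anti; rewrite nm_ge0 andbT.
  have := main 0; rewrite nm0 !expr0n /= !mulr0 !subr0; apply.
  by lra.
exists c1, c2; split; last by rewrite f0.
- by apply: le_trans bc1 _; rewrite /k; lra.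
- by apply: le_trans bc2 _; rewrite /k; lra.
Qed.

End Taylor.

(** * Liouville's theorem and removable singularities *)

Section HolomorphicFunctions.
Variable R : realType.
Local Notation K := (C R).
Implicit Types (c z h u v w x y l : K) (f g : K -> K) (r : R).

Lemma has_cderiv_uniq f z l l' : has_cderiv f z l -> has_cderiv f z l' -> l = l'.
Proof.
move=> hl hl'; apply/eqP; rewrite -subr_eq0 -nm_eq0 eq_le nm_ge0 andbT.
apply/ler_addgt0Pl => e e0; rewrite addr0.
have [d d0 hd] := hl (e / 2) (divr_gt0 e0 (ltr0n _ 2)).
have [d' d0' hd'] := hl' (e / 2) (divr_gt0 e0 (ltr0n _ 2)).
pose s := Num.min d d' / 2.
have s0 : 0 < s by rewrite divr_gt0 // lt_min d0 d0'.
have sd : s < d.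
  by have : Num.min d d' <= d by [rewrite ge_min lexx]; rewrite /s; lra.
have sd' : s < d'.
  by have : Num.min d d' <= d' by [rewrite ge_min lexx orbT]; rewrite /s; lra.
have zs : z + s%:C%C - z = s%:C%C by ring.
have ns : nm (s%:C%C : K) = s by rewrite nm_real ger0_norm // ltW.
have := hd (z + s%:C%C); rewrite zs ns => /(_ sd) i1.
have := hd' (z + s%:C%C); rewrite zs ns => /(_ sd') i2.
rewrite -(ler_pM2r s0) -{1}ns -nmM.
have -> : (l - l') * s%:C%C = (f (z + s%:C%C) - f z - l' * s%:C%C)
    - (f (z + s%:C%C) - f z - l * s%:C%C) by ring.
by apply: le_trans (nmB_le i2 i1) _; lra.
Qed.

Lemma cderivable_affine f c b z : cderivable f (c + b * z) ->
  cderivable (fun w => f (c + b * w)) z.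
Proof.
move=> [l hl]; exists (l * b) => e e0.
have b0 : 0 < nm b + 1 by have := nm_ge0 b; lra.
have [d d0 hd] := hl (e / (nm b + 1)) (divr_gt0 e0 b0).
exists (d / (nm b + 1)) => [|w]; first by rewrite divr_gt0.
rewrite ltr_pdivlMr // => hw.
have E : c + b * w - (c + b * z) = b * (w - z) by ring.
have g := nm_ge0 (w - z).
have := hd (c + b * w); rewrite E nmM => /(_ ltac:(lra)) i.
rewrite -[l * b * _]mulrA; apply: le_trans i _.
rewrite mulrAC ler_pdivrMr //.
have := mulr_ge0 (ltW e0) g; lra.
Qed.

Theorem taylor_disc : exists2 k : R, 0 < k & forall f c r (M : R), 0 < r ->
  (forall z, nm (z - c) <= r -> cderivable f z) ->
  (forall z, r / 2 <= nm (z - c) <= r -> nm (f z) <= M) ->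
  exists c1 c2, [/\ nm c1 <= k * M / r, nm c2 <= k * M / r ^+ 2 &
    forall h, nm h <= r / 4 ->
    nm (f (c + h) - f c - c1 * h - c2 * h ^+ 2) <= k * M * (nm h / r) ^+ 3].
Proof.
have [k k0 kP] := taylor3 R; exists k => // f c r M r0 df fM.
have nr : nm (r%:C%C : K) = r by rewrite nm_real ger0_norm // ltW.
have rC : (r%:C%C : K) != 0 by rewrite -nm_eq0 nr gt_eqF.
have [||c1 [c2 [b1 b2 hP]]] := kP (fun z => f (c + r%:C%C * z)) M.
- move=> z z1; apply: cderivable_affine; apply: df.
  by rewrite addrAC subrr add0r nmM nr ler_piMr // ltW.
- move=> z /andP[z1 z2]; apply: fM; rewrite addrAC subrr add0r nmM nr.
  by apply/andP; split; nra.
exists (c1 / r%:C%C), (c2 / r%:C%C ^+ 2); split.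
- by rewrite nmM nmV nr ler_wpM2r // invr_ge0 ltW.
- by rewrite nmM nmV nmX nr ler_wpM2r // invr_ge0 exprn_ge0 // ltW.
move=> h hh; have := hP (h / r%:C%C).
rewrite nmM nmV nr ler_pdivrMr // => /(_ ltac:(lra)).
rewrite mulrCA divff // !mulr1 mulr0 addr0; apply: le_trans.
by apply: nm_eq_le; field.
Qed.

(** On the disc of radius r the Taylor expansion of f is affine up to O(1 / r)
    at a given point. Its linear coefficient, which may depend on r, is
    eliminated between the points z and 1. *)
Theorem liouville_affine f (A D : R) : 0 <= A ->
  (forall z, cderivable f z) -> (forall z, D <= nm z -> nm (f z) <= A * nm z) ->
  forall z, f z = f 0 + z * (f 1 - f 0).
Proof.
move=> A0 df fA z; have [k k0 kP] := taylor_disc.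
have est r : 0 < r -> 2 * D <= r -> 1 <= r -> exists c1, forall h, nm h <= r / 4 ->
    nm (f h - f 0 - c1 * h) <= k * A * (nm h ^+ 2 + nm h ^+ 3) / r.
  move=> r0 rD r1; have [//|||c1 [c2 [_ b2 hP]]] := kP f 0 r (A * r).
  - by move=> w _; exact: df.
  - move=> w; rewrite subr0 => /andP[w1 w2]; apply: le_trans (fA w _) _; first by lra.
    exact: ler_wpM2l.
  exists c1 => h hh; have := hP h hh; rewrite add0r => i1.
  have i2 : nm (c2 * h ^+ 2) <= k * A / r * nm h ^+ 2.
    rewrite nmM nmX ler_wpM2r ?exprn_ge0 ?nm_ge0 //; apply: le_trans b2 _.
    by rewrite le_eqVlt; apply/orP; left; apply/eqP; field; rewrite gt_eqF.
  have -> : f h - f 0 - c1 * h = (f h - f 0 - c1 * h - c2 * h ^+ 2) + c2 * h ^+ 2 by ring.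
  apply: le_trans (nmD_le i1 i2) _.
  have ri : r^-1 <= 1 by rewrite invf_le1.
  have ri0 : 0 <= r^-1 by rewrite invr_ge0 ltW.
  have -> : k * (A * r) * (nm h / r) ^+ 3 = k * A * nm h ^+ 3 * r^-1 * r^-1.
    by field; rewrite gt_eqF.
  have P0 : 0 <= k * A * nm h ^+ 3 * r^-1 by rewrite !mulr_ge0 ?exprn_ge0 ?nm_ge0 // ltW.
  have := ler_piMr P0 ri; lra.
apply/eqP; rewrite eq_sym -subr_eq0 -nm_eq0 eq_le nm_ge0 andbT.
apply/ler_addgt0Pl => e e0; rewrite addr0.
(* The error of the affine approximation is at most B / r, so r is taken larger
   than B / e. *)
pose B := k * A * (nm z * 2 + (nm z ^+ 2 + nm z ^+ 3)).
have z0 := nm_ge0 z.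
have B0 : 0 <= B.
  by rewrite !mulr_ge0 ?addr_ge0 ?mulr_ge0 ?exprn_ge0 // ltW.
pose r := 1 + `|2 * D| + 4 + 4 * nm z + B / e.
have Be : 0 <= B / e by rewrite divr_ge0 // ltW.
have D0 := normr_ge0 (2 * D); have D1 := ler_norm (2 * D).
have r0 : 0 < r by rewrite /r; lra.
have [|||c1 hc] := est r; rewrite /r; try lra.
have i1 := hc 1; rewrite -/r nm1 !expr1n mulr1 in i1.
have i2 := hc z; rewrite -/r in i2.
have -> : f 0 + z * (f 1 - f 0) - f z = z * (f 1 - f 0 - c1) - (f z - f 0 - c1 * z) by ring.
have h1 := i1 ltac:(rewrite /r; lra); have h2 := i2 ltac:(rewrite /r; lra).
apply: le_trans (nmB_le (nmM_le (lexx _) h1) h2) _.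
have -> : nm z * (k * A * (1 + 1) / r) + k * A * (nm z ^+ 2 + nm z ^+ 3) / r = B / r.
  by rewrite /B; field; rewrite gt_eqF.
rewrite ler_pdivrMr // mulrC -ler_pdivrMr // /r; lra.
Qed.

End HolomorphicFunctions.

Section TwoVariables.
Variable R : realType.
Local Notation K := (C R).
Implicit Types (c z h u v w x y l : K) (r : R).

Lemma cderivable_near_eq (f g : K -> K) z (d : R) : 0 < d ->
  (forall w, nm (w - z) < d -> f w = g w) -> cderivable f z -> cderivable g z.
Proof.
move=> d0 fg [l hl]; exists l => e e0; have [s s0 hs] := hl e e0.
exists (Num.min d s); first by rewrite lt_min d0.
move=> w; rewrite lt_min => /andP[wd ws].
by rewrite -!fg ?subrr ?nm0 //; exact: hs.
Qed.

(** The quadratic term of [taylor_disc] goes into the error. The constants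
    depend on f through M and r only, hence are uniform when f depends on a
    parameter. *)
Theorem cauchy_estimate : exists2 k : R, 0 < k & forall (f : K -> K) c r (M : R), 0 < r ->
  (forall z, nm (z - c) <= r -> cderivable f z) ->
  (forall z, nm (z - c) <= r -> nm (f z) <= M) ->
  exists l, [/\ has_cderiv f c l, nm l <= k * M / r,
    forall h, nm h <= r / 4 -> nm (f (c + h) - f c) <= k * M / r * nm h &
    forall h, nm h <= r / 4 -> nm (f (c + h) - f c - l * h) <= k * M / r ^+ 2 * nm h ^+ 2].
Proof.
have [k k0 kP] := taylor_disc R; exists (3 * k); first by lra.
move=> f c r M r0 df fM; have [|||c1 [c2 [b1 b2 hP]]] := kP f c r M => //.
  by move=> z /andP[_]; exact: fM.
have M0 : 0 <= M.
  by apply: le_trans (nm_ge0 _) (fM c _); rewrite subrr nm0 ltW.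
have Q0 : 0 <= k * M / r by rewrite !mulr_ge0 ?invr_ge0 // ltW.
have Q20 : 0 <= k * M / r ^+ 2.
  by rewrite mulr_ge0 ?invr_ge0 ?exprn_ge0 ?mulr_ge0 // ltW.
have sec h : nm h <= r / 4 ->
    nm (f (c + h) - f c - c1 * h) <= 2 * (k * M / r ^+ 2 * nm h ^+ 2).
  move=> hh; have h0 := nm_ge0 h.
  have -> : f (c + h) - f c - c1 * h =
     (f (c + h) - f c - c1 * h - c2 * h ^+ 2) + c2 * h ^+ 2 by ring.
  apply: le_trans (nmD_le (hP h hh) (nmM_le b2 (lexx _))) _.
  have -> : k * M * (nm h / r) ^+ 3 = (k * M / r ^+ 2 * nm h ^+ 2) * (nm h / r).
    by field; rewrite gt_eqF.
  have hr : nm h / r <= 1 by rewrite ler_pdivrMr //; lra.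
  have P0 : 0 <= k * M / r ^+ 2 * nm h ^+ 2 by rewrite mulr_ge0 ?exprn_ge0.
  by rewrite nmX; have := ler_piMr P0 hr; lra.
exists c1; split.
- move=> e e0; pose Q := 2 * (k * M / r ^+ 2) + 1.
  have Q1 : 0 < Q by rewrite /Q; lra.
  exists (Num.min (r / 4) (e / Q)); first by rewrite lt_min !divr_gt0.
  move=> w; rewrite lt_min => /andP[w1 w2].
  have := sec (w - c) (ltW w1).
  rewrite [c + _]addrC subrK => i; apply: le_trans i _.
  rewrite ltr_pdivlMr // in w2.
  have := nm_ge0 (w - c); set t := nm (w - c) in w1 w2 * => t0.
  have : t * (t * Q) <= t * e by rewrite ler_wpM2l // ltW.
  by rewrite /Q; nra.
- by lra.
- move=> h hh; have h0 := nm_ge0 h.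
  have -> : f (c + h) - f c = (f (c + h) - f c - c1 * h) + c1 * h by ring.
  apply: le_trans (nmD_le (sec h hh) (nmM_le b1 (lexx _))) _.
  have -> : k * M / r ^+ 2 * nm h ^+ 2 = (k * M / r * nm h) * (nm h / r).
    by field; rewrite gt_eqF.
  have hr : nm h / r <= 1 by rewrite ler_pdivrMr //; lra.
  have P0 : 0 <= k * M / r * nm h by rewrite mulr_ge0.
  by have := ler_piMr P0 hr; lra.
- move=> h hh; apply: le_trans (sec h hh) _.
  have P0 : 0 <= k * M / r ^+ 2 * nm h ^+ 2 by rewrite mulr_ge0 ?exprn_ge0 ?nm_ge0.
  lra.
Qed.

(** At c the derivative of the quotient is the quadratic Taylor coefficient of
    f, because the remainder is of third order. *)
Theorem removable (f : K -> K) c r l : 0 < r ->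
  (forall z, nm (z - c) < r -> cderivable f z) -> has_cderiv f c l ->
  forall z, nm (z - c) < r ->
  cderivable (fun w => if w == c then l else (f w - f c) / (w - c)) z.
Proof.
move=> r0 df fl z zr; have [->|zc] := eqVneq z c; last first.
  apply: (@cderivable_near_eq (dquot f c) _ _ (nm (z - c))).
  - by rewrite nm_gt0 subr_eq0.
  - move=> w; case: eqVneq => // ->; first by rewrite nmB ltxx.
  - by apply: dquot_cderivable => //; exact: df.
have fc : cderivable f c by exists l.
have [d d0 hd] := cderivable_cont fc ltr01.
pose s := Num.min r d / 2.
have s0 : 0 < s by rewrite divr_gt0 // lt_min r0 d0.
have sr : s < r.
  by have : Num.min r d <= r by [rewrite ge_min lexx]; rewrite /s; lra.
have sd : s < d.
  by have : Num.min r d <= d by [rewrite ge_min lexx orbT]; rewrite /s; lra.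
clearbody s.
have [k k0 kP] := taylor_disc R; pose M := nm (f c) + 1.
have M0 : 0 < M by have := nm_ge0 (f c); rewrite /M; lra.
have [|||c1 [c2 [b1 b2 hP]]] := kP f c s M => //.
- by move=> w ws; apply: df; apply: le_lt_trans ws sr.
- move=> w /andP[_ ws]; have -> : f w = f c + (f w - f c) by ring.
  by apply: nmD_le => //; apply: hd; apply: le_lt_trans ws sd.
have Q0 : 0 < k * M / s ^+ 3 by apply: divr_gt0; [exact: mulr_gt0 | exact: exprn_gt0].
set Q := k * M / s ^+ 3 in Q0.
have third h : nm h <= s / 4 ->
    nm (f (c + h) - f c - c1 * h - c2 * h ^+ 2) <= Q * nm h ^+ 3.
  move=> /hP i; apply: le_trans i _; rewrite le_eqVlt; apply/orP; left; apply/eqP.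
  by rewrite /Q expr_div_n; field; rewrite gt_eqF.
clearbody Q.
have lc1 : l = c1.
  have [k' k0' kP'] := cauchy_estimate.
  have [|||l' [hl' _ _ hq]] := kP' f c s M => //.
  - by move=> w ws; apply: df; apply: le_lt_trans ws sr.
  - move=> w ws; have -> : f w = f c + (f w - f c) by ring.
    by apply: nmD_le => //; apply: hd; apply: le_lt_trans ws sd.
  apply: (has_cderiv_uniq fl) => e e0.
  have n2 : 0 < nm c2 + Q + 1 by have := nm_ge0 c2; lra.
  exists (Num.min (Num.min 1 (s / 4)) (e / (nm c2 + Q + 1))).
    by rewrite !lt_min ltr01 !divr_gt0.
  move=> w; rewrite !lt_min => /andP[/andP[w1 ws] we].
  have := third (w - c) (ltW ws); rewrite [c + _]addrC subrK => i.
  have -> : f w - f c - c1 * (w - c) =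
    (f w - f c - c1 * (w - c) - c2 * (w - c) ^+ 2) + c2 * (w - c) ^+ 2 by ring.
  apply: le_trans (nmD_le i (lexx _)) _; rewrite nmM nmX.
  rewrite ltr_pdivlMr // in we.
  have := nm_ge0 (w - c); set t := nm (w - c) in w1 ws we * => t0.
  have t3 : t ^+ 3 <= t ^+ 2.
    by rewrite exprS ler_piMl ?exprn_ge0 // ltW.
  have := ler_wpM2l (ltW Q0) t3 => j1.
  have : t * (t * (nm c2 + Q + 1)) <= t * e by rewrite ler_wpM2l // ltW.
  have := sqr_ge0 t; nra.
exists c2 => e e0; exists (Num.min (s / 4) (e / Q)); first by rewrite lt_min !divr_gt0.
move=> w; rewrite lt_min eqxx => /andP[w1 w2].
case: eqVneq => [->|wc]; first by rewrite !subrr mulr0 subrr nm0 mulr0.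
have wc0 : w - c != 0 by rewrite subr_eq0.
have -> : (f w - f c) / (w - c) - l - c2 * (w - c) =
   (f w - f c - c1 * (w - c) - c2 * (w - c) ^+ 2) / (w - c).
  by rewrite lc1; field.
rewrite nmM nmV ler_pdivrMr ?nm_gt0 //.
have := third (w - c) (ltW w1); rewrite [c + _]addrC subrK => i; apply: le_trans i _.
rewrite ltr_pdivlMr // in w2.
have := nm_ge0 (w - c); set t := nm (w - c) in w1 w2 * => t0.
have : t ^+ 2 * (t * Q) <= t ^+ 2 * e by rewrite ler_wpM2l ?sqr_ge0 // ltW.
by rewrite !exprS expr0; lra.
Qed.

(** * Division by an equation of the diagonal *)

(** The increment of g splits into a horizontal step at height y + v and a
    vertical step at x, both estimated by [cauchy_estimate]. It remains to see
    that the horizontal derivative at height y + v tends to the one at height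
    y: both are close to difference quotients with a fixed step t, and these
    are Lipschitz in the second variable. *)
Theorem osgood (g : K -> K -> K) r (M : R) : 0 < r ->
  (forall x y, nm x <= r -> nm y <= r ->
     [/\ cderivable (g^~ y) x, cderivable (g x) y & nm (g x y) <= M]) ->
  forall x y, nm x <= r / 2 -> nm y <= r / 2 -> exists l1 l2, has_cderiv2 g x y l1 l2.
Proof.
move=> r0 gP x y hx hy; have [k k0 kP] := cauchy_estimate.
pose q := r / 2; have q0 : 0 < q by rewrite divr_gt0.
have M0 : 0 <= M.
  have h0 : nm (0 : K) <= r by rewrite nm0 ltW.
  by have [_ _ h] := gP 0 0 h0 h0; exact: le_trans (nm_ge0 _) h.
pose L := k * M / q; pose Q := k * M / q ^+ 2 + 1.
have L0 : 0 <= L by rewrite !mulr_ge0 ?invr_ge0 // ltW.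
have Q1 : 0 <= k * M / q ^+ 2.
  by rewrite mulr_ge0 ?invr_ge0 ?exprn_ge0 ?mulr_ge0 // ltW.
have Q0 : 0 < Q by rewrite /Q; lra.
have horiz y' : nm y' <= r -> exists l, forall h, nm h <= q / 4 ->
    nm (g (x + h) y' - g x y' - l * h) <= Q * nm h ^+ 2.
  move=> hy'; have [//|||l [_ _ _ hl]] := kP (g^~ y') x q M.
  - move=> z hz; have [] // := gP z y'.
    by have := nmD (z - x) x; rewrite subrK /q in hz *; lra.
  - move=> z hz; have [] // := gP z y'.
    by have := nmD (z - x) x; rewrite subrK /q in hz *; lra.
  exists l => h /hl i; apply: le_trans i _; apply: ler_wpM2r; rewrite ?exprn_ge0 ?nm_ge0 //.
  by rewrite /Q; lra.
have vert x' : nm x' <= r -> exists l, forall h, nm h <= q / 4 ->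
    nm (g x' (y + h) - g x' y - l * h) <= Q * nm h ^+ 2 /\
    nm (g x' (y + h) - g x' y) <= L * nm h.
  move=> hx'; have [//|||l [_ _ hL hl]] := kP (g x') y q M.
  - move=> z hz; have [] // := gP x' z.
    by have := nmD (z - y) y; rewrite subrK /q in hz *; lra.
  - move=> z hz; have [] // := gP x' z.
    by have := nmD (z - y) y; rewrite subrK /q in hz *; lra.
  exists l => h hh; split; last exact: hL.
  apply: le_trans (hl h hh) _; apply: ler_wpM2r; rewrite ?exprn_ge0 ?nm_ge0 //.
  by rewrite /Q; lra.
have hxr : nm x <= r by lra.
have [l1 h1] := horiz y ltac:(lra).
have [l2 h2] := vert x hxr.
exists l1, l2 => e e0.
pose t := Num.min (q / 4) (e / (8 * Q)).
have t0 : 0 < t by rewrite lt_min !divr_gt0 // mulr_gt0.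
have tq : t <= q / 4 by rewrite ge_min lexx.
have tQ : t * (8 * Q) <= e.
  by rewrite -ler_pdivlMr ?mulr_gt0 // ge_min lexx orbT.
clearbody t; have nt : nm (t%:C%C : K) = t by rewrite nm_real ger0_norm // ltW.
pose d := Num.min (Num.min (q / 4) (e / (2 * Q))) (t * e / (8 * (L + 1))).
have L1 : 0 < L + 1 by lra.
have d0 : 0 < d by rewrite !lt_min !divr_gt0 ?mulr_gt0.
exists d => // u v; rewrite /d !lt_min => /andP[/andP[u1 u2] _] /andP[/andP[v1 v2] v3].
have xtr : nm (x + t%:C%C) <= r.
  by apply: le_trans (nmD _ _) _; rewrite nt /q in tq *; lra.
have [l2' h2'] := vert _ xtr.
have yvr : nm (y + v) <= r.
  by apply: le_trans (nmD _ _) _; rewrite /q in v1; lra.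
have [L' hL'] := horiz _ yvr.
have i1 := hL' u (ltW u1).
have [i2 i2'] := h2 v (ltW v1); have [_ i3'] := h2' v (ltW v1).
have j1 := hL' (t%:C%C) ltac:(by rewrite nt).
have j2 := h1 (t%:C%C) ltac:(by rewrite nt).
rewrite nt in j1 j2.
have LB : nm (L' - l1) * t <= 2 * Q * t ^+ 2 + 2 * L * nm v.
  rewrite -{1}nt -nmM.
  have -> : (L' - l1) * t%:C%C = 
    (g (x + t%:C%C) y - g x y - l1 * t%:C%C) - (g (x + t%:C%C) (y + v) - g x (y + v) - L' * t%:C%C)
    + ((g (x + t%:C%C) (y + v) - g (x + t%:C%C) y) - (g x (y + v) - g x y)) by ring.
  by apply: le_trans (nmD_le (nmB_le j2 j1) (nmB_le i3' i2')) _; lra.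
have LB2 : nm (L' - l1) <= e / 2.
  rewrite -(ler_pM2r t0); apply: le_trans LB _.
  rewrite ltr_pdivlMr ?mulr_gt0 // in v3.
  have a1 : t * (t * (8 * Q)) <= t * e by rewrite ler_wpM2l // ltW.
  have := nm_ge0 v; rewrite expr2; nra.
have -> : g (x + u) (y + v) - g x y - l1 * u - l2 * v =
   (g (x + u) (y + v) - g x (y + v) - L' * u) + (L' - l1) * u
   + (g x (y + v) - g x y - l2 * v) by ring.
apply: le_trans (nmD_le (nmD_le i1 (nmM_le LB2 (lexx _))) i2) _.
rewrite ltr_pdivlMr ?mulr_gt0 // in u2; rewrite ltr_pdivlMr ?mulr_gt0 // in v2.
have gu := nm_ge0 u; have gv := nm_ge0 v.
have a1 : nm u * (nm u * (2 * Q)) <= nm u * e by rewrite ler_wpM2l // ltW.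
have a2 : nm v * (nm v * (2 * Q)) <= nm v * e by rewrite ler_wpM2l // ltW.
rewrite !expr2; nra.
Qed.

Lemma has_cderiv2_1 (f : K -> K -> K) x y l1 l2 :
  has_cderiv2 f x y l1 l2 -> has_cderiv (f^~ y) x l1.
Proof.
move=> h e /h[d d0 hd]; exists d => // w wd.
have := hd (w - x) 0 wd; rewrite nm0 => /(_ d0).
by rewrite !addr0 mulr0 subr0 [x + _]addrC subrK.
Qed.

Lemma has_cderiv2_2 (f : K -> K -> K) x y l1 l2 :
  has_cderiv2 f x y l1 l2 -> has_cderiv (f x) y l2.
Proof.
move=> h e /h[d d0 hd]; exists d => // w wd.
have := hd 0 (w - y); rewrite nm0 => /(_ d0 wd).
by rewrite !addr0 mulr0 subr0 add0r [y + _]addrC subrK.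
Qed.

(** The quotient g is the divided difference, extended to the diagonal by the
    first partial derivative. It is bounded by the Lipschitz estimate of
    [cauchy_estimate] and differentiable in each variable by [removable], so
    [osgood] applies. *)
Theorem hadamard (f : K -> K -> K) (d : R) : 0 < d ->
  (forall x y, nm x < d -> nm y < d -> exists l1 l2, has_cderiv2 f x y l1 l2) ->
  (forall x, nm x < d -> f x x = 0) ->
  exists g : K -> K -> K, exists2 s : R, 0 < s & forall x y, nm x < s -> nm y < s ->
    f x y = (x - y) * g x y /\ exists l1 l2, has_cderiv2 g x y l1 l2.
Proof.
move=> d0 df f0.
have n0 : nm (0 : K) < d by rewrite nm0.
have [a1 [a2 ha]] := df 0 0 n0 n0; have [d1 d10 hd1] := ha 1 ltr01.
pose r := Num.min d d1 / 2.
have r0 : 0 < r by rewrite divr_gt0 // lt_min d0 d10.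
have rd : r < d.
  by have : Num.min d d1 <= d by [rewrite ge_min lexx]; rewrite /r; lra.
have rd1 : r < d1.
  by have : Num.min d d1 <= d1 by [rewrite ge_min lexx orbT]; rewrite /r; lra.
clearbody r.
pose M := nm a1 * r + nm a2 * r + 2 * r.
have fM x y : nm x <= r -> nm y <= r -> nm (f x y) <= M.
  move=> hx hy; have := hd1 x y (le_lt_trans hx rd1) (le_lt_trans hy rd1).
  rewrite !add0r (f0 0 n0) subr0 => i.
  have -> : f x y = (f x y - a1 * x - a2 * y) + (a1 * x + a2 * y) by ring.
  apply: le_trans (nmD_le i (nmD_le (nmM_le (lexx _) hx) (nmM_le (lexx _) hy))) _.
  by rewrite /M; lra.
have [p pP] : exists p : K -> K, forall y, nm y < d -> exists l2, has_cderiv2 f y y (p y) l2.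
  suff : forall y, exists l, nm y < d -> exists l2, has_cderiv2 f y y l l2.
    by move=> /choice[p hp]; exists p.
  move=> y; have [yd|_] := ltP (nm y) d; last by exists 0.
  by have [l1 [l2 h]] := df y y yd yd; exists l1 => _; exists l2.
(* f vanishes on the diagonal, so its partial derivatives there are opposite *)
have opp y l2 : nm y < d -> has_cderiv2 f y y (p y) l2 -> l2 = - p y.
  move=> yd hl; have dg : has_cderiv (fun w => f w w) y (p y + l2).
    move=> e e0; have [s s0 hs] := hl (e / 2) (divr_gt0 e0 (ltr0n _ 2)).
    exists s => // w ws; have := hs (w - y) (w - y) ws ws.
    rewrite [y + _]addrC subrK => i; apply: le_trans (le_trans i _); last by lra.
    by apply: nm_eq_le; ring.
  have d_0 : has_cderiv (fun w => f w w) y 0.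
    move=> e e0; exists (d - nm y); first by rewrite subr_gt0.
    move=> w wy; have wd : nm w < d.
      by have := nmD (w - y) y; rewrite subrK; lra.
    by rewrite !f0 // mul0r !subrr nm0 mulr_ge0 ?nm_ge0 // ltW.
  have := has_cderiv_uniq dg d_0 => /eqP; rewrite addrC addr_eq0 => /eqP; exact.
pose g x y := if x == y then p y else f x y / (x - y).
have [k k0 kP] := cauchy_estimate.
have r20 : 0 < r / 2 by lra.
have near_r z w : nm (z - w) <= r / 2 -> nm w <= r / 16 -> nm z < r.
  by move=> i j; have := nmD (z - w) w; rewrite subrK; lra.
have hs : forall x y, nm x <= r / 16 / 2 -> nm y <= r / 16 / 2 ->
    exists l1 l2, has_cderiv2 g x y l1 l2.
  apply: (@osgood g (r / 16) (k * M / (r / 2))); first by lra.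
  move=> x y hx hy.
  have [yr xr] : nm y < r /\ nm x < r by split; lra.
  have [yd xd] : nm y < d /\ nm x < d by split; lra.
  have xy : nm (x - y) <= r / 8 by have := nmD x (- y); rewrite nmN; lra.
  have [l2 hl2] := pP y yd; have hp := has_cderiv2_1 hl2.
  have [m2 hm2] := pP x xd; have hm := has_cderiv2_2 hm2.
  have fd z : nm (z - y) <= r / 2 -> cderivable (f^~ y) z.
    move=> hz; have zr := near_r z y hz hy.
    have [a [b hab]] := df z y (lt_trans zr rd) yd.
    by exists a; exact: has_cderiv2_1 hab.
  split.
  + have -> : g^~ y = fun w => if w == y then p y else (f w y - f y y) / (w - y).
      by apply/funext => w; rewrite (f0 y yd) subr0.
    apply: (@removable (f^~ y) y (r / 2) (p y)) => //; last by lra.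
    by move=> z /ltW; exact: fd.
  + have -> : g x = fun w => -1 * (if w == x then m2 else (f x w - f x x) / (w - x)).
      apply/funext => w; rewrite (f0 x xd) subr0 /g eq_sym mulN1r.
      case: eqVneq => [->|wx]; first by rewrite (opp x m2 xd hm2) opprK.
      by rewrite -mulrN -invrN opprB.
    apply: cderivableM; first exact: cderivable_cst.
    apply: (@removable (f x) x (r / 2) m2) => //; last by rewrite nmB; lra.
    move=> z /ltW hz; have zr := near_r z x hz hx.
    have [a [b hab]] := df x z xd (lt_trans zr rd).
    by exists b; exact: has_cderiv2_2 hab.
  + have [|l [hl bl lip _]] := kP (f^~ y) y (r / 2) M r20 fd.
      by move=> z hz; apply: fM; rewrite ltW //; exact: near_r hz hy.
    rewrite /g; case: eqVneq => [_|nxy]; first by rewrite (has_cderiv_uniq hp hl).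
    have xy0 : 0 < nm (x - y) by rewrite nm_gt0 subr_eq0.
    rewrite nmM nmV ler_pdivrMr //.
    have := lip (x - y); rewrite [y + _]addrC subrK (f0 y yd) subr0; apply.
    by lra.
exists g, (r / 32); first by lra.
move=> x y hx hy; split; last by apply: hs; lra.
rewrite /g; case: eqVneq => [->|xy]; first by rewrite subrr mul0r f0 //; lra.
by rewrite mulrC divfK // subr_eq0.
Qed.

End TwoVariables.

(** * Matrices of complex structures *)

Section ComplexStructureMatrices.
Variables (R : realType) (V : vectType R).
Local Notation K := (C R).
Local Notation d := (\dim {:V}).
Local Notation b := (vbasis {:V}).
Local Notation rc := (real_complex R).
Implicit Types (I J : 'End(V)) (v : 'rV[K]_d).

(** The matrix of the complexified endomorphism acts on rows from the right, so
    that compositions are reversed in [cmx_comp]. *)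
Definition cmx J : 'M[K]_d := map_mx rc (passmx.mxof b b J).

Lemma map_rc_inj m k : injective (map_mx rc : 'M[R]_(m, k) -> 'M[K]_(m, k)).
Proof.
move=> A B /matrixP h; apply/matrixP => i j.
by have := h i j; rewrite !mxE => -[].
Qed.

Lemma cmx_inj : injective cmx.
Proof.
move=> I J /map_rc_inj; apply: (can_inj (passmx.mxofK _ _)); exact: vbasisP.
Qed.

Lemma cmx_lin (a : R) I J : cmx (a *: I + J) = rc a *: cmx I + cmx J.
Proof. by rewrite /cmx passmx.mxof_linear map_mxD map_mxZ. Qed.

Lemma cmxD I J : cmx (I + J) = cmx I + cmx J.
Proof. by have := cmx_lin 1 I J; rewrite rmorph1 !scale1r. Qed.

Lemma cmx0 : cmx 0 = 0.
Proof. by apply: (addrI (cmx 0)); rewrite -cmxD !addr0. Qed.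

Lemma cmxZ (a : R) J : cmx (a *: J) = rc a *: cmx J.
Proof. by rewrite -[a *: J]addr0 cmx_lin cmx0 addr0. Qed.

Lemma cmxN J : cmx (- J) = - cmx J.
Proof. by rewrite -scaleN1r cmxZ rmorphN1 scaleN1r. Qed.

Lemma cmx1 : cmx \1%VF = 1%:M.
Proof. by rewrite /cmx passmx.mxof1 ?map_mx1 //; apply: basis_free (vbasisP _). Qed.

Lemma cmx_comp I J : cmx (I \o J)%VF = cmx J *m cmx I.
Proof. by rewrite /cmx (passmx.mxof_comp b b (vbasisP _)) map_mxM. Qed.

Lemma complexify_app J X : complexify (J X) = complexify X *m cmx J.
Proof. by rewrite /complexify /cmx (passmx.rVof_app b (vbasisP _)) map_mxM. Qed.

Lemma complexifyN (X : V) : complexify (- X) = - complexify X.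
Proof. by have := complexify_app (- \1)%VF X; rewrite opp_lfunE id_lfunE cmxN cmx1 mulmxN mulmx1. Qed.

Lemma complex_structureE J : complex_structure J <-> cmx J *m cmx J = - 1%:M.
Proof.
rewrite -cmx_comp -cmx1 -cmxN; split=> [->//|]; exact: cmx_inj.
Qed.

Lemma complexify_surj (a : 'rV[R]_d) : exists X, complexify X = map_mx rc a.
Proof.
by exists (passmx.vecof b a); rewrite /complexify passmx.vecofK //; exact: vbasisP.
Qed.

Lemma row_ReIm v : v = map_mx rc (map_mx (@complex.Re R) v)
  + 'i *: map_mx rc (map_mx (@complex.Im R) v).
Proof. by apply/rowP => j; rewrite !mxE; exact: complexE. Qed.

Lemma eq_ReIm (x y x' y' : 'rV[R]_d) :
  map_mx rc x + 'i *: map_mx rc y = map_mx rc x' + 'i *: map_mx rc y' ->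
  x = x' /\ y = y'.
Proof.
have pairE (a e : R) : rc a + 'i * rc e = Complex a e by rewrite [RHS]complexE.
move=> /rowP h; split; apply/rowP => j; have := h j; rewrite !mxE.
  by rewrite (pairE (x 0 j)) (pairE (x' 0 j)) => -[].
by rewrite (pairE (x 0 j)) (pairE (x' 0 j)) => -[].
Qed.

(** For the converse, comparing real and imaginary parts in the eigenvector
    equation shows that the imaginary part of v is minus the image by J of its
    real part. *)
Lemma V10E J v : complex_structure J -> V10 J v <-> v *m cmx J = 'i *: v.
Proof.
move=> /complex_structureE J2; split.
  move=> [X ->]; rewrite complexify_app mulmxBl -scalemxAl -mulmxA J2 mulmxN mulmx1.
  by rewrite scalerBr scalerA mulCii scalerN opprK scaleN1r opprK addrC.
move=> h; have hv := row_ReIm v.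
set x := map_mx _ v in hv; set y := map_mx _ v in hv.
have [X hX] := complexify_surj x.
exists X; rewrite {1}hv; congr (_ + _); first by rewrite hX.
rewrite -scalerN; congr (_ *: _).
have -> : complexify (J X) = - map_mx rc y; last by rewrite opprK.
rewrite complexify_app hX /cmx -map_mxM -map_mxN; congr map_mx.
have [-> //] : x *m passmx.mxof b b J = - y /\ y *m passmx.mxof b b J = x.
apply: eq_ReIm; rewrite map_mxN !map_mxM scalemxAl -mulmxDl -/(cmx J) -hv h {1}hv.
by rewrite scalerDr scalerA mulCii scaleN1r addrC.
Qed.

Lemma V01_opp J : V01 (- J) = V10 J.
Proof.
apply/seteqP; split=> v [X ->]; exists X.
  by rewrite complexify_app cmxN mulmxN scalerN complexify_app.
by rewrite !complexify_app cmxN mulmxN scalerN.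
Qed.

Lemma complex_structureN J : complex_structure J -> complex_structure (- J).
Proof. by move=> /complex_structureE h; apply/complex_structureE; rewrite cmxN mulmxN mulNmx opprK. Qed.

Lemma V01E J v : complex_structure J -> V01 J v <-> v *m cmx J = - 'i *: v.
Proof.
move=> cJ; rewrite -[J in V01 J]opprK V01_opp V10E; last exact: complex_structureN.
by rewrite cmxN mulmxN scaleNr; split=> [<-|->]; rewrite opprK.
Qed.

(** A real vector X is the real part of the (0,1)-vector X + 'i J X, and J X is
    its imaginary part. *)
Lemma V01_V10_opp I J : (V01 J `<=` V10 I)%classic -> J = - I.
Proof.
move=> h; apply/lfunP => X.
have [Y] := h (complexify X + 'i *: complexify (J X)) (ex_intro _ X erefl).
rewrite -scalerN -complexifyN => /eq_ReIm[].
have ri : injective (passmx.rVof b) by apply: (can_inj (passmx.rVofK _)); exact: vbasisP.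
by move=> /ri -> /ri ->; rewrite opp_lfunE.
Qed.

End ComplexStructureMatrices.

(** * Holomorphic families of matrices *)

Section MatrixFunctions.
Variable R : realType.
Local Notation K := (C R).

Section Entries.
Variables (W : normedModType K) (p q : nat).
Implicit Types (A : W -> 'M[K]_(p, q)) (t : W).

Lemma entry_differentiable A t i j :
  differentiable A t -> differentiable (fun u => A u i j) t.
Proof.
move=> dA; apply: (@differentiable_comp _ _ _ _ A (fun N : 'M[K]_(p, q) => N i j)) => //.
exact: differentiable_coord.
Qed.

Lemma fun_sum_differentiable (U : normedModType K) (I : Type) (r : seq I)
    (F : I -> W -> U) t :
  (forall i, differentiable (F i) t) -> differentiable (fun u => \sum_(i <- r) F i u) t.
Proof.
move=> dF; elim: r => [|i r IH].
  by under eq_fun do rewrite big_nil; exact: differentiable_cst.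
by under eq_fun do rewrite big_cons; exact: differentiableD.
Qed.

Lemma mx_differentiable A t :
  (forall i j, differentiable (fun u => A u i j) t) -> differentiable A t.
Proof.
move=> dA; have -> : A = fun u => \sum_i \sum_j A u i j *: delta_mx i j.
  by apply/funext => u; exact: matrix_sum_delta.
apply: fun_sum_differentiable => i; apply: fun_sum_differentiable => j.
exact: differentiableZl.
Qed.

End Entries.

Lemma mulmxr_differentiable (W : normedModType K) p q r (A : W -> 'M[K]_(p, q))
    (Z : 'M[K]_(q, r)) (t : W) :
  differentiable A t -> differentiable (fun u => A u *m Z) t.
Proof.
move=> dA; apply: mx_differentiable => i j; under eq_fun do rewrite mxE.
apply: fun_sum_differentiable => k; apply: differentiableM; last exact: differentiable_cst.
exact: entry_differentiable.
Qed.

(** The entries of A0 are entire, and grow at most linearly because those of A1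
    are bounded around 0. *)
Theorem affine_gluing p q (A0 A1 : K -> 'M[K]_(p, q)) :
  (forall z, differentiable A0 z) -> (forall w, differentiable A1 w) ->
  (forall z, z != 0 -> A0 z = z *: A1 z^-1) ->
  (forall z, A0 z = A0 0 + z *: A1 0) /\ (forall w, A1 w = A1 0 + w *: A0 0).
Proof.
move=> dA0 dA1 glue.
have scal (a b : K -> K) : (forall z, cderivable a z) -> (forall w, cderivable b w) ->
    (forall z, z != 0 -> a z = z * b z^-1) ->
    (forall z, a z = a 0 + z * b 0) /\ (forall w, b w = b 0 + w * a 0).
  move=> da db ab.
  have [d d0 hd] := cderivable_cont (db 0) ltr01.
  have az : forall z, a z = a 0 + z * (a 1 - a 0).
    apply: (@liouville_affine _ a (nm (b 0) + 1) (2 / d)) => //.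
      by have := nm_ge0 (b 0); lra.
    move=> z hz; have z0 : z != 0.
      by rewrite -nm_gt0; apply: lt_le_trans hz; rewrite divr_gt0.
    rewrite ab // nmM mulrC ler_wpM2r ?nm_ge0 //.
    rewrite -[b z^-1](subrK (b 0)); apply: le_trans (nmD _ _) _.
    rewrite addrC lerD2l; apply: hd; rewrite subr0 nmV.
    rewrite -[ltLHS]mul1r ltr_pdivrMr ?nm_gt0 //.
    move: hz; rewrite ler_pdivrMr // mulrC; lra.
  set s := a 1 - a 0 in az.
  have bw w : w != 0 -> b w = s + w * a 0.
    move=> w0; have := ab w^-1; rewrite invr_eq0 invrK az => /(_ w0) h.
    have -> : b w = w * (w^-1 * b w) by rewrite mulrA divff // mul1r.
    by rewrite -h; field.
  have b0 : b 0 = s.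
    apply/eqP; rewrite -subr_eq0 -nm_eq0 eq_le nm_ge0 andbT.
    apply/ler_addgt0Pl => e e0; rewrite addr0.
    have [r r0 hr] := cderivable_cont (db 0) (divr_gt0 e0 (ltr0n _ 2)).
    have a1 : 0 < nm (a 0) + 1 by have := nm_ge0 (a 0); lra.
    pose t := Num.min (r / 2) (e / (2 * (nm (a 0) + 1))).
    have t0 : 0 < t by rewrite lt_min !divr_gt0 // mulr_gt0.
    have tr : t <= r / 2 by rewrite ge_min lexx.
    have te : t * (2 * (nm (a 0) + 1)) <= e.
      by rewrite -ler_pdivlMr ?mulr_gt0 // ge_min lexx orbT.
    have nt : nm (t%:C%C : K) = t by rewrite nm_real ger0_norm // ltW.
    have tC : (t%:C%C : K) != 0 by rewrite -nm_gt0 nt.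
    have := hr t%:C%C; rewrite subr0 nt => /(_ ltac:(lra)); rewrite (bw _ tC) => i.
    have -> : b 0 - s = t%:C%C * a 0 - (s + t%:C%C * a 0 - b 0) by ring.
    apply: le_trans (nmB_le (lexx _) i) _; rewrite nmM nt.
    by have := nm_ge0 (a 0); nra.
  split=> [z|w]; first by rewrite az b0.
  by have [->|/bw->] := eqVneq w 0; rewrite ?mul0r ?addr0 // b0.
have entry i j : (forall z, A0 z i j = A0 0 i j + z * A1 0 i j) /\
    (forall w, A1 w i j = A1 0 i j + w * A0 0 i j).
  apply: (scal (fun z => A0 z i j) (fun w => A1 w i j)).
  - by move=> z; apply/differentiable_cderivable/entry_differentiable.
  - by move=> z; apply/differentiable_cderivable/entry_differentiable.
  - by move=> z z0; rewrite glue // mxE.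
by split=> z; apply/matrixP => i j; rewrite !mxE; apply (entry i j).
Qed.

Lemma cderivableD (f g : K -> K) z : cderivable f z -> cderivable g z ->
  cderivable (fun w => f w + g w) z.
Proof.
move=> /cderivable_differentiable df /cderivable_differentiable dg.
exact/differentiable_cderivable/differentiableD.
Qed.

Lemma cderivable_sum (I : Type) (r : seq I) (F : I -> K -> K) z :
  (forall i, cderivable (F i) z) -> cderivable (fun w => \sum_(i <- r) F i w) z.
Proof.
move=> dF; apply/differentiable_cderivable/fun_sum_differentiable => i.
exact/cderivable_differentiable.
Qed.

Lemma cderivable_prod (I : Type) (r : seq I) (F : I -> K -> K) z :
  (forall i, cderivable (F i) z) -> cderivable (fun w => \prod_(i <- r) F i w) z.
Proof.
move=> dF; elim: r => [|i r IH].
  by under eq_fun do rewrite big_nil; exact: cderivable_cst.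
by under eq_fun do rewrite big_cons; exact: cderivableM.
Qed.

Lemma cderivable_det n (A : K -> 'M[K]_n) z :
  (forall i j, cderivable (fun w => A w i j) z) -> cderivable (fun w => \det (A w)) z.
Proof.
move=> dA; apply: cderivable_sum => s; apply: cderivableM; first exact: cderivable_cst.
exact: cderivable_prod.
Qed.

Lemma cderivable_mulmx p q r (A : K -> 'M[K]_(p, q)) (B : K -> 'M[K]_(q, r)) z :
  (forall i j, cderivable (fun w => A w i j) z) ->
  (forall i j, cderivable (fun w => B w i j) z) ->
  forall i j, cderivable (fun w => (A w *m B w) i j) z.
Proof.
move=> dA dB i j; under eq_fun do rewrite mxE.
by apply: cderivable_sum => k; apply: cderivableM.
Qed.

Lemma cderivable_eq0 (f : K -> K) z (d : R) : 0 < d -> cderivable f z ->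
  (forall w, w != z -> nm (w - z) < d -> f w = 0) -> f z = 0.
Proof.
move=> d0 df h; apply/eqP; rewrite -nm_eq0 eq_le nm_ge0 andbT.
apply/ler_addgt0Pl => e e0; rewrite addr0.
have [s s0 hs] := cderivable_cont df e0.
pose t := Num.min d s / 2.
have t0 : 0 < t by rewrite divr_gt0 // lt_min d0 s0.
have td : t < d by have : Num.min d s <= d by [rewrite ge_min lexx]; rewrite /t; lra.
have ts : t < s by have : Num.min d s <= s by [rewrite ge_min lexx orbT]; rewrite /t; lra.
have nt : nm (t%:C%C : K) = t by rewrite nm_real ger0_norm // ltW.
have zt : z + t%:C%C - z = t%:C%C by ring.
have := hs (z + t%:C%C); rewrite zt nt => /(_ ts).
rewrite (h (z + t%:C%C)) ?zt ?nt //; first by rewrite sub0r nmN.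
by rewrite -subr_eq0 zt -nm_gt0 nt.
Qed.

(** The determinant is \det D1 times the value at t of the characteristic
    polynomial of X = - D0 D1^-1, all of whose roots are 0. *)
Lemma det_pencil n (D0 D1 : 'M[K]_n) : D1 \in unitmx ->
  (forall t, t != 0 -> D0 + t *: D1 \in unitmx) ->
  forall t, \det (D0 + t *: D1) = \det D1 * t ^+ n.
Proof.
move=> D1u Du t; pose X := - (D0 *m invmx D1).
have DE u : D0 + u *: D1 = (u%:M - X) *m D1.
  by rewrite /X opprK mulmxDl mul_scalar_mx mulmxKV // addrC.
have charE u : \det (u%:M - X) = (char_poly X).[u].
  rewrite /char_poly -[RHS]/(horner_eval u _) -det_map_mx; congr (\det _).
  apply/matrixP => i j; rewrite !mxE /= /horner_eval !hornerE.
  by case: (i == j); rewrite ?hornerX ?hornerC ?mulr1n ?mulr0n.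
have [rs crs] := closed_field_poly_normal (char_poly X).
rewrite (monicP (char_poly_monic X)) scale1r in crs.
have rs0 r : r \in rs -> r = 0.
  move=> rrs; apply/eqP; apply/negPn/negP => r0; have := Du r r0.
  rewrite unitmxE DE det_mulmx charE crs unitfE mulf_eq0 negb_or => /andP[/negP[]].
  by rewrite -[_ == 0]/(root _ r) root_prod_XsubC.
have szrs : size rs = n.
  have := size_char_poly X; rewrite crs size_prod_XsubC => -[]; exact.
have crX : char_poly X = 'X^n.
  rewrite crs; transitivity ('X^(size rs) : {poly K}); last by rewrite szrs.
  rewrite (@eq_big_seq _ _ _ _ rs _ (fun=> 'X)); last by move=> r /rs0 ->; rewrite subr0.
  by rewrite big_const_seq count_predT iter_mulr_1.
by rewrite DE det_mulmx charE crX hornerXn mulrC.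
Qed.

End MatrixFunctions.

(** * Homogeneous coordinates and affine frames *)

Section Charts.
Variable R : realType.
Local Notation F := (C R).
Implicit Types (z w : P1 R) (t : F).

(** The pair (hom0 z t, hom1 z t) is a pair of homogeneous coordinates of loc z
    t. In these coordinates [hdet] is an equation of the diagonal, in all
    charts at once. *)
Definition hom0 z t : F := if z is Some _ then 1 else t.
Definition hom1 z t : F := if z is Some a then a + t else 1.
Definition hdet z w t t' : F := hom0 z t * hom1 w t' - hom1 z t * hom0 w t'.

Definition chart z (x : P1 R) : F :=
  match z, x with
  | Some a, Some b => b - a
  | Some _, None => 0
  | None, Some b => b^-1
  | None, None => 0
  end.

Lemma locK z : cancel (loc z) (chart z).
Proof.
case: z => [a|] t /=; first by rewrite addrC addKr.
by case: eqVneq => [->|_] //=; rewrite invrK.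
Qed.

Lemma loc0 z : loc z 0 = z.
Proof. by case: z => [a|] /=; rewrite ?addr0 ?eqxx. Qed.

Lemma hdet_eq0 z w t t' : (hdet z w t t' == 0) = (loc z t == loc w t' :> option F).
Proof.
rewrite /hdet; case: z w => [a|] [b|] /=.
- by rewrite mul1r mulr1 subr_eq0 eq_sym.
- rewrite mul1r; case: (eqVneq t' 0) => [->|t0]; first by rewrite mulr0 subr0 oner_eq0.
  have -> : (Some (a + t) == Some t'^-1) = (a + t == t'^-1) by [].
  by rewrite subr_eq0 -(inj_eq (mulIf t0) (a + t)) mulVf // eq_sym.
- rewrite mulr1; case: (eqVneq t 0) => [->|t0]; first by rewrite mul0r sub0r oppr_eq0 oner_eq0.
  have -> : (Some t^-1 == Some (b + t')) = (t^-1 == b + t') by [].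
  by rewrite subr_eq0 -(inj_eq (mulfI t0) t^-1) divff // eq_sym.
- rewrite mulr1 mul1r subr_eq0.
  case: (altP (t =P 0)) => [->|t0]; case: (altP (t' =P 0)) => [->|t1]; rewrite ?eqxx //.
  + by rewrite eq_sym (negPf t1).
  + by rewrite (negPf t0).
  + have -> : (Some t^-1 == Some t'^-1) = (t^-1 == t'^-1) by [].
    by rewrite (inj_eq invr_inj).
Qed.

(** The sign of [hdet] relative to the difference of the coordinates of two
    points of the same chart; it changes at infinity, where the homogeneous
    coordinates are exchanged. *)
Definition chart_sign z : F := if z is Some _ then -1 else 1.

Lemma chart_sign2 z : chart_sign z * chart_sign z = 1.
Proof. by case: z => [a|] /=; rewrite ?mulrNN mulr1. Qed.

Lemma hdet_diag z t t' : hdet z z t t' = chart_sign z * (t - t').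
Proof. by case: z => [a|]; rewrite /hdet /=; ring. Qed.

Lemma hom0_differentiable z (W : normedModType F) (k : W -> F) (x : W) :
  differentiable k x -> differentiable (fun u => hom0 z (k u)) x.
Proof. by case: z => [a|] //= _; exact: differentiable_cst. Qed.

Lemma hom1_differentiable z (W : normedModType F) (k : W -> F) (x : W) :
  differentiable k x -> differentiable (fun u => hom1 z (k u)) x.
Proof.
case: z => [a|] dk; last exact: differentiable_cst.
exact: (differentiableD (differentiable_cst a x) dk).
Qed.

Lemma hdet_differentiable z w (x : F * F) :
  differentiable (fun u : F * F => hdet z w u.1 u.2) x.
Proof.
have d1 := differentiable_fst x; have d2 := differentiable_snd x.
by apply: differentiableB; apply: differentiableM;
  (exact: hom0_differentiable || exact: hom1_differentiable).
Qed.

Lemma mulmx_differentiable (W : normedModType F) p q r (A : W -> 'M[F]_(p, q))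
    (B : W -> 'M[F]_(q, r)) (x : W) :
  differentiable A x -> differentiable B x -> differentiable (fun u => A u *m B u) x.
Proof.
move=> dA dB; apply: mx_differentiable => i j; under eq_fun do rewrite mxE.
by apply: fun_sum_differentiable => k; apply: differentiableM; exact: entry_differentiable.
Qed.

Lemma scalemx_differentiable (W : normedModType F) p q (k : W -> F) (A : W -> 'M[F]_(p, q))
    (x : W) :
  differentiable k x -> differentiable A x -> differentiable (fun u => k u *: A u) x.
Proof.
move=> dk dA; apply: mx_differentiable => i j; under eq_fun do rewrite mxE.
by apply: differentiableM => //; exact: entry_differentiable.
Qed.

End Charts.

Lemma cramer_rows (F : fieldType) n d (P Q : 'M[F]_(n, d)) (p q : 'rV[F]_n) (al be ga de g : F) :
  ((al * de - be * ga) * g) *: (p *m P + q *m Q) =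
  (g *: (de *: p - ga *: q)) *m (al *: P + be *: Q)
    + (g *: (al *: q - be *: p)) *m (ga *: P + de *: Q).
Proof.
rewrite -!scalemxAl !mulmxBl !mulmxDr -!scalemxAl -!scalemxAr.
move: (p *m P) (p *m Q) (q *m P) (q *m Q) => pP pQ qP qQ.
by apply/rowP => j; rewrite !mxE; ring.
Qed.

Section Frames.
Variables (R : realType) (n : nat) (V : vectType R) (J : P1 R -> 'End(V)).
Local Notation F := (C R).
Local Notation d := (\dim {:V}).
Implicit Types (z w x y : P1 R) (t : F).

(** The two trivialisations are affine with the same two coefficients, in
    opposite orders, which homogeneous coordinates unify. *)
Lemma pluricomplex_frames : pluricomplex n J -> exists P Q : 'M[F]_(n, d),
  forall z t, is_frame (V10 (J (loc z t))) (hom0 z t *: P + hom1 z t *: Q).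
Proof.
move=> [_ _ [A0 [A1 [hA0 hA1 glue]]] _].
have [||z z0|a0 a1] := @affine_gluing R _ _ A0 A1.
- by move=> z; have [] := hA0 z.
- by move=> z; have [] := hA1 z.
- by rewrite glue // opprK expr1z.
exists (A0 0), (A1 0) => -[a|] t /=.
  by rewrite scale1r -a0; have [] := hA0 (a + t).
by rewrite scale1r addrC -a1; have [] := hA1 t.
Qed.

Lemma pluricomplex_quotients : pluricomplex n J -> exists S T : 'M[F]_(d, n),
  forall z t, is_quotient_map (V10 (J (loc z t))) (hom0 z t *: S + hom1 z t *: T).
Proof.
move=> [_ _ _ [A0 [A1 [hA0 hA1 glue]]]].
have [||z z0|a0 a1] := @affine_gluing R _ _ A0 A1.
- by move=> z; have [] := hA0 z.
- by move=> z; have [] := hA1 z.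
- by rewrite glue // exprN1 scalerA divff // scale1r.
exists (A0 0), (A1 0) => -[a|] t /=.
  by rewrite scale1r -a0; have [] := hA0 (a + t).
by rewrite scale1r addrC -a1; have [] := hA1 t.
Qed.

Lemma frame_mem (E : set 'rV[F]_d) (A : 'M[F]_(n, d)) (u : 'rV_n) :
  is_frame E A -> E (u *m A).
Proof. by move=> [_ h]; apply/h; exact: submxMl. Qed.

End Frames.

(** * From the antipodal relation to the diagonal *)

Section FromAntipodal.
Variables (R : realType) (n : nat) (V : vectType R) (J : P1 R -> 'End(V)).
Local Notation F := (C R).
Local Notation d := (\dim {:V}).
Variables P Q : 'M[F]_(n, d).
Hypothesis n0 : (0 < n)%N.
Hypothesis dimV : d = n.*2.
Hypothesis frameP : forall z t,
  is_frame (V10 (J (loc z t))) (hom0 z t *: P + hom1 z t *: Q).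
Hypothesis anti : forall z, J (antipode z) = - J z.
Hypothesis disj : forall x y v, x <> y -> V10 (J x) v -> V10 (J y) v -> v = 0.
Implicit Types (z w x y : P1 R) (t : F).

Lemma frame0 : is_frame (V10 (J (Some 0))) P.
Proof. by have := frameP (Some 0) 0; rewrite /= addr0 scale1r scale0r addr0. Qed.

Lemma frameoo : is_frame (V10 (J None)) Q.
Proof. by have := frameP None 0; rewrite /= eqxx scale1r scale0r add0r. Qed.

Lemma PQ_full : row_full (col_mx P Q).
Proof.
have [/eqP rP hP] := frame0; have [/eqP rQ hQ] := frameoo.
rewrite /row_full -addsmxE mxrank_disjoint_sum ?rP ?rQ ?dimV ?addnn //.
apply/eqP; rewrite -submx0; apply/row_subP => i; rewrite submx0; apply/eqP.
have := row_sub i (P :&: Q)%MS; rewrite sub_capmx => /andP[/hP h1 /hQ h2].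
exact: (disj _ h1 h2).
Qed.

Let Z := pinvmx (col_mx P Q).
Let Zl : 'M[F]_(d, n) := lsubmx Z.
Let Zr : 'M[F]_(d, n) := rsubmx Z.

Lemma PQ_coord (v : 'rV[F]_d) : v = v *m Zl *m P + v *m Zr *m Q.
Proof.
rewrite -mul_row_col -mul_mx_row hsubmxK mulmxKpV //.
exact: submx_full PQ_full.
Qed.

(** By Cramer's rule ([cramer_rows]), hdet v is the sum of an element of V10 (J
    x) and one of V10 (J y) = V01 (J (antipode y)), with coefficients that are
    polynomial in the coordinates and linear in v. *)
Lemma image_W z w (f : P1 R -> P1 R -> F) (g : F -> F -> F) :
  (\forall t \near (0 : F * F), differentiable (fun u : F * F => g u.1 u.2) t) ->
  near_at z w (fun x y => f x y = hdet z w (chart z x) (chart w y) * g (chart z x) (chart w y)) ->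
  in_annihilator J z w f.
Proof.
move=> dg fg s ds.
pose p x y := s x y *m Zl; pose q x y := s x y *m Zr.
pose fr z t := hom0 z t *: P + hom1 z t *: Q.
pose a x y := (g (chart z x) (chart w y) *:
  (hom1 w (chart w y) *: p x y - hom0 w (chart w y) *: q x y)) *m fr z (chart z x).
pose b x y := (g (chart z x) (chart w y) *:
  (hom0 z (chart z x) *: q x y - hom1 z (chart z x) *: p x y)) *m fr w (chart w y).
exists a, b; split.
- near=> t; rewrite /a; under eq_fun do rewrite !locK.
  have d1 := differentiable_fst t; have d2 := differentiable_snd t.
  have dst : differentiable (fun u => s (loc z u.1) (loc w u.2)) t by near: t.
  apply: mulmx_differentiable.
    apply: scalemx_differentiable; first by near: t.
    apply: differentiableB; apply: scalemx_differentiable.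
    + exact: hom1_differentiable.
    + exact: mulmxr_differentiable.
    + exact: hom0_differentiable.
    + exact: mulmxr_differentiable.
  apply: differentiableD; apply: scalemx_differentiable; try exact: differentiable_cst.
  + exact: hom0_differentiable.
  + exact: hom1_differentiable.
- near=> t; rewrite /b; under eq_fun do rewrite !locK.
  have d1 := differentiable_fst t; have d2 := differentiable_snd t.
  have dst : differentiable (fun u => s (loc z u.1) (loc w u.2)) t by near: t.
  apply: mulmx_differentiable.
    apply: scalemx_differentiable; first by near: t.
    apply: differentiableB; apply: scalemx_differentiable.
    + exact: hom0_differentiable.
    + exact: mulmxr_differentiable.
    + exact: hom1_differentiable.
    + exact: mulmxr_differentiable.
  apply: differentiableD; apply: scalemx_differentiable; try exact: differentiable_cst.
  + exact: hom0_differentiable.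
  + exact: hom1_differentiable.
- near=> t; rewrite /a !locK; apply: frame_mem; exact: frameP.
- near=> t; rewrite anti V01_opp /b !locK; apply: frame_mem; exact: frameP.
- apply: filterS fg => t /= ->; rewrite /a /b !locK.
  set sx := s _ _; rewrite {1}[sx]PQ_coord -/(p _ _).
  by rewrite /p /q -/sx; exact: cramer_rows.
Unshelve. all: by end_near. Qed.

Lemma V10D x u v : V10 (J x) u -> V10 (J x) v -> V10 (J x) (u + v).
Proof.
have := frameP x 0; rewrite loc0 => -[_ h] /h hu /h hv.
by apply/h; exact: addmx_sub.
Qed.

Lemma V10Z x (c : F) v : V10 (J x) v -> V10 (J x) (c *: v).
Proof.
have := frameP x 0; rewrite loc0 => -[_ h] /h hv.
by apply/h; exact: scalemx_sub.
Qed.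

(** A nonzero vector of the space over the point that the chart misses
    (infinity or 0) lies in none of the spaces over the chart. *)
Lemma test_vector z : exists v, forall t, ~ V10 (J (loc z t)) v.
Proof.
(* The only point outside the range of loc z. *)
pose z' : P1 R := if z is Some _ then None else Some 0.
have zz' t : loc z t <> z'.
  rewrite /z' {z'}; case: z => [a|] //=; case: eqVneq => // t0 [] /eqP.
  by rewrite invr_eq0 (negPf t0).
have := frameP z' 0; rewrite loc0; set A := _ + _ => -[/eqP rA hA].
have [v vA v0] : exists2 v : 'rV_d, (v <= A)%MS & v != 0.
  have : A != 0 by rewrite -mxrank_eq0 rA -lt0n.
  by case/rowV0Pn => v; exists v.
exists v => t hv; move/eqP: v0; apply.
exact: (disj (zz' t) hv ((hA v).2 vA)).
Qed.

Lemma near_at_self z w (Pr : P1 R -> P1 R -> Prop) : near_at z w Pr -> Pr z w.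
Proof.
move=> /near2P[e e0 h]; have h0 : nm (0 - 0 : F) < e by rewrite subr0 nm0.
by have := h (0, 0) h0 h0; rewrite /= !loc0.
Qed.

Lemma in_image_diag z (s : P1 R -> P1 R -> complexification V) :
  in_image_W J z z s -> near_at z z (fun x y => x = y -> V10 (J x) (s x y)).
Proof.
move=> [a [b [_ _ ha hb hs]]]; apply: filterS3 ha hb hs => u /= ha hb hs e.
rewrite hs; apply: V10D; first exact: ha.
by move: hb; rewrite anti V01_opp e.
Qed.

Lemma cst_holomorphic (v : complexification V) z w : holomorphic_at z w (fun _ _ => v).
Proof. by near=> t; exact: differentiable_cst. Unshelve. all: by end_near. Qed.

Lemma hdet_near z w : z <> w -> \forall t \near (0 : F * F), hdet z w t.1 t.2 != 0.
Proof.
move=> zw; have /differentiable_continuous hc := @hdet_differentiable R z w 0.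
have h0 : hdet z w (0 : F * F).1 (0 : F * F).2 != 0.
  by rewrite hdet_eq0 !loc0; apply/eqP.
exact: (cvgr_neq0 _ hc h0).
Qed.

Lemma off_diagonal z w (f : P1 R -> P1 R -> F) : z <> w ->
  holomorphic_at z w f -> in_annihilator J z w f.
Proof.
move=> zw df; have hn := hdet_near zw.
apply: (image_W
  (g := fun t t' => f (loc z t) (loc w t') * (hdet z w t t')^-1)).
  near=> t; apply: differentiableM; first by near: t.
  apply: differentiableV; first exact: hdet_differentiable.
  by near: t.
apply: filterS hn => t t0; rewrite !locK mulrCA divff ?mulr1 //.
Unshelve. all: by end_near. Qed.

Lemma on_diagonal z (f : P1 R -> P1 R -> F) :
  holomorphic_at z z f -> in_diagonal_ideal z z f -> in_annihilator J z z f.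
Proof.
move=> /near2P[e1 e10 h1] /near2P[e2 e20 h2].
pose e := Num.min e1 e2.
have e0 : 0 < e by rewrite lt_min e10.
have ee1 : e <= e1 by rewrite ge_min lexx.
have ee2 : e <= e2 by rewrite ge_min lexx orbT.
have [||g [s s0 hg]] := @hadamard R (fun t t' => f (loc z t) (loc z t')) e e0.
- move=> x y hx hy; apply: differentiable_has_cderiv2.
  by apply: (h1 (x, y)); rewrite /= subr0 (lt_le_trans _ ee1).
- by move=> x hx; apply: (h2 (x, x)); rewrite //= subr0 (lt_le_trans _ ee2).
apply: (image_W (g := fun t t' => chart_sign z * g t t')).
  apply/near2P; exists s => // t; rewrite !subr0 => t1 t2.
  have [_ [l1 [l2 hl]]] := hg _ _ t1 t2.
  apply: differentiableM; first exact: differentiable_cst.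
  rewrite [t]surjective_pairing; exact: has_cderiv2_differentiable hl.
apply/near2P; exists s => // t; rewrite !subr0 => t1 t2.
(* In each chart hdet is plus or minus the difference of the coordinates. *)
have [-> _] := hg _ _ t1 t2; rewrite !locK hdet_diag mulrACA.
by rewrite chart_sign2 mul1r.
Qed.

Theorem antipodal_diagonal : characteristic_curve_is_diagonal J.
Proof.
split=> [z w|z w f df].
  split=> [[s [ds ns]]|<-].
    apply: contrapT => zw; apply: ns.
    have := off_diagonal zw (f := fun _ _ => 1) _ ds.
    rewrite (_ : (fun x y => 1 *: s x y) = s); last by apply/funext => x; apply/funext => y; rewrite scale1r.
    by apply; near=> t; exact: differentiable_cst.
  have [v hv] := test_vector z.
  exists (fun _ _ => v); split; first exact: cst_holomorphic.
  move=> /in_image_diag/near_at_self/(_ erefl).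
  by have := hv 0; rewrite loc0.
have [e|zw] := pselect (z = w); last first.
  split=> _; last exact: off_diagonal.
  apply: filterS (hdet_near zw) => t + e.
  by rewrite hdet_eq0 e eqxx.
rewrite -{w}e in df *; split; last exact: on_diagonal.
have [v hv] := test_vector z.
move=> /(_ (fun _ _ => v) (cst_holomorphic _ _ _))/in_image_diag.
apply: filterS => t /= h xy; apply: contrapT => /eqP f0; apply: (hv t.1).
have := V10Z (f (loc z t.1) (loc z t.2))^-1 (h xy).
by rewrite scalerA mulVf // scale1r.
Unshelve. all: by end_near. Qed.

End FromAntipodal.

Section FromHypercomplex.
Variables (R : realType) (V : vectType R) (J : P1 R -> 'End(V)).
Local Notation F := (C R).
Local Notation d := (\dim {:V}).

(** The product relation gives B A = D, and then D D = -1 gives A B A = B. *)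
Lemma quaternion_anticommute (L : comNzRingType) m (A B D : 'M[L]_m) :
  A *m A = - 1%:M -> B *m B = - 1%:M -> D *m D = - 1%:M ->
  D *m (B *m A) = - 1%:M ->
  [/\ A *m B = - (B *m A), A *m D = - (D *m A) & B *m D = - (D *m B)].
Proof.
move=> AA BB DD DBA.
have DE : B *m A = D.
  have : D *m (D *m (B *m A)) = - D by rewrite DBA mulmxN mulmx1.
  by rewrite mulmxA DD mulNmx mul1mx => /oppr_inj.
have AB : A *m B = - (B *m A).
  have BABA : B *m (A *m (B *m A)) = - 1%:M by rewrite mulmxA DE DD.
  have ABA : A *m (B *m A) = B.
    have : B *m (B *m (A *m (B *m A))) = - B by rewrite BABA mulmxN mulmx1.
    by rewrite mulmxA BB mulNmx mul1mx => /oppr_inj.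
  have : A *m (B *m A) *m A = B *m A by rewrite ABA.
  by rewrite -!mulmxA AA !mulmxN mulmx1 => <-; rewrite opprK.
split; first exact: AB.
- by rewrite -DE mulmxA AB mulNmx.
- by rewrite -DE -[_ *m _ *m B]mulmxA AB mulmxN opprK.
Qed.

Lemma quaternion_cmx (I1 I2 I3 : 'End(V)) : quaternion_relations I1 I2 I3 ->
  let A := cmx I1 in let B := cmx I2 in let D := cmx I3 in
  [/\ A *m A = - 1%:M, B *m B = - 1%:M & D *m D = - 1%:M] /\
  [/\ A *m B = - (B *m A), A *m D = - (D *m A) & B *m D = - (D *m B)].
Proof.
move=> [/complex_structureE AA /complex_structureE BB /complex_structureE DD h] A B D.
have DBA : D *m (B *m A) = - 1%:M by rewrite -!cmx_comp h cmxN cmx1.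
by split; [split | exact: quaternion_anticommute].
Qed.

Lemma quaternion_sqr (L : comNzRingType) m (A B D : 'M[L]_m) (a b c : L) :
  [/\ A *m A = - 1%:M, B *m B = - 1%:M & D *m D = - 1%:M] /\
  [/\ A *m B = - (B *m A), A *m D = - (D *m A) & B *m D = - (D *m B)] ->
  (a *: A + b *: B + c *: D) *m (a *: A + b *: B + c *: D) =
    - (a ^+ 2 + b ^+ 2 + c ^+ 2) *: 1%:M.
Proof.
move=> [[AA BB DD] [AB AD BD]].
rewrite !mulmxDl !mulmxDr -!scalemxAl -!scalemxAr AA BB DD AB AD BD.
move: (B *m A) (D *m A) (D *m B) => X Y W.
by apply/matrixP => i j; rewrite !mxE; ring.
Qed.

Lemma hypercomplex_antipode : hypercomplex J -> forall z, J (antipode z) = - J z.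
Proof.
move=> [I1 [I2 [I3 [phi [_ [_ _ _ hphi] hJ]]]]] z.
by rewrite !hJ hphi !mxE !scaleNr !opprD.
Qed.

(** A common (1,0)-vector is killed by J x - J y, whose square is minus the
    squared distance between phi x and phi y. *)
Lemma hypercomplex_disjoint : (forall z, complex_structure (J z)) -> hypercomplex J ->
  forall x y v, x <> y -> V10 (J x) v -> V10 (J y) v -> v = 0.
Proof.
move=> cJ [I1 [I2 [I3 [phi [hq [_ inj _ _] hJ]]]]] x y v xy.
move=> /(V10E _ (cJ x)) hx /(V10E _ (cJ y)) hy.
pose u i := phi x 0 i - phi y 0 i.
have hv : v *m (real_complex R (u 0) *: cmx I1 + real_complex R (u 1) *: cmx I2
    + real_complex R (u 2) *: cmx I3) = 0.
  have -> : real_complex R (u 0) *: cmx I1 + real_complex R (u 1) *: cmx I2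
    + real_complex R (u 2) *: cmx I3 = cmx (J x) - cmx (J y).
    rewrite !hJ !cmxD !cmxZ /u !rmorphB !scalerBl !opprD.
    by rewrite [RHS]addrACA [X in _ = X + _]addrACA.
  by rewrite mulmxBr hx hy subrr.
have := congr1 (mulmx^~ (real_complex R (u 0) *: cmx I1 + real_complex R (u 1) *: cmx I2
    + real_complex R (u 2) *: cmx I3)) hv.
rewrite mul0mx -mulmxA (quaternion_sqr _ _ _ (quaternion_cmx hq)) -scalemxAr mulmx1 scaleNr => /eqP.
rewrite oppr_eq0 scaler_eq0 => /orP[|/eqP //].
rewrite -!rmorphXn -!rmorphD fmorph_eq0 => us.
case: xy; apply: inj; apply/rowP => i.
move: us; rewrite !paddr_eq0 ?addr_ge0 ?sqr_ge0 // !sqrf_eq0 /u !subr_eq0.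
move=> /andP[/andP[/eqP e0 /eqP e1] /eqP e2].
case: i => -[|[|[|//]]] hi.
- by have -> : Ordinal hi = 0 by apply: val_inj.
- by have -> : Ordinal hi = 1 by apply: val_inj.
- by have -> : Ordinal hi = 2 by apply: val_inj.
Qed.

End FromHypercomplex.

Theorem hypercomplex_diagonal (R : realType) (n : nat) (V : vectType R)
    (hn : (0 < n)%N) (hV : \dim (fullv : {vspace V}) = n.*2)
    (J : P1 R -> 'End(V)) : pluricomplex n J -> hypercomplex J ->
  characteristic_curve_is_diagonal J.
Proof.
move=> hJ hh; have [P [Q frameP]] := pluricomplex_frames hJ.
have [cJ _ _ _] := hJ.
exact: antipodal_diagonal hn hV frameP (hypercomplex_antipode hh) (hypercomplex_disjoint cJ hh).
Qed.

(** * From the diagonal to the antipodal relation *)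

Section FromDiagonal.
Variables (R : realType) (n : nat) (V : vectType R) (J : P1 R -> 'End(V)).
Local Notation F := (C R).
Local Notation d := (\dim {:V}).
Hypothesis dimV : d = n.*2.
Hypothesis hJ : pluricomplex n J.
Hypothesis curve : characteristic_curve_is_diagonal J.
Implicit Types (z w x y : P1 R) (t : F).

Lemma V10_eigenspace (I : 'End(V)) v : complex_structure I ->
  V10 I v <-> (v <= eigenspace (cmx I) 'i)%MS.
Proof.
by move=> cI; rewrite (V10E _ cI); split=> h; apply/eigenspaceP.
Qed.

Lemma V01_eigenspace (I : 'End(V)) v : complex_structure I ->
  V01 I v <-> (v <= eigenspace (cmx I) (- 'i))%MS.
Proof.
by move=> cI; rewrite (V01E _ cI); split=> h; apply/eigenspaceP.
Qed.

(** The eigenspaces of I for 'i and - 'i are complementary, and the former has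
    dimension n, half of the total. *)
Lemma V01_frame (I : 'End(V)) (A : 'M[F]_(n, d)) : complex_structure I ->
  is_frame (V10 I) A -> exists A' : 'M[F]_(n, d), is_frame (V01 I) A'.
Proof.
move=> cI [/eqP rA hA]; have Ip v := V10_eigenspace v cI; have Im v := V01_eigenspace v cI.
set E := eigenspace _ 'i in Ip *; set G := eigenspace _ (- 'i) in Im *.
have rE : \rank E = n.
  rewrite -rA; apply/eqP; rewrite eqn_leq; apply/andP; split; apply: mxrankS.
    by apply/row_subP => i; apply/hA/Ip; exact: row_sub.
  by apply/row_subP => i; apply/Ip/hA; exact: row_sub.
have M2 : cmx I *m cmx I = - 1%:M by apply/complex_structureE.
have full : \rank (E + G)%MS = d.
  apply/eqP; rewrite -[_ == _]/(row_full _) -col_leq_rank -{1}(@mxrank1 F d).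
  apply: mxrankS.
  have -> : 1%:M = 2^-1 *: (1%:M - 'i *: cmx I) + 2^-1 *: (1%:M + 'i *: cmx I).
    rewrite -scalerDr addrACA addNr addr0 scalerDr -scalerDl -div1r -splitr.
    by rewrite scale1r.
  apply: addmx_sub_adds; apply: scalemx_sub; apply/eigenspaceP.
    rewrite mulmxBl mul1mx -scalemxAl M2 scalerN opprK scalerBr scalerA mulCii.
    by rewrite scaleN1r opprK addrC.
  rewrite mulmxDl mul1mx -scalemxAl M2 scalerN scalerDr scalerA mulNr mulCii.
  by rewrite opprK scale1r scaleNr addrC.
have cap0 : (E :&: G)%MS = 0.
  apply/eqP; rewrite -submx0; apply/row_subP => i; rewrite submx0.
  have := row_sub i (E :&: G)%MS; rewrite sub_capmx => /andP[/eigenspaceP h1 /eigenspaceP].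
  rewrite h1 => /eqP; rewrite scaleNr -subr_eq0 opprK -scalerDl -mulr2n.
  by rewrite scaler_eq0 mulrn_eq0 /= (negPf (neq0Ci _)).
have rG : \rank G = n.
  have h := mxrank_sum_cap E G; rewrite cap0 mxrank0 addn0 full in h.
  by apply: (@addnI n); rewrite -{1}rE -h dimV -addnn.
have [A' [rA' eA']] : exists A' : 'M[F]_(n, d), row_free A' /\ (A' :=: G)%MS.
  by rewrite -rG; exists (row_base G); rewrite row_base_free; split => //; exact: eq_row_base.
by exists A'; split=> // v; rewrite eA'.
Qed.

Let cJ z : complex_structure (J z). Proof. by have [] := hJ. Qed.

Lemma frames : exists A : P1 R -> 'M[F]_(n, d), forall z, is_frame (V10 (J z)) (A z).
Proof.
have [P [Q h]] := pluricomplex_frames hJ.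
by exists (fun z => hom0 z 0 *: P + hom1 z 0 *: Q) => z; have := h z 0; rewrite loc0.
Qed.

Lemma coframes : exists A : P1 R -> 'M[F]_(n, d),
  forall y, is_frame (V01 (J (antipode y))) (A y).
Proof.
have [A hA] := frames.
have [f hf] := choice (fun y => V01_frame (cJ _) (hA (antipode y))).
by exists f.
Qed.

(** Since (x, y) is not in the support, all constant vectors decompose, so the
    two spaces span; by dimension count they are complementary. *)
Lemma transverse x y v : x <> y -> V10 (J x) v -> V01 (J (antipode y)) v -> v = 0.
Proof.
move=> xy; have [A hA] := frames; have [A' hA'] := coframes.
have [/eqP rA mA] := hA x; have [/eqP rA' mA'] := hA' y.
have full : \rank (A x + A' y)%MS = d.
  apply/eqP; rewrite -[_ == _]/(row_full _) -col_leq_rank -{1}(@mxrank1 F d).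
  apply: mxrankS.
  apply/row_subP => i; pose e := row i (1%:M : 'M[F]_d).
  have im : in_image_W J x y (fun _ _ => e).
    apply: contrapT => ns; apply/xy/(curve.1 x y).1; exists (fun _ _ => e); split=> //.
    exact: cst_holomorphic.
  case: im => a [b [_ _ /near_at_self ha /near_at_self hb /near_at_self hs]].
  rewrite -[X in (X <= _)%MS]/e hs.
  by apply: addmx_sub_adds; [apply/mA|apply/mA'].
move=> /mA h1 /mA' h2.
have c0 : (A x :&: A' y)%MS = 0.
  have h := mxrank_sum_cap (A x) (A' y); rewrite full in h.
  apply/eqP; rewrite -mxrank_eq0; apply/eqP/(@addnI d).
  rewrite h addn0; apply: (etrans (y := (n + n)%N)); first by congr addn.
  by rewrite addnn dimV.
have : (v <= A x :&: A' y)%MS by rewrite sub_capmx h1 h2.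
by rewrite c0 submx0 => /eqP.
Qed.

(** A local equation of the diagonal at the points (Some c, Some c). *)
Definition zdiff (x y : P1 R) : F :=
  match x, y with Some a, Some b => a - b | _, _ => 0 end.

Lemma zdiff_annihilator (c : F) : in_annihilator J (Some c) (Some c) zdiff.
Proof.
apply/(curve.2 (Some c) (Some c) zdiff).
  near=> t; rewrite /zdiff /=.
  have d1 := differentiable_fst t; have d2 := differentiable_snd t.
  by apply: differentiableB; apply: differentiableD => //; exact: differentiable_cst.
by near=> t; rewrite /zdiff /= => -[->]; rewrite subrr.
Unshelve. all: by end_near. Qed.

(** The germ [zdiff] kills the class of the constant section e; the
    decomposition is then restricted to the line y = c, where zdiff is t. *)
Lemma splitting (c : F) (e : 'rV[F]_d) : exists be : F -> 'rV[F]_d,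
  (forall j, cderivable (fun t => be t 0 j) 0) /\
  \forall t \near (0 : F), V01 (J (antipode (Some c))) (be t) /\
    V10 (J (Some (c + t))) (t *: e - be t).
Proof.
have [a [b [_ db ha hb hs]]] := zdiff_annihilator (cst_holomorphic e (Some c) (Some c)).
exists (fun t => b (Some (c + t)) (Some c)); split=> [j|].
  have /near2P[s s0 hd] := db.
  have d0 : nm (0 - 0 : F) < s by rewrite subr0 nm0.
  have /(entry_differentiable 0 j) := hd (0, 0) d0 d0.
  move=> /(@differentiable_has_cderiv2 R (fun u1 u2 => b (loc (Some c) u1) (loc (Some c) u2) 0 j)).
  move=> [l1 [l2 /has_cderiv2_1 hl]]; exists l1.
  by move: hl; rewrite /= addr0.
have /near2P[s1 s10 h1] := ha; have /near2P[s2 s20 h2] := hb; have /near2P[s3 s30 h3] := hs.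
apply/near1P; exists (Num.min s1 (Num.min s2 s3)); first by rewrite !lt_min s10 s20.
move=> t; rewrite !lt_min => /and3P[t1 t2 t3].
have d1 : nm (0 - 0 : F) < s1 by rewrite subr0 nm0.
have d2 : nm (0 - 0 : F) < s2 by rewrite subr0 nm0.
have d3 : nm (0 - 0 : F) < s3 by rewrite subr0 nm0.
have := h1 (t, 0) t1 d1; have := h2 (t, 0) t2 d2; have := h3 (t, 0) t3 d3.
rewrite /= /loc /zdiff !addr0 => e1 e2 e3; split=> //.
have -> : t *: e = (c + t - c) *: e by rewrite [c + t]addrC addrK.
by rewrite e1 addrK.
Qed.

(** Let A be a frame of V01 (J (antipode (Some c))) and B t the quotient map
    with kernel V10 (J (Some (c + t))). By [transverse] the pencil A *m B t
    satisfies the hypotheses of [det_pencil], so its determinant is a constant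
    times t^n; by [splitting], t *: (L *m B t) = G t *m (A *m B t) with G
    differentiable and L *m B 0 = 1. Comparing determinants and letting t tend
    to 0, G 0 is invertible, whence A *m B 0 = 0. *)
Theorem coframe_in_frame (c : F) v :
  V01 (J (antipode (Some c))) v -> V10 (J (Some c)) v.
Proof.
have [A' /(_ (Some c)) [fA' mA']] := coframes; set A := A' (Some c) in fA' mA'.
have [S [T quot]] := pluricomplex_quotients hJ.
pose B t := (S + c *: T) + t *: T.
have Bq t : is_quotient_map (V10 (J (Some (c + t)))) (B t).
  by have := quot (Some c) t; rewrite /= scale1r scalerDl addrA.
have Too : is_quotient_map (V10 (J None)) T.
  by have := quot None 0; rewrite /= eqxx scale0r add0r scale1r.
have unit x (X : 'M[F]_(d, n)) : x <> Some c -> is_quotient_map (V10 (J x)) X ->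
    A *m X \in unitmx.
  move=> xc [_ hX]; rewrite -row_free_unit; apply: inj_row_free => u.
  rewrite mulmxA => /hX h1; have h2 : V01 (J (antipode (Some c))) (u *m A).
    by apply/mA'; exact: submxMl.
  have := transverse xc h1 h2 => /eqP; rewrite mulmx_free_eq0 // => /eqP; exact.
pose D0 := A *m (S + c *: T); pose D1 := A *m T.
have AB t : A *m B t = D0 + t *: D1 by rewrite mulmxDr -scalemxAr.
have D1u : D1 \in unitmx by apply: (unit None).
have Du t : t != 0 -> D0 + t *: D1 \in unitmx.
  move=> t0; rewrite -AB; apply: (unit _ _ _ (Bq t)) => -[] /eqP.
  by rewrite -subr_eq0 addrC addKr (negPf t0).
have [be hbe] := choice (fun i : 'I_d => splitting c (delta_mx 0 i)).
pose b t := \matrix_(i < d) be i t.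
have [L hL] : exists L, L *m B 0 = 1%:M by have [/row_fullP] := Bq 0.
pose G t := L *m b t *m pinvmx A.
have key : \forall t \near (0 : F), t *: (L *m B t) = G t *m (D0 + t *: D1).
  have FF : Filter (nbhs (0 : F)) by exact: nbhs_filter.
  have hall := @filter_forall F 'I_d (fun i t => V01 (J (antipode (Some c))) (be i t) /\
    V10 (J (Some (c + t))) (t *: delta_mx 0 i - be i t)) (nbhs (0 : F)) FF (fun i => (hbe i).2).
  apply: filterS hall => t ht.
  have bA : b t *m pinvmx A *m A = b t.
    apply: mulmxKpV; apply/row_subP => i; rewrite rowK; apply/mA'.
    by have [] := ht i.
  have bB : b t *m B t = t *: B t.
    apply/row_matrixP => i; rewrite row_mul rowK linearZ /= [in RHS]rowE.
    have [_ /(Bq t).2] := ht i; rewrite mulmxBl => /eqP; rewrite subr_eq0 => /eqP <-.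
    by rewrite scalemxAl.
  by rewrite -AB /G mulmxA -!(mulmxA L) bA bB -scalemxAr.
(* For t <> 0 the common factor t ^+ n cancels from the determinants of both
   sides of key; g is continuous, so it also vanishes at 0. *)
pose g t := \det (L *m B t) - \det (G t) * \det D1.
have g0 : g 0 = 0.
  have /near1P[s s0 hs] := key; apply: (cderivable_eq0 s0) => [|t t0 ts]; last first.
    have := congr1 (fun X => \det X) (hs t ts); rewrite /= detZ det_mulmx.
    rewrite (det_pencil D1u Du) mulrA [_ * t ^+ n]mulrC => /(mulfI (expf_neq0 n t0)).
    by rewrite /g => ->; rewrite subrr.
  have cst_d p q (X : 'M[F]_(p, q)) i j : cderivable (fun t : F => X i j) 0.
    exact: cderivable_cst.
  have dB i j : cderivable (fun t => B t i j) 0.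
    under eq_fun do rewrite [B _ _ _]mxE [(_ *: T) _ _]mxE.
    apply: cderivableD; first exact: cderivable_cst.
    apply: cderivableM; [exact: cderivable_id | exact: cderivable_cst].
  have db i j : cderivable (fun t => b t i j) 0.
    by under eq_fun do rewrite mxE; have [] := hbe i.
  have dN (f : F -> F) : cderivable f 0 -> cderivable (fun t => - f t) 0.
    move=> df; have -> : (fun t => - f t) = fun t => -1 * f t.
      by apply/funext => t; rewrite mulN1r.
    by apply: cderivableM => //; exact: cderivable_cst.
  apply: cderivableD; first by apply: cderivable_det; exact: cderivable_mulmx.
  apply: dN; apply: cderivableM; last exact: cderivable_cst.
  apply: cderivable_det; apply: cderivable_mulmx; last exact: cst_d.
  by apply: cderivable_mulmx.
have G0u : G 0 \in unitmx.
  rewrite unitmxE unitfE; apply/eqP => G0; move/eqP: g0.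
  by rewrite /g hL det1 G0 mul0r subr0 oner_eq0.
have D00 : D0 = 0.
  have := nbhs_singleton key; rewrite !scale0r addr0 => h.
  by apply: (can_inj (mulKmx G0u)); rewrite -h mulmx0.
move=> /mA' /submxP[u ->]; have := Bq 0; rewrite addr0 => -[_ h]; apply/h.
by rewrite -mulmxA AB scale0r addr0 D00 mulmx0.
Qed.

(** The relation at infinity is the one at 0, read backwards. *)
Theorem diagonal_antipode z : J (antipode z) = - J z.
Proof.
case: z => [c|]; first by apply: V01_V10_opp => v; exact: coframe_in_frame.
have : J (antipode (Some 0)) = - J (Some 0).
  by apply: V01_V10_opp => v; exact: coframe_in_frame.
by rewrite /= eqxx => ->; rewrite opprK.
Qed.

Theorem diagonal_disjoint x y v : x <> y -> V10 (J x) v -> V10 (J y) v -> v = 0.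
Proof.
move=> xy h1 h2; apply: (transverse xy h1).
by rewrite diagonal_antipode V01_opp.
Qed.

End FromDiagonal.

(** * Stereographic projection *)

Section Stereographic.
Variable R : realType.
Local Notation F := (C R).
Local Notation Re := (@complex.Re R).
Local Notation Im := (@complex.Im R).
Implicit Types (z : P1 R) (t x : F).

Definition row3 (a b c : R) : 'rV[R]_3 := \row_j nth 0 [:: a; b; c] j.

Lemma row3E (a b c : R) :
  [/\ row3 a b c 0 0 = a, row3 a b c 0 1 = b & row3 a b c 0 2 = c].
Proof. by split; rewrite mxE. Qed.

Lemma row3_eta (u : 'rV[R]_3) : u = row3 (u 0 0) (u 0 1) (u 0 2).
Proof.
apply/rowP => -[[|[|[|//]]] hi]; rewrite mxE /=; congr (u _ _); exact: val_inj.
Qed.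

Lemma row3N (a b c : R) : - row3 a b c = row3 (- a) (- b) (- c).
Proof. by apply/rowP => -[[|[|[|//]]] hi]; rewrite !mxE. Qed.

(** The sign of the third coordinate is such that the three structures at 0, 1
    and - 'i, taken in this order, have product -1. *)
Definition stereo z : 'rV[R]_3 :=
  if z is Some x then let s := 1 + Re x ^+ 2 + Im x ^+ 2 in
    row3 ((1 - Re x ^+ 2 - Im x ^+ 2) / s) (2 * Re x / s) (- (2 * Im x) / s)
  else row3 (-1) 0 0.

Lemma den_gt0 (a b : R) : 0 < 1 + a ^+ 2 + b ^+ 2.
Proof. by have := sqr_ge0 a; have := sqr_ge0 b; lra. Qed.

Lemma stereo_inj : injective stereo.
Proof.
have oo x : stereo (Some x) <> stereo None.
  move=> /(congr1 (fun u : 'rV_3 => u 0 0)); rewrite /= !mxE /=.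
  set a := Re x; set b := Im x; have := den_gt0 a b => s0 e.
  have sn : 1 + a ^+ 2 + b ^+ 2 != 0 by rewrite gt_eqF.
  by have := divfK sn (1 - a ^+ 2 - b ^+ 2); rewrite e; lra.
case=> [x|] [y|] //; [|by move/oo|by move/esym/oo].
move=> e; congr Some; have e0 := congr1 (fun u : 'rV_3 => u 0 0) e.
have e1 := congr1 (fun u : 'rV_3 => u 0 1) e; have e2 := congr1 (fun u : 'rV_3 => u 0 2) e.
move: e0 e1 e2; rewrite /= !mxE /= {e}.
case: x y => a b [c d] /=; have s0 := den_gt0 a b; have s1 := den_gt0 c d.
have n0 : 1 + a ^+ 2 + b ^+ 2 != 0 by rewrite gt_eqF.
have n1 : 1 + c ^+ 2 + d ^+ 2 != 0 by rewrite gt_eqF.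
move=> /eqP; rewrite eqr_div // => /eqP e0.
have es : a ^+ 2 + b ^+ 2 = c ^+ 2 + d ^+ 2 by nra.
have -> : 1 + c ^+ 2 + d ^+ 2 = 1 + a ^+ 2 + b ^+ 2 by lra.
have si : (1 + a ^+ 2 + b ^+ 2)^-1 != 0 by rewrite invr_eq0 gt_eqF.
by move=> /(mulIf si) h1 /(mulIf si) h2; congr Complex; lra.
Qed.

Lemma stereo_range : range stereo = @unit_sphere R.
Proof.
apply/seteqP; split=> [u [z _ <-]|u].
  rewrite /unit_sphere /=; case: z => [x|] /=; rewrite !big_ord_recl big_ord0 !mxE /=.
    by set a := Re x; set b := Im x; have s0 := den_gt0 a b; field; rewrite gt_eqF.
  by ring.
rewrite /unit_sphere /= [u]row3_eta; set a := u 0 0; set b := u 0 1; set c := u 0 2.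
rewrite !big_ord_recl big_ord0 !mxE /= addr0 => h.
have [a1|a1] := eqVneq a (-1).
  exists None => //=; rewrite a1.
  have [-> ->] : b = 0 /\ c = 0; last by [].
  move: h; rewrite a1; have := sqr_ge0 b; have := sqr_ge0 c => hc hb h.
  by split; apply/eqP; rewrite -sqrf_eq0; apply/eqP; lra.
have a2 : 1 + a != 0 by rewrite addrC -[1]opprK subr_eq0.
exists (Some (Complex (b / (1 + a)) (- c / (1 + a)))) => //=.
have es : 1 + (b / (1 + a)) ^+ 2 + (- c / (1 + a)) ^+ 2 = 2 / (1 + a).
  have -> : 1 + (b / (1 + a)) ^+ 2 + (- c / (1 + a)) ^+ 2 =
    ((1 + a) ^+ 2 + (b ^+ 2 + c ^+ 2)) / (1 + a) ^+ 2 by field.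
  have -> : b ^+ 2 + c ^+ 2 = 1 - a ^+ 2 by lra.
  by field.
have es' : 1 - (b / (1 + a)) ^+ 2 - (- c / (1 + a)) ^+ 2 = 2 * a / (1 + a).
  have -> : 1 - (b / (1 + a)) ^+ 2 - (- c / (1 + a)) ^+ 2 =
    2 - (1 + (b / (1 + a)) ^+ 2 + (- c / (1 + a)) ^+ 2) by ring.
  by rewrite es; field.
by rewrite es es'; congr row3; field.
Qed.

Lemma stereo_antipode z : stereo (antipode z) = - stereo z.
Proof.
case: z => [x|]; last first.
  by rewrite /= row3N; congr row3; rewrite /= ?expr0n /=; field.
rewrite /antipode; case: eqVneq => [->|x0].
  by rewrite /= row3N; congr row3; rewrite /= ?expr0n /=; field.
have -> : - (x^*)^-1 = Complex (- Re x / (Re x ^+ 2 + Im x ^+ 2)) (- Im x / (Re x ^+ 2 + Im x ^+ 2)) :> F.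
  case: x x0 => a b _ /=.
  transitivity (- (Complex (a / (a ^+ 2 + (- b) ^+ 2)) (- (- b / (a ^+ 2 + (- b) ^+ 2)))) : F); first by [].
  transitivity (Complex (- (a / (a ^+ 2 + (- b) ^+ 2))) (- - (- b / (a ^+ 2 + (- b) ^+ 2))) : F); first by [].
  by rewrite sqrrN opprK !mulNr.
rewrite /stereo /= row3N.
set a := Re x; set b := Im x.
have r0 : a ^+ 2 + b ^+ 2 != 0.
  by rewrite -nm_sqr sqrf_eq0 nm_eq0.
have s0 : 1 + a ^+ 2 + b ^+ 2 != 0 by rewrite gt_eqF // den_gt0.
have s1 : 1 + (- a / (a ^+ 2 + b ^+ 2)) ^+ 2 + (- b / (a ^+ 2 + b ^+ 2)) ^+ 2 =
   (1 + a ^+ 2 + b ^+ 2) / (a ^+ 2 + b ^+ 2) by field.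
by rewrite s1; congr row3; field; rewrite r0 s0.
Qed.

Lemma stereo_oo t : stereo (loc None t) = let s := 1 + Re t ^+ 2 + Im t ^+ 2 in
  row3 ((Re t ^+ 2 + Im t ^+ 2 - 1) / s) (2 * Re t / s) (2 * Im t / s).
Proof.
rewrite /loc; case: eqVneq => [->|t0].
  by rewrite /= ; congr row3; rewrite /= ?expr0n /=; field.
have -> : t^-1 = Complex (Re t / (Re t ^+ 2 + Im t ^+ 2)) (- (Im t / (Re t ^+ 2 + Im t ^+ 2))) :> F.
  by case: t t0.
rewrite /=; set a := Re t; set b := Im t.
have r0 : a ^+ 2 + b ^+ 2 != 0.
  by rewrite -nm_sqr sqrf_eq0 nm_eq0.
have s0 : 1 + a ^+ 2 + b ^+ 2 != 0 by rewrite gt_eqF // den_gt0.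
have s1 : 1 + (a / (a ^+ 2 + b ^+ 2)) ^+ 2 + (- (b / (a ^+ 2 + b ^+ 2))) ^+ 2 =
   (1 + a ^+ 2 + b ^+ 2) / (a ^+ 2 + b ^+ 2) by field.
by rewrite s1; congr row3; field; rewrite r0 s0.
Qed.

Lemma Re_continuous : continuous (Re : F -> R).
Proof.
move=> x; apply/(@cvgrPdist_lt _ _ _ (nbhs x)) => e e0; apply/near1P; exists e => // t xt.
by rewrite -ReN -ReD; apply: le_lt_trans (Re_le_nm _) _; rewrite nmB.
Qed.

Lemma Im_continuous : continuous (Im : F -> R).
Proof.
move=> x; apply/(@cvgrPdist_lt _ _ _ (nbhs x)) => e e0; apply/near1P; exists e => // t xt.
by rewrite -ImN -ImD; apply: le_lt_trans (Im_le_nm _) _; rewrite nmB.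
Qed.

Lemma row3_continuous (f g h : F -> R) : continuous f -> continuous g -> continuous h ->
  continuous (fun t => row3 (f t) (g t) (h t)).
Proof.
move=> cf cg ch.
have -> : (fun t => row3 (f t) (g t) (h t)) = fun t =>
    f t *: row3 1 0 0 + g t *: row3 0 1 0 + h t *: row3 0 0 1.
  apply/funext => t; apply/rowP => -[[|[|[|//]]] hi]; rewrite !mxE /=; ring.
move=> x; apply: (@cvgD _ _ _ (nbhs x)); first apply: (@cvgD _ _ _ (nbhs x));
  apply: (@cvgZr_tmp _ _ _ (nbhs x)).
- exact: cf.
- exact: cg.
- exact: ch.
Qed.

Lemma stereo_continuous z : continuous (fun t : F => stereo (loc z t)).
Proof.
have sqrc (f : F -> R) : continuous f -> continuous (fun t => f t ^+ 2).
  by move=> cf x; exact: (@cvgM _ _ (nbhs x) _ _ _ _ _ (cf x) (cf x)).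
have addc (f g : F -> R) : continuous f -> continuous g -> continuous (fun t => f t + g t).
  by move=> cf cg x; apply: (@cvgD _ _ _ (nbhs x)); [exact: cf|exact: cg].
have oppc (f : F -> R) : continuous f -> continuous (fun t => - f t).
  by move=> cf x; apply: (@cvgN _ _ _ (nbhs x)); exact: cf.
have cstc (a : R) : continuous (fun _ : F => a) by move=> x; apply: (@cvg_cst _ _ _ (nbhs x)).
have mulc (f g : F -> R) : continuous f -> continuous g -> continuous (fun t => f t * g t).
  by move=> cf cg x; apply: (@cvgM _ _ (nbhs x)); [exact: cf|exact: cg].
have divc (f g h : F -> R) : continuous f -> continuous g -> continuous h ->
    continuous (fun t => f t / (1 + g t ^+ 2 + h t ^+ 2)).
  move=> cf cg ch; have cd : continuous (fun t => 1 + g t ^+ 2 + h t ^+ 2).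
    apply: (addc (fun t => 1 + g t ^+ 2)); last exact: sqrc.
    by apply: (addc (fun=> 1)); [exact: cstc | exact: sqrc].
  apply: mulc => // x; apply: (@cvgV _ _ (nbhs x)); first by rewrite gt_eqF // den_gt0.
  exact: cd.
case: z => [a|].
  have ca : continuous (fun t : F => Re (a + t)).
    have -> : (fun t : F => Re (a + t)) = fun t => Re a + Re t by apply/funext => t; rewrite ReD.
    by apply: addc => //; exact: Re_continuous.
  have cb : continuous (fun t : F => Im (a + t)).
    have -> : (fun t : F => Im (a + t)) = fun t => Im a + Im t by apply/funext => t; rewrite ImD.
    by apply: addc => //; exact: Im_continuous.
  apply: row3_continuous; apply: divc => //.
  - apply: (addc (fun t => 1 - Re (a + t) ^+ 2)); last by apply: oppc; exact: sqrc.
    by apply: (addc (fun=> 1)); [exact: cstc | apply: oppc; exact: sqrc].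
  - exact: mulc.
  - apply: oppc; exact: mulc.
under eq_fun do rewrite stereo_oo.
have [ca cb] := (Re_continuous, Im_continuous).
apply: row3_continuous; apply: divc => //.
- apply: (addc (fun t => Re t ^+ 2 + Im t ^+ 2)) => //.
  by apply: addc; exact: sqrc.
- exact: mulc.
- exact: mulc.
Qed.

Theorem stereo_identification : antipodal_identification stereo.
Proof.
split; [exact: stereo_continuous | exact: stereo_inj | exact: stereo_range | exact: stereo_antipode].
Qed.

End Stereographic.

(** * From the antipodal relation to the quaternions *)

(** The first formula is the first equation plus x times the second, the other
    one is y times the first equation minus the second. *)
Lemma solve_action (L : comNzRingType) n m (P Q X Y : 'M[L]_(n, m)) (i x y : L) :
  X + x *: Y = i *: (P + x *: Q) -> y *: X - Y = - i *: (y *: P - Q) ->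
  (1 + x * y) *: X = i *: ((1 - x * y) *: P + (2 * x) *: Q) /\
  (1 + x * y) *: Y = i *: ((2 * y) *: P + (x * y - 1) *: Q).
Proof.
move=> h1 h2; split.
  have -> : (1 + x * y) *: X = (X + x *: Y) + x *: (y *: X - Y).
    by apply/matrixP => k l; rewrite !mxE; ring.
  by rewrite h1 h2; apply/matrixP => k l; rewrite !mxE; ring.
have -> : (1 + x * y) *: Y = y *: (X + x *: Y) - (y *: X - Y).
  by apply/matrixP => k l; rewrite !mxE; ring.
by rewrite h1 h2; apply/matrixP => k l; rewrite !mxE; ring.
Qed.

Lemma antipodal_row (L : fieldType) n m (P Q : 'M[L]_(n, m)) (M : 'M[L]_m) (i y : L) :
  y != 0 -> (P - y^-1 *: Q) *m - M = i *: (P - y^-1 *: Q) ->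
  y *: (P *m M) - Q *m M = - i *: (y *: P - Q).
Proof.
move=> y0 /(congr1 (fun X => - y *: X)).
have -> : y *: P - Q = y *: (P - y^-1 *: Q).
  by rewrite scalerBr scalerA divff // scale1r.
rewrite mulmxN mulmxBl -scalemxAl scalerN !scaleNr opprK scalerBr !scalerA.
by rewrite divff // scale1r => ->; rewrite mulrC.
Qed.

Section Quaternions.
Variables (R : realType) (n : nat) (V : vectType R) (J : P1 R -> 'End(V)).
Local Notation F := (C R).
Local Notation d := (\dim {:V}).
Local Notation rc := (real_complex R).
Variables P Q : 'M[F]_(n, d).
Hypothesis frameP : forall z t,
  is_frame (V10 (J (loc z t))) (hom0 z t *: P + hom1 z t *: Q).
Hypothesis full : row_full (col_mx P Q).
Hypothesis anti : forall z, J (antipode z) = - J z.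
Hypothesis cJ : forall z, complex_structure (J z).
Implicit Types (z : P1 R) (x : F).

Lemma frame_eigen z (A : 'M[F]_(n, d)) :
  is_frame (V10 (J z)) A -> A *m cmx (J z) = 'i *: A.
Proof.
move=> hA; apply/row_matrixP => k; rewrite row_mul linearZ /=.
by apply/(V10E _ (cJ z)); rewrite rowE; exact: frame_mem hA.
Qed.

(** The endomorphism J (Some x) is 'i on the rows of P + x *: Q and - 'i on
    those of x^* *: P - Q, which frame the space over the antipode of x. *)
Lemma action x : let M := cmx (J (Some x)) in
  (1 + x * x^*) *: (P *m M) = 'i *: ((1 - x * x^*) *: P + (2 * x) *: Q) /\
  (1 + x * x^*) *: (Q *m M) = 'i *: ((2 * x^*) *: P + (x * x^* - 1) *: Q).
Proof.
move=> M; apply: solve_action.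
  have := frameP (Some x) 0; rewrite loc0 /= addr0 scale1r => /frame_eigen.
  by rewrite mulmxDl -scalemxAl.
have hM : cmx (J (antipode (Some x))) = - M by rewrite anti cmxN.
have [x0|x0] := eqVneq x 0.
  have := frameP None 0; rewrite loc0 /= scale0r add0r scale1r => /frame_eigen.
  have -> : None = antipode (Some x) :> P1 R by rewrite /= x0 eqxx.
  rewrite hM x0 conjC0 !scale0r !sub0r mulmxN => ->.
  by rewrite scaleNr scalerN opprK.
have := frameP (antipode (Some x)) 0; rewrite loc0 => /frame_eigen; rewrite hM.
rewrite /= (negPf x0) /= addr0 scale1r scaleNr; apply: antipodal_row.
by rewrite conjC_eq0.
Qed.

Lemma full_inj (A B : 'M[F]_d) : P *m A = P *m B -> Q *m A = Q *m B -> A = B.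
Proof. by move=> hP hQ; apply: (row_full_inj full); rewrite !mul_col_mx hP hQ. Qed.

Lemma double_inj m p (X Y : 'M[F]_(m, p)) : (1 + 1 : F) *: X = (1 + 1) *: Y -> X = Y.
Proof. by apply: scalerI; rewrite -mulr2n pnatr_eq0. Qed.

Lemma action0 : P *m cmx (J (Some 0)) = 'i *: P /\ Q *m cmx (J (Some 0)) = - 'i *: Q.
Proof.
have [] := action 0; rewrite /= mul0r conjC0 mulr0 addr0 subr0 sub0r !scale1r !scale0r.
by rewrite addr0 add0r scaleN1r scalerN scaleNr.
Qed.

Lemma action1 : P *m cmx (J (Some 1)) = 'i *: Q /\ Q *m cmx (J (Some 1)) = 'i *: P.
Proof.
have [] := action 1; rewrite /= conjC1 !mulr1 subrr !scale0r addr0 add0r => h1 h2.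
by split; apply: double_inj; rewrite ?h1 ?h2 !scalerA mulrC.
Qed.

Lemma actionNi : P *m cmx (J (Some (- 'i))) = Q /\ Q *m cmx (J (Some (- 'i))) = - P.
Proof.
have iC : (- 'i : F)^* = 'i by rewrite -[RHS]opprK -[X in _ = - X](@conjCi F) -rmorphN.
have [] := action (- 'i); rewrite iC mulNr mulCii opprK subrr !scale0r.
rewrite addr0 add0r => h1 h2.
split; apply: double_inj; rewrite ?h1 ?h2 !scalerA.
  by congr (_ *: _); rewrite mulrCA mulrN mulCii opprK mulr1.
by rewrite mulrCA mulCii mulrN1 scaleNr scalerN.
Qed.

(** On the rows of P and Q, which span, the formulas of [action] are linear in
    the stereographic coordinates of x. *)
Theorem antipodal_hypercomplex : hypercomplex J.
Proof.
have [p0 q0] := action0; have [p1 q1] := action1; have [p2 q2] := actionNi.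
exists (J (Some 0)), (J (Some 1)), (J (Some (- 'i))), (@stereo R); split.
- split; try exact: cJ.
  apply: cmx_inj; rewrite !cmx_comp cmxN cmx1; apply: full_inj.
    rewrite !mulmxA p2 q1 -scalemxAl p0 scalerA mulCii scaleN1r.
    by rewrite mulmxN mulmx1.
  rewrite !mulmxA q2 mulNmx p1 mulNmx -scalemxAl q0 scalerA mulrN mulCii opprK scale1r.
  by rewrite mulmxN mulmx1.
- exact: stereo_identification.
case=> [x|]; last first.
  have [-> -> ->] := row3E (-1 : R) 0 0.
  have := anti (Some 0); rewrite /= eqxx => ->.
  by rewrite !scale0r !addr0 scaleN1r.
rewrite /stereo; set s := 1 + complex.Re x ^+ 2 + _; set a := _ / s; set b := _ / s; set c := _ / s.
have [-> -> ->] := row3E a b c.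
apply: cmx_inj; rewrite !cmxD !cmxZ.
have s0 : s != 0 by rewrite gt_eqF // den_gt0.
have S0 : rc s != 0 by rewrite fmorph_eq0.
have xE : x = rc (complex.Re x) + 'i * rc (complex.Im x) by exact: complexE.
have xC : x^* = rc (complex.Re x) - 'i * rc (complex.Im x).
  transitivity (rc (complex.Re x) + 'i * rc (- complex.Im x)); last by rewrite rmorphN mulrN.
  by case: (x) => a' b'; exact: complexE.
set r := rc (complex.Re x) in xE xC; set m := rc (complex.Im x) in xE xC.
have i2 : 'i * 'i = -1 :> F by exact: mulCii.
have xx : x * x^* = r ^+ 2 + m ^+ 2.
  rewrite {1}xE xC; transitivity (r ^+ 2 - 'i * 'i * m ^+ 2); first by ring.
  by rewrite i2; ring.
have sE : rc s = 1 + x * x^* by rewrite xx /s !rmorphD !rmorphXn rmorph1 addrA.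
have aE : (rc s : F) * (rc a : F) = 1 - x * x^*.
  by rewrite -rmorphM mulrC /a divfK // xx !rmorphB !rmorphXn rmorph1 opprD addrA.
have bE : (rc s : F) * (rc b : F) = 2 * r by rewrite -rmorphM mulrC /b divfK // rmorphM rmorph_nat.
have cE : (rc s : F) * (rc c : F) = - (2 * m).
  by rewrite -rmorphM mulrC /c divfK // rmorphN rmorphM rmorph_nat.
have [hp hq] := action x; rewrite -sE in hp hq.
apply: full_inj; apply: (scalerI S0); rewrite ?hp ?hq !mulmxDr -!scalemxAr.
  rewrite p0 p1 p2 !scalerDr !scalerA aE bE -addrA -scalerDl.
  congr (_ *: _ + _ *: _); first exact: mulrC.
  transitivity (2 * r * 'i + - (2 * m)); last by congr (_ + _); exact: esym cE.
  rewrite {1}xE; transitivity (2 * r * 'i + 2 * ('i * 'i) * m); first by ring.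
  by rewrite i2; ring.
rewrite q0 q1 q2 !scalerDr scalerN -scaleNr !scalerA aE bE mulrN.
rewrite -addrA -scalerDl [RHS]addrC; congr (_ *: _ + _ *: _); last by ring.
transitivity (2 * r * 'i + - - (2 * m)); last by congr (_ + _); rewrite -cE -mulrN.
rewrite xC; transitivity (2 * r * 'i - 2 * ('i * 'i) * m); first by ring.
by rewrite i2; ring.
Qed.

End Quaternions.

Theorem proposition3p17 (R : realType) (n : nat) (V : vectType R)
    (hn : (0 < n)%N) (hV : \dim (fullv : {vspace V}) = n.*2)
    (K : P1 R -> 'End(V)) (hK : pluricomplex n K) :
  hypercomplex K <-> characteristic_curve_is_diagonal K.
Proof.
split; first by move=> h; exact: (hypercomplex_diagonal hn hV hK h).
move=> curve; have [P [Q frameP]] := pluricomplex_frames hK.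
have [cK _ _ _] := hK; have disj := diagonal_disjoint hV hK curve.
exact: antipodal_hypercomplex frameP (PQ_full hV frameP disj) (diagonal_antipode hV hK curve) cK.
Qed.
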